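(* Any Lamé curve of odd degree and signature $1$ over $\bar{\mathbf Q}$ can be defined over a number field unramified above $2$ and has good reduction (in the sense of potentially good reduction) at any prime lying above $2$. Furthermore, the number of ($\bar{\mathbf Q}$-isomorphism classes of) Lamé curves of odd degree and signature $1$ defined over a fixed number field $K$ can be bounded by a constant only depending on the maximal degree of the residual extensions of $K$ at $2$ (i.e. on the maximum, over the primes $\mathfrak p$ of $K$ above $2$, of the degree of the residue field of $\mathfrak p$ over $\mathbf F_2$).
   Context: Let $E$ be an elliptic curve over an algebraically closed field $k$ of characteristic $\neq 3$, with identity $0_E$, and let $P\in E(k)$ be a torsion point of exact order $n>1$, with $n$ not divisible by the characteristic of $k$. There is $f_P\in k(E)$, unique up to a multiplicative constant, with divisor $n(P)-n(0_E)$; it induces a degree $n$ cover $f_P:E\to\mathbf P^1_k$. The pair $(E,P)$ is a Lamé curve of order (or degree) $n$ if $f_P$ is tamely ramified and is ramified exactly at $0_E$ and $P$, with ramification index $n$, and at one third point $Q$, with ramification index $3$. In this case $2Q=P$ in $E(k)$, and the signature of $(E,P)$ is $1$ if $Q$ has order $n$ and $0$ if $Q$ has order $2n$. Here $k=\bar{\mathbf Q}$, and Lamé curves of all odd orders are considered together. A Lamé curve $(E,P)$ over $\bar{\mathbf Q}$ is defined over a number field $K$ if it is $\bar{\mathbf Q}$-isomorphic to a pair $(E_0,P_0)$ with $E_0$ an elliptic curve over $K$ and $P_0\in E_0(K)$. Convention: ''good reduction'' of a Lamé curve $(E,P)$ means that the elliptic curve $E$ has potentially good reduction, i.e. its $j$-invariant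 is integral at the given prime. *)

(* Defs.v *)
From HB Require Import structures.
From mathcomp Require Import all_boot all_order all_algebra all_field.
From mathcomp Require Import zify ring.

Set Implicit Arguments.
Unset Strict Implicit.
Unset Printing Implicit Defensive.

Import GRing.Theory Num.Theory.
Local Open Scope ring_scope.

(* The curve y^2 + a1 x y + a3 y = x^3 + a2 x^2 + a4 x + a6.  The record does
   not contain smoothness, which is the separate predicate [elliptic]. *)
Record weierstrass (F : Type) := Weierstrass
  { wa1 : F; wa2 : F; wa3 : F; wa4 : F; wa6 : F }.

Definition map_weierstrass (F G : Type) (f : F -> G) (E : weierstrass F) :=
  Weierstrass (f (wa1 E)) (f (wa2 E)) (f (wa3 E)) (f (wa4 E)) (f (wa6 E)).

(* [Inf] is the point at infinity, the identity 0_E of the group law. *)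
Inductive point (F : Type) := Inf | Aff of F & F.
Arguments Inf {F}.

Definition map_point (F G : Type) (f : F -> G) (R : point F) : point G :=
  match R with Inf => Inf | Aff x y => Aff (f x) (f y) end.

Section Weierstrass.
Variables (F : fieldType) (E : weierstrass F).
Local Notation a1 := (wa1 E).
Local Notation a2 := (wa2 E).
Local Notation a3 := (wa3 E).
Local Notation a4 := (wa4 E).
Local Notation a6 := (wa6 E).

Definition wb2 := a1 ^+ 2 + 4%:R * a2.
Definition wb4 := 2%:R * a4 + a1 * a3.
Definition wb6 := a3 ^+ 2 + 4%:R * a6.
Definition wb8 := a1 ^+ 2 * a6 + 4%:R * a2 * a6 - a1 * a3 * a4
                  + a2 * a3 ^+ 2 - a4 ^+ 2.
Definition wc4 := wb2 ^+ 2 - 24%:R * wb4.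
Definition wdisc := - wb2 ^+ 2 * wb8 - 8%:R * wb4 ^+ 3 - 27%:R * wb6 ^+ 2
                    + 9%:R * wb2 * wb4 * wb6.
Definition elliptic := wdisc != 0.
Definition jinv := wc4 ^+ 3 / wdisc.

Definition on_curve (R : point F) : Prop :=
  match R with
  | Inf => True
  | Aff x y => y ^+ 2 + a1 * x * y + a3 * y
               = x ^+ 3 + a2 * x ^+ 2 + a4 * x + a6
  end.

(* Chord-tangent law: [l] and [nu] are the slope and the intercept of the line
   through the two points (the tangent line if they coincide). *)
Definition addp (R S : point F) : point F :=
  match R, S with
  | Inf, _ => S
  | _, Inf => R
  | Aff x1 y1, Aff x2 y2 =>
    if (x1 == x2) && (y1 + y2 + a1 * x2 + a3 == 0) then Inf else
    let l := if x1 == x2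
      then (3%:R * x1 ^+ 2 + 2%:R * a2 * x1 + a4 - a1 * y1)
           / (2%:R * y1 + a1 * x1 + a3)
      else (y2 - y1) / (x2 - x1) in
    let nu := y1 - l * x1 in
    let x3 := l ^+ 2 + a1 * l - a2 - x1 - x2 in
    Aff x3 (- (l + a1) * x3 - nu - a3)
  end.

Definition mulp (n : nat) (R : point F) : point F := iter n (addp R) Inf.

Definition exact_order (R : point F) (n : nat) : Prop :=
  [/\ (0 < n)%N, mulp n R = Inf &
      forall m : nat, (0 < m < n)%N -> mulp m R <> Inf].

(* The Weierstrass equation as a polynomial in Y over the field F(X). *)
Definition weq_lin : {poly F} := a1 *: 'X + a3%:P.
Definition weq_rhs : {poly F} := 'X^3 + a2 *: 'X^2 + a4 *: 'X + a6%:P.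
Definition weq : {poly {fraction {poly F}}} :=
  'X^2 + (tofrac weq_lin)%:P * 'X - (tofrac weq_rhs)%:P.

Lemma size_weq_lin : (size weq_lin <= 2)%N.
Proof.
apply: leq_trans (size_polyD _ _) _; rewrite geq_max.
rewrite (leq_trans (size_scale_leq _ _)) ?size_polyX //=.
by rewrite (leq_trans (size_polyC_leq1 _)).
Qed.

Lemma size_weq_rhs : size weq_rhs = 4.
Proof.
rewrite /weq_rhs -!addrA size_polyDl ?size_polyXn //.
apply: leq_ltn_trans (size_polyD _ _) _; rewrite gtn_max.
rewrite (leq_ltn_trans (size_scale_leq _ _)) ?size_polyXn //=.
apply: leq_ltn_trans (size_polyD _ _) _; rewrite gtn_max.
rewrite (leq_ltn_trans (size_scale_leq _ _)) ?size_polyX //=.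
by rewrite (leq_ltn_trans (size_polyC_leq1 _)).
Qed.

Lemma size_weq_tail :
  (size ((tofrac weq_lin)%:P * 'X - (tofrac weq_rhs)%:P)%R < 3)%N.
Proof.
apply: leq_ltn_trans (size_polyD _ _) _; rewrite gtn_max size_polyN.
apply/andP; split; last by rewrite (leq_ltn_trans (size_polyC_leq1 _)).
by rewrite mul_polyC (leq_ltn_trans (size_scale_leq _ _)) ?size_polyX.
Qed.

Lemma size_weq : size weq = 3.
Proof. by rewrite /weq -addrA size_polyDl size_polyXn // size_weq_tail. Qed.

Lemma monic_weq : weq \is monic.
Proof.
rewrite monicE /weq -addrA lead_coefDl ?lead_coefXn //.
by rewrite size_polyXn size_weq_tail.
Qed.

(* Y = a / b cannot be a root: compare degrees after clearing denominators. *)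
Lemma weq_no_ratio (a b : {poly F}) : b != 0 ->
  a ^+ 2 + weq_lin * a * b - weq_rhs * b ^+ 2 != 0.
Proof.
move=> b0; apply/negP => /eqP.
have sb : (0 < size b)%N by rewrite size_poly_gt0.
have rhs0 : weq_rhs != 0 by rewrite -size_poly_gt0 size_weq_rhs.
have sr : size (weq_rhs * b ^+ 2)%R = (3 + (size b).-1.*2).+1.
  rewrite size_mul ?expf_neq0 // size_weq_rhs expr2 size_mul //.
  by rewrite -[size b]prednK // -addnn /= addSn addnS.
have sl : (size (weq_lin * a * b)%R
           <= 2 + (size a).-1 + (size b).-1)%N.
  have [->|a0] := eqVneq a 0; first by rewrite mulr0 mul0r size_poly0.
  have sa : (0 < size a)%N by rewrite size_poly_gt0.
  apply: leq_trans (size_polyMleq _ _) _.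
  rewrite -{1}[size b]prednK // addnS /= leq_add2r.
  apply: leq_trans (size_polyMleq _ _) _.
  by rewrite -{1}[size a]prednK // addnS /= leq_add2r size_weq_lin.
have [->|a0] := eqVneq a 0.
  rewrite expr0n /= mulr0 mul0r !add0r => /eqP.
  by rewrite oppr_eq0 mulf_eq0 (negPf rhs0) expf_eq0 (negPf b0).
have sa : (0 < size a)%N by rewrite size_poly_gt0.
have sq : size (a ^+ 2) = ((size a).-1.*2).+1.
  by rewrite expr2 size_mul // -[size a]prednK // -addnn /= addnS.
move: sl sr sq.
set s := (size a).-1; set t := (size b).-1 => sl sr sq.
have [lt|ge] := leqP s t.+1.
- move/eqP; rewrite subr_eq0 => /eqP eqP.
  have : (size (a ^+ 2 + weq_lin * a * b)%R <= (2 + t.*2).+1)%N.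
    apply: leq_trans (size_polyD _ _) _; rewrite geq_max sq; lia.
  rewrite eqP sr; lia.
- move/eqP; rewrite -addrA addr_eq0 => /eqP eqP.
  have : (size (weq_lin * a * b - weq_rhs * b ^+ 2)%R <= s.*2)%N.
    apply: leq_trans (size_polyD _ _) _; rewrite geq_max size_polyN sr; lia.
  rewrite -size_polyN -eqP sq; lia.
Qed.

Lemma frac_ratio (r : {fraction {poly F}}) :
  exists a b : {poly F}, b != 0 /\ r = tofrac a / tofrac b.
Proof.
exists (\n_(repr r)), (\d_(repr r)); split; first exact: denom_ratioP.
apply: (canRL (mulfK _)); first by rewrite tofrac_eq0 denom_ratioP.
rewrite -{1}[r]reprK; unlock tofrac.
rewrite -[LHS]FracField.pi_mul; apply/eqmodP.
rewrite /= FracField.equivfE /FracField.mulf.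
by rewrite !numden_Ratio ?mulf_neq0 ?denom_ratioP ?oner_neq0 // !mulr1 mulrC.
Qed.

Lemma monic_irreducible_weq : monic_irreducible_poly weq.
Proof.
split; last exact: monic_weq.
apply: cubic_irreducible; first by rewrite size_weq.
move=> r; have [a [b [b0 ->]]] := frac_ratio r.
have fb0 : tofrac b != 0 by rewrite tofrac_eq0.
apply/negP => /eqP.
rewrite /weq !(hornerD, hornerN, hornerM, hornerC, hornerX, hornerXn) => H.
have := weq_no_ratio a b0.
rewrite -tofrac_eq0 tofracB tofracD !tofracM.
move/negP; apply; apply/eqP.
have := congr1 (fun z => z * (tofrac b) ^+ 2) H.
rewrite mul0r => <-.
have clear_denom (K : fieldType) (u v l c : K) : v != 0 ->
  u * u + l * u * v - c * (v * v) = (u / v * (u / v) + l * (u / v) - c) * (v * v).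
  by move=> v0; field.
by rewrite !expr2 (clear_denom _ _ _ _ _ fb0).
Qed.

(* The function field F(E) = F(X)[Y] / (weq). *)
Definition funfield := {poly %/ weq with monic_irreducible_weq}.

Definition fconst (c : F) : funfield := in_qpoly weq (tofrac c%:P)%:P.
Definition fx : funfield := in_qpoly weq (tofrac 'X)%:P.
Definition fy : funfield := in_qpoly weq 'X.

(* A bivariate polynomial is a polynomial in Y whose coefficients are
   polynomials in X. *)
Definition eval2 (g : {poly {poly F}}) (a b : F) : F := g.[b%:P].[a].
Definition feval2 (g : {poly {poly F}}) (u v : funfield) : funfield :=
  (map_poly (map_poly fconst) g).[v%:P].[u].

(* Affine coordinates around R: (x, y) if R is affine, and (x / y, 1 / y),
   in which R is the origin, if R is at infinity. *)
Definition chart_u (R : point F) := if R is Aff _ _ then fx else fx / fy.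
Definition chart_v (R : point F) := if R is Aff _ _ then fy else fy^-1.
Definition value_at (R : point F) (g : {poly {poly F}}) : F :=
  if R is Aff a b then eval2 g a b else eval2 g 0 0.
Definition germ (R : point F) (g : {poly {poly F}}) : funfield :=
  feval2 g (chart_u R) (chart_v R).

(* The local ring of E at R, its maximal ideal and its units. *)
Definition local_ring (R : point F) (f : funfield) : Prop :=
  exists g h : {poly {poly F}},
    value_at R h != 0 /\ f = germ R g / germ R h.
Definition max_ideal (R : point F) (f : funfield) : Prop :=
  exists g h : {poly {poly F}},
    [/\ value_at R g = 0, value_at R h != 0 & f = germ R g / germ R h].
Definition local_unit (R : point F) (f : funfield) : Prop :=
  exists g h : {poly {poly F}},
    [/\ value_at R g != 0, value_at R h != 0 & f = germ R g / germ R h].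

Definition uniformizer (R : point F) (t : funfield) : Prop :=
  max_ideal R t /\
  forall f, max_ideal R f -> exists2 g, local_ring R g & f = t * g.

(* The order of f at R is m; this fails for every m if f = 0. *)
Definition order_at (R : point F) (f : funfield) (m : int) : Prop :=
  exists t w, [/\ uniformizer R t, local_unit R w & f = t ^ m * w].

(* f, seen as a cover of the projective line, has ramification index e at R:
   f - f(R) vanishes to order e, or f has a pole of order e. *)
Definition cover_index (R : point F) (f : funfield) (e : nat) : Prop :=
  (0 < e)%N /\
  ((exists c : F, order_at R (f - fconst c) e%:Z) \/
   order_at R f (- e%:Z)).

(* div f = n (P) - n (0_E) *)
Definition div_torsion (P : point F) (n : nat) (f : funfield) : Prop :=
  [/\ order_at P f n%:Z, order_at Inf f (- n%:Z) &
      forall R, on_curve R -> R <> P -> R <> Inf -> order_at R f 0].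

(* (E, P) is a Lame curve of order n, and Q is the third ramification point.
   Since f_P is unique up to a constant factor, the choice of f does not
   matter.  The last clause is tameness. *)
Definition lame_with (P : point F) (n : nat) (Q : point F) : Prop :=
  [/\ elliptic,
      [/\ on_curve P, (1 < n)%N, n%:R != 0 :> F & exact_order P n],
      [/\ on_curve Q, Q <> Inf & Q <> P] &
      exists f, [/\ div_torsion P n f,
        [/\ cover_index Inf f n, cover_index P f n & cover_index Q f 3],
        forall R, on_curve R -> R <> Inf -> R <> P -> R <> Q ->
          cover_index R f 1 &
        forall R e, on_curve R -> cover_index R f e -> e%:R != 0 :> F]].

Definition lame_curve (P : point F) (n : nat) : Prop :=
  exists Q, lame_with P n Q.

Definition signature (P : point F) (n s : nat) : Prop :=
  exists2 Q, lame_with P n Q &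
    (s = 1%N /\ exact_order Q n) \/ (s = 0%N /\ exact_order Q (2 * n)%N).

End Weierstrass.

(* Isomorphisms of elliptic curves are the admissible changes of variables
   x = u^2 x' + r, y = u^3 y' + s u^2 x' + t (x, y on E and x', y' on E');
   they map 0_E to 0_E'.  Those considered here also map P to P'. *)
Definition weierstrass_change (F : fieldType) (u r s t : F)
    (E E' : weierstrass F) : Prop :=
  [/\ u * wa1 E' = wa1 E + 2%:R * s,
      u ^+ 2 * wa2 E' = wa2 E - s * wa1 E + 3%:R * r - s ^+ 2,
      u ^+ 3 * wa3 E' = wa3 E + r * wa1 E + 2%:R * t,
      u ^+ 4 * wa4 E' = wa4 E - s * wa3 E + 2%:R * r * wa2 E
        - (t + r * s) * wa1 E + 3%:R * r ^+ 2 - 2%:R * s * t &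
      u ^+ 6 * wa6 E' = wa6 E + r * wa4 E + r ^+ 2 * wa2 E + r ^+ 3
        - t * wa3 E - t ^+ 2 - r * t * wa1 E].

Definition point_change (F : fieldType) (u r s t : F) (R' : point F) :=
  if R' is Aff x y
  then Aff (u ^+ 2 * x + r) (u ^+ 3 * y + s * u ^+ 2 * x + t) else Inf.

Definition pair_iso (F : fieldType) (E : weierstrass F) (P : point F)
    (E' : weierstrass F) (P' : point F) : Prop :=
  exists u r s t : F,
    [/\ u != 0, weierstrass_change u r s t E E' &
        P = point_change u r s t P'].

(* (E, P) over Omega has a model over K, embedded in Omega by iota. *)
Definition defined_over (K Omega : fieldType) (iota : K -> Omega)
    (E : weierstrass Omega) (P : point Omega) : Prop :=
  exists (E0 : weierstrass K) (P0 : point K),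
    [/\ elliptic E0, on_curve E0 P0 &
        pair_iso E P (map_weierstrass iota E0) (map_point iota P0)].

(* Primes of the ring of integers of an algebraic extension L of the rationals,
   possibly of infinite degree. *)
Section Primes.
Variable L : fieldType.

Definition is_integer (x : L) : Prop := integralOver (intr : int -> L) x.

Definition prime_ideal (pp : L -> Prop) : Prop :=
  [/\ forall x, pp x -> is_integer x,
      [/\ pp 0, forall x y, pp x -> pp y -> pp (x + y) &
          forall x y, is_integer x -> pp y -> pp (x * y)],
      ~ pp 1 &
      forall x y, is_integer x -> is_integer y -> pp (x * y) ->
        pp x \/ pp y].

Definition prime_over (p : nat) (pp : L -> Prop) : Prop :=
  prime_ideal pp /\ pp p%:R.

(* x belongs to the localization of the ring of integers at pp. *)
Definition integral_at (pp : L -> Prop) (x : L) : Prop :=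
  exists a b, [/\ is_integer a, is_integer b, ~ pp b & x = a / b].

Fixpoint ideal_exp (pp : L -> Prop) (m : nat) : L -> Prop :=
  if m is m'.+1 then fun x => exists (k : nat) (a b : 'I_k -> L),
    [/\ forall i, pp (a i), forall i, ideal_exp pp m' (b i) &
        x = \sum_i a i * b i]
  else is_integer.

Definition ramification_index (p : nat) (pp : L -> Prop) (e : nat) : Prop :=
  ideal_exp pp e p%:R /\ ~ ideal_exp pp e.+1 p%:R.

Definition unramified_above (p : nat) : Prop :=
  forall pp, prime_over p pp -> ramification_index p pp 1.

(* The classes modulo pp of b_0, ..., b_(d-1) form a basis of the residue
   field over 'F_p. *)
Definition residue_degree (p : nat) (pp : L -> Prop) (d : nat) : Prop :=
  exists b : 'I_d -> L, (forall i, is_integer (b i)) /\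
    forall x, is_integer x -> exists! c : {ffun 'I_d -> 'F_p},
      pp (x - \sum_i (nat_of_ord (c i))%:R * b i).

Definition max_residue_degree (p d : nat) : Prop :=
  (exists2 pp, prime_over p pp & residue_degree p pp d) /\
  forall pp d', prime_over p pp -> residue_degree p pp d' -> (d' <= d)%N.

End Primes.

(* Here pp is a prime of the ring of all algebraic integers. *)
Definition potentially_good_reduction (pp : algC -> Prop)
    (E : weierstrass algC) : Prop := integral_at pp (jinv E).

(* Main.v *)
From HB Require Import structures.
Require Import Defs.
From mathcomp Require Import all_boot all_order all_algebra all_field.
From mathcomp Require Import cyclic.
From mathcomp Require Import boolp.
From mathcomp Require classical_sets.
From mathcomp Require Import ring zify.

Set Implicit Arguments.
Unset Strict Implicit.
Unset Printing Implicit Defensive.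

Import GRing.Theory Num.Theory.
Local Open Scope ring_scope.

(** The theorem rests on one identity between the slopes of tangents.  Let (E, P)
be a Lame curve of odd order n and signature 1, with third ramification point
Q, so that Q has order n and 2Q = P.  Doubling permutes the multiples of Q;
say 2^j Q = Q.  Then
  the sum over i < j of 2^(j-1-i) slope(2^i Q) vanishes,
where slope(R) is the derivative dY/2dx at R, for Y = 2y + a1 x + a3
(lemma [lame_cycle]).

The identity is proved in k(E), with the derivation D such that Dx = Y.  For an
affine point R put u_R = (Y + Y_R) / (2 (x - x_R)): its only affine pole is R,
where it looks like a logarithmic derivative Dt/t.
- The function f_P has neither zeros nor poles at affine points other than P,
  hence D f_P / f_P = m (u_P - lambda) with m > 0 and lambda a constant.  The
  ramification index 3 at Q says that this vanishes doubly at Q: a line of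
  slope lambda through -P is tangent to E at Q.  Therefore 2Q = P and
  lambda = slope(Q) ([ramification_equations], [tangent_double]).
- The quotient of a tangent line by a vertical line shows that
  2 u_R - u_2R + slope(R) is a logarithmic derivative ([addp_dlog]).  Iterating
  it along the cycle of Q gives that (2^j - 1) u_Q + S is one, for S the sum
  above.  The first item makes 2m u_Q one as well, hence also 2m S.
- A constant c which is a logarithmic derivative is zero: a solution T of
  DT = cT has no zero or pole at affine points, hence is constant
  ([principal], [dlog_cst0]).

The arithmetic takes place on y^2 + axy + y = x^3, a form which every E acquires
by moving a flex to the origin ([deuring_form]).  Let x_i, y_i, l_i be the
coordinates and the tangent slopes of the points 2^i Q, so that
2^(k-1-i) (2 l_i + a) sums to zero over a period k; let A be a valuation ring
with maximal ideal m containing 2.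
- Good reduction.  If a is in A, so are the x_i, since otherwise doubling would
  strictly increase the pole for ever, and so are the l_i.  All terms of the
  sum but the last a are even, so a is in m ([cyc_supersingular]).  If a is not
  in A, rescaling replaces it by 1 and the same argument yields 1 in m.  So
  a is in m, the discriminant a^3 - 27 is a unit and j is in A.
- Ramification.  Since a is even, doubling is congruent modulo 2 to x -> x^4,
  y -> y^4 + 1, and every element z of the local ring S generated by a, the
  x_i and the y_i satisfies z^q = z modulo 2S for a power q of 2 ([frob_gen]).
  If z is in m, then z (1 - z^(q-1)) is in 2S and so is z.  Hence 2 generates
  the maximal ideal of S, and the field generated by a, the x_i and the y_i is
  unramified above 2 ([max_div2]); it is a field of definition.
- Finiteness.  Doubling contracts residue classes, so congruent x_i of one
  cycle are equal ([cyc_x_inj]).  If (E, P) is defined over K, the ratios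
  (x_i - x_1) / (x_2 - x_1) with i > 0 lie in K; there are at most 2^d of them,
  and k0 = 2 (2^d)! is a period of every cycle ([bounded_period]).  Two cycles
  with the same period and congruent x_0, y_0 coincide: by the recursion, the
  ideal generated by the differences of their data is contained in its product
  with m ([cyc_rigid]).  The class of x_0 is a root of X^(4^k0) - X and
  determines that of y_0 up to the automorphism -1, which leaves at most 4^k0
  isomorphism classes ([lame_bound]). *)

(** * Quadratic extensions of F(x), values and the derivation *)

(** The field F(x)[Y] / (Y^2 - psi), given by what is used of it: [hf_gen] and
    [hf_free] say that 1 and Y form a basis over the fractions of F[x]. *)
Record hyperelliptic_field (F : fieldType) (psi : {poly F}) (K : fieldType) :=
  HyperellipticField {
    px : {rmorphism {poly F} -> K};
    yy : K;
    yy_sqr : yy ^+ 2 = px psi;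
    hf_gen : forall z, exists A B C, C != 0 /\ z = (px A + px B * yy) / px C;
    hf_free : forall A B, px A + px B * yy = 0 -> A = 0 /\ B = 0 }.

Section FunctionField.
Variables (F : closedFieldType) (psi : {poly F}) (K : fieldType).
Hypothesis char0 : forall n, n.+1%:R != 0 :> F.
Variable k : hyperelliptic_field psi K.
Local Notation px := (px k).
Local Notation yy := (yy k).

Definition el (A B : {poly F}) : K := px A + px B * yy.
Definition ev (A B : {poly F}) (a b : F) : F := A.[a] + B.[a] * b.

Lemma px_inj : injective px.
Proof.
move=> A B eAB; apply/eqP; rewrite -subr_eq0; apply/eqP.
have [] // := @hf_free _ _ _ k (A - B) 0.
by rewrite rmorphB eAB subrr rmorph0 mul0r addr0.
Qed.

Lemma px_eq0 A : (px A == 0) = (A == 0).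
Proof. by rewrite -(rmorph0 px) (inj_eq px_inj). Qed.

Lemma el_inj A B C D : el A B = el C D -> A = C /\ B = D.
Proof.
move=> /eqP; rewrite -subr_eq0 => /eqP e.
have [] := @hf_free _ _ _ k (A - C) (B - D).
  by rewrite !rmorphB -[RHS]e /el; ring.
by move=> /eqP; rewrite subr_eq0 => /eqP -> /eqP; rewrite subr_eq0 => /eqP ->.
Qed.

Lemma el_eq0 A B : el A B = 0 -> A = 0 /\ B = 0.
Proof. exact: hf_free. Qed.

Lemma el_px A : el A 0 = px A. Proof. by rewrite /el rmorph0 mul0r addr0. Qed.
Lemma el_yy : el 0 1 = yy. Proof. by rewrite /el rmorph0 rmorph1 mul1r add0r. Qed.

Lemma elM A B C D : el A B * el C D = el (A * C + B * D * psi) (A * D + B * C).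
Proof. by rewrite /el !(rmorphM, rmorphD) /= -yy_sqr; ring. Qed.

Lemma elD A B C D : el A B + el C D = el (A + C) (B + D).
Proof. by rewrite /el !rmorphD; ring. Qed.

Lemma elN A B : - el A B = el (- A) (- B).
Proof. by rewrite /el !rmorphN; ring. Qed.

Lemma el_den z : exists A B C, C != 0 /\ z * px C = el A B.
Proof.
have [A [B [C [C0 ->]]]] := hf_gen k z; exists A, B, C; split=> //.
by rewrite divfK // px_eq0.
Qed.

(** The value at the point (a, b) of Y^2 = psi is a relation, since an
    element of K is not given with a fraction whose denominator is nonzero
    at the point. *)
Definition val_at (a b : F) (z : K) (v : F) : Prop :=
  exists A B C D, [/\ ev C D a b != 0, z * el C D = el A B
                    & v * ev C D a b = ev A B a b].
Definition regular a b z := exists v, val_at a b z v.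

Section Point.
Variables (a b : F).
Hypothesis onab : b ^+ 2 = psi.[a].

Lemma evM A B C D : ev A B a b * ev C D a b
                    = ev (A * C + B * D * psi) (A * D + B * C) a b.
Proof. rewrite /ev !hornerE -onab; ring. Qed.
Lemma evD A B C D : ev A B a b + ev C D a b = ev (A + C) (B + D) a b.
Proof. rewrite /ev !hornerD; ring. Qed.
Lemma evN A B : - ev A B a b = ev (- A) (- B) a b.
Proof. rewrite /ev !hornerN; ring. Qed.

Lemma ev_neq0 A B : ev A B a b != 0 -> el A B != 0.
Proof.
apply: contra => /eqP /el_eq0[-> ->]; by rewrite /ev !horner0 mul0r addr0.
Qed.

Lemma val_el A B : val_at a b (el A B) (ev A B a b).
Proof.
exists A, B, 1, 0; rewrite el_px rmorph1 mulr1 /ev horner0 hornerC.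
by rewrite mul0r addr0 mulr1 oner_eq0.
Qed.

Lemma val_px A : val_at a b (px A) A.[a].
Proof.
have := val_el A 0; by rewrite el_px /ev horner0 mul0r addr0.
Qed.

Lemma val_yy : val_at a b yy b.
Proof.
by have := val_el 0 1; rewrite el_yy /ev horner0 hornerC mul1r add0r.
Qed.

Lemma val_unique z v w : val_at a b z v -> val_at a b z w -> v = w.
Proof.
move=> [A [B [C [D [n1 e1 q1]]]]] [A' [B' [C' [D' [n2 e2 q2]]]]].
have e : el A B * el C' D' = el A' B' * el C D.
  by rewrite -e1 -e2; ring.
move: e; rewrite !elM => /el_inj[eq1 eq2].
apply: (mulIf n1); apply: (mulIf n2).
by rewrite q1 [RHS]mulrAC q2 !evM eq1 eq2.
Qed.

Lemma val_add z w u v :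
  val_at a b z u -> val_at a b w v -> val_at a b (z + w) (u + v).
Proof.
move=> [A [B [C [D [n1 e1 q1]]]]] [A' [B' [C' [D' [n2 e2 q2]]]]].
exists (A * C' + B * D' * psi + (A' * C + B' * D * psi)),
  (A * D' + B * C' + (A' * D + B' * C)),
  (C * C' + D * D' * psi), (C * D' + D * C').
rewrite -evM -elM -evD -elD -!evM -!elM -!e1 -!e2 -q1 -q2 mulf_neq0 //.
by split=> //; ring.
Qed.

Lemma val_mul z w u v :
  val_at a b z u -> val_at a b w v -> val_at a b (z * w) (u * v).
Proof.
move=> [A [B [C [D [n1 e1 q1]]]]] [A' [B' [C' [D' [n2 e2 q2]]]]].
exists (A * A' + B * B' * psi), (A * B' + B * A'),
  (C * C' + D * D' * psi), (C * D' + D * C').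
rewrite -!evM -!elM -!e1 -!e2 -q1 -q2 mulf_neq0 //.
by split=> //; ring.
Qed.

Lemma val_opp z u : val_at a b z u -> val_at a b (- z) (- u).
Proof.
move=> [A [B [C [D [n1 e1 q1]]]]].
exists (- A), (- B), C, D; rewrite -evN -elN -e1 -q1; split=> //; ring.
Qed.

Lemma val_sub z w u v :
  val_at a b z u -> val_at a b w v -> val_at a b (z - w) (u - v).
Proof. by move=> h1 h2; apply: val_add => //; apply: val_opp. Qed.

Lemma val_inv z u : val_at a b z u -> u != 0 -> val_at a b z^-1 u^-1.
Proof.
move=> [A [B [C [D [n1 e1 q1]]]]] u0.
exists C, D, A, B; have n2 : ev A B a b != 0 by rewrite -q1 mulf_neq0.
have z0 : z != 0.
  apply/eqP => z0; move: e1 (ev_neq0 n2); rewrite z0 mul0r => <-.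
  by rewrite eqxx.
by rewrite -e1 -q1 mulf_neq0 // !mulKf.
Qed.

Lemma val_div z w u v : val_at a b z u -> val_at a b w v -> v != 0 ->
  val_at a b (z / w) (u / v).
Proof. by move=> h1 h2 v0; apply: val_mul => //; apply: val_inv. Qed.

Lemma val_cst c : val_at a b (px c%:P) c.
Proof. by have := val_px c%:P; rewrite hornerC. Qed.

Lemma val_exp z u n : val_at a b z u -> val_at a b (z ^+ n) (u ^+ n).
Proof.
move=> h; elim: n => [|n IH]; last by rewrite !exprS; apply: val_mul.
by rewrite !expr0 -(rmorph1 px); apply: val_cst.
Qed.

Lemma val0 : val_at a b 0 0.
Proof. by rewrite -(rmorph0 px); apply: val_cst. Qed.
Lemma val_nat n : val_at a b n%:R n%:R.
Proof.
by have := val_cst n%:R; rewrite polyC_natr rmorph_nat.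
Qed.

Lemma val_neq0 z u : val_at a b z u -> u != 0 -> z != 0.
Proof.
move=> h u0; apply/eqP => z0; move/eqP: u0; apply.
by apply: val_unique h _; rewrite z0; apply: val0.
Qed.

Lemma val0_mul z w : val_at a b z 0 -> regular a b w -> val_at a b (z * w) 0.
Proof. by move=> h [v hv]; have := val_mul h hv; rewrite mul0r. Qed.

End Point.

(** Half of psi', which is the derivative of Y when that of x is Y. *)
Definition dpsi : {poly F} := 2%:R^-1 *: psi^`().
Definition del A B : K := el (B^`() * psi + B * dpsi) A^`().

Definition isder (z w : K) : Prop := exists A B C, [/\ C != 0,
  z = el A B / px C &
  w = (del A B * px C - el A B * yy * px C^`()) / px C ^+ 2].

Lemma isder_ex z : exists w, isder z w.
Proof.
have [A [B [C [C0 ->]]]] := hf_gen k z.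
by eexists; exists A, B, C.
Qed.

(** The derivation of K over F with D x = Y, dual to the differential dx / Y.
    It is chosen through its graph [isder], because the representation of
    an element as a fraction is not unique. *)
Definition D (z : K) : K := projT1 (cid (isder_ex z)).

Lemma D_isder z : isder z (D z).
Proof. exact: (projT2 (cid (isder_ex z))). Qed.

Lemma delE A B : del A B = px A^`() * yy + px B^`() * yy ^+ 2 + px B * px dpsi.
Proof. by rewrite /del /el !(rmorphD, rmorphM) /= -yy_sqr; ring. Qed.

Lemma isder_unique z w1 w2 : isder z w1 -> isder z w2 -> w1 = w2.
Proof.
move=> [A [B [C [C0 -> ->]]]] [A' [B' [C' [C'0 e ->]]]].
have pC : px C != 0 by rewrite px_eq0.
have pC' : px C' != 0 by rewrite px_eq0.
have /el_inj[eA eB] : el (A * C') (B * C') = el (A' * C) (B' * C).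
  rewrite /el !rmorphM -[px A * px C' + _ * yy](_ : el A B * px C' = _);
    last by rewrite /el; ring.
  rewrite (_ : px A' * px C + _ * yy = el A' B' * px C); last by rewrite /el; ring.
  by apply/eqP; rewrite -eqr_div // e.
have dA := congr1 (fun p => px p^`()) eA.
have dB := congr1 (fun p => px p^`()) eB.
move/(congr1 px): eA; move/(congr1 px): eB.
move: dA dB; rewrite /= !derivM !(rmorphD, rmorphM) /= => dA dB eB eA.
have eqA : px A' = px A * px C' / px C by rewrite eA mulfK.
have eqB : px B' = px B * px C' / px C by rewrite eB mulfK.
have eqdA : px A'^`() = (px A^`() * px C' + px A * px C'^`() - px A' * px C^`()) / px C.
  by apply: (canRL (mulfK _)) => //; rewrite dA; ring.
have eqdB : px B'^`() = (px B^`() * px C' + px B * px C'^`() - px B' * px C^`()) / px C.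
  by apply: (canRL (mulfK _)) => //; rewrite dB; ring.
rewrite !delE /el eqdA eqdB eqA eqB.
by field; rewrite pC pC'.
Qed.

Lemma D_def z w : isder z w -> D z = w.
Proof. exact: isder_unique (D_isder z). Qed.

Lemma D_el A B : D (el A B) = del A B.
Proof.
apply: D_def; exists A, B, 1; rewrite oner_eq0 rmorph1 divr1 -polyC1 derivC.
by rewrite rmorph0 !(mulr0, mulr1, subr0, expr1n, divr1).
Qed.

Lemma D_px A : D (px A) = px A^`() * yy.
Proof.
by rewrite -el_px D_el delE deriv0 !rmorph0 !mul0r !addr0.
Qed.

Lemma D_cst c : D (px c%:P) = 0.
Proof. by rewrite D_px derivC rmorph0 mul0r. Qed.

Lemma D_yy : D yy = px dpsi.
Proof.
by rewrite -el_yy D_el delE -polyC1 derivC deriv0 !rmorph0 !mul0r !add0r rmorph1 mul1r.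
Qed.

Lemma D_add z w : D (z + w) = D z + D w.
Proof.
apply: D_def; have [A [B [C [C0 -> ->]]]] := D_isder z.
have [A' [B' [C' [C'0 -> ->]]]] := D_isder w.
have pC : px C != 0 by rewrite px_eq0.
have pC' : px C' != 0 by rewrite px_eq0.
exists (A * C' + A' * C), (B * C' + B' * C), (C * C'); split.
- by rewrite mulf_neq0.
- by rewrite /el !(rmorphD, rmorphM) /=; field; rewrite pC pC'.
rewrite !delE /el !(derivD, derivM) !(rmorphD, rmorphM) /=.
by field; rewrite pC pC'.
Qed.

Lemma D_mul z w : D (z * w) = D z * w + z * D w.
Proof.
apply: D_def; have [A [B [C [C0 -> ->]]]] := D_isder z.
have [A' [B' [C' [C'0 -> ->]]]] := D_isder w.
have pC : px C != 0 by rewrite px_eq0.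
have pC' : px C' != 0 by rewrite px_eq0.
have dpsi2 : px psi^`() = 2%:R * px dpsi.
  by rewrite -(rmorph_nat px) -rmorphM /= /dpsi mulr_natl -scaler_nat scalerA
     mulfV ?scale1r // char0.
exists (A * A' + B * B' * psi), (A * B' + B * A'), (C * C'); split.
- by rewrite mulf_neq0.
- by rewrite -elM rmorphM mulf_div.
rewrite !delE /el !(derivD, derivM) !(rmorphD, rmorphM) /= dpsi2 -!yy_sqr.
by field; rewrite pC pC'.
Qed.

Lemma D0 : D 0 = 0. Proof. by have := D_cst 0; rewrite polyC0 rmorph0. Qed.
Lemma D1 : D 1 = 0. Proof. by have := D_cst 1; rewrite polyC1 rmorph1. Qed.
Lemma D_opp z : D (- z) = - D z.
Proof. by apply/eqP; rewrite -addr_eq0 -D_add addNr D0. Qed.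
Lemma D_sub z w : D (z - w) = D z - D w.
Proof. by rewrite D_add D_opp. Qed.
Lemma D_inv z : z != 0 -> D z^-1 = - D z / z ^+ 2.
Proof.
move=> z0; have := D1; rewrite -(mulfV z0) D_mul => /eqP; rewrite addrC addr_eq0.
move=> /eqP e; apply: (mulfI z0); rewrite e; field; exact: z0.
Qed.
Lemma D_exp z n : D (z ^+ n) = n%:R * z ^+ n.-1 * D z.
Proof.
elim: n => [|n IH]; first by rewrite expr0 D1 !mul0r.
rewrite exprS D_mul IH -natr1; case: n {IH} => [|n]; first by rewrite !expr0; ring.
by rewrite /= exprS; ring.
Qed.

(** D maps F[x, Y] to itself, hence each of its localizations. *)
Lemma D_regular a b z : b ^+ 2 = psi.[a] -> regular a b z -> regular a b (D z).
Proof.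
move=> onab hz; have [v [A [B [C [E [n1 e1 q1]]]]]] := hz.
have el0 : el C E != 0 by apply: ev_neq0 n1.
have -> : D z = (del A B - z * del C E) / el C E.
  apply: (canRL (mulfK _)) => //; rewrite -!D_el -e1 D_mul; ring.
case: hz => u hu; eexists; apply: (val_div onab _ (val_el _ _ _ _) n1).
by apply: val_sub => //; [exact: val_el|exact: (val_mul onab hu (val_el _ _ _ _))].
Qed.

End FunctionField.

(** * Functions regular at all affine points *)

Section CharZeroPoly.
Variable F : fieldType.
Hypothesis char0 : forall n, n.+1%:R != 0 :> F.

Lemma lead_coef_deriv0 (p : {poly F}) :
  lead_coef p^`() = lead_coef p *+ (size p).-1.
Proof.
have [s1|s1] := leqP (size p) 1.
  by rewrite (size1_polyC s1) derivC lead_coef0; case: (size _) (size_polyC_leq1 p`_0) => [|[]].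
have s2 : (size p).-2.+1 = (size p).-1 by rewrite prednK // -ltnS prednK // ltnW.
have c : p^`()`_(size p).-2 = lead_coef p *+ (size p).-1.
  by rewrite coef_deriv s2 lead_coefE.
have c0 : p^`()`_(size p).-2 != 0.
  rewrite c -s2 -mulr_natr mulf_neq0 ?char0 // lead_coef_eq0 -size_poly_gt0.
  exact: ltnW.
rewrite -c lead_coefE; congr (_ `_ _); apply/eqP; rewrite eqn_leq.
have p0 : p != 0 by rewrite -size_poly_gt0 ltnW.
have := lt_size_deriv p0.
have : ((size p).-2 < size p^`())%N by rewrite ltnNge; apply: contra c0 => /leq_sizeP ->.
lia.
Qed.

(** The hypothesis says that N / m has derivative zero, so that it is a
    constant; comparing leading coefficients is enough for the degrees. *)
Lemma log_deriv_size (N m : {poly F}) : N != 0 -> m != 0 ->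
  m * N^`() = m^`() * N -> size N = size m.
Proof.
move=> N0 m0 /(congr1 lead_coef); rewrite !lead_coefM !lead_coef_deriv0.
rewrite mulrnAr mulrnAl -[LHS]mulr_natr -[RHS]mulr_natr => e.
have /eqP : lead_coef m * lead_coef N * ((size N).-1%:R - (size m).-1%:R) = 0 :> F.
  by rewrite mulrBr e subrr.
rewrite !mulf_eq0 !lead_coef_eq0 (negPf N0) (negPf m0) /= => {}e.
have : (size N).-1 = (size m).-1.
  have inj (i j : nat) : (i <= j)%N -> (j%:R - i%:R : F) == 0 -> j = i.
    move=> le; rewrite -natrB //; case: (j - i)%N (subnK le) => [|d] <- //.
    by rewrite (negPf (char0 d)).
  have [le|/ltnW le] := leqP (size m).-1 (size N).-1; first exact: inj.
  by rewrite -opprB oppr_eq0 in e; rewrite (inj _ _ le e).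
move: N0 m0; rewrite -(size_poly_gt0 N) -(size_poly_gt0 m).
by case: (size N) (size m) => [|i] [|j] //= _ _ ->.
Qed.
End CharZeroPoly.

Section Global.
Variables (F : closedFieldType) (psi : {poly F}) (K : fieldType).
Hypothesis char0 : forall n, n.+1%:R != 0 :> F.
Variable k : hyperelliptic_field psi K.
Local Notation px := (px k).
Local Notation yy := (yy k).
Local Notation el := (el k).
Local Notation D := (D k).
Local Notation val_at := (val_at k).
Local Notation regular := (regular k).
Local Notation dpsi := (dpsi psi).

Lemma closed_sqrt (c : F) : exists b, b ^+ 2 = c.
Proof.
have [|b] := closed_rootP ('X^2 - c%:P) _; first by rewrite size_XnsubC.
by rewrite /root hornerD hornerXn hornerN hornerC subr_eq0 => /eqP; exists b.
Qed.

Lemma el_conj A B : el A B * el A (- B) = px (A ^+ 2 - B ^+ 2 * psi).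
Proof. by rewrite elM -el_px; congr el; ring. Qed.

Lemma ev_conj A B a b : b ^+ 2 = psi.[a] ->
  ev A B a b * ev A B a (- b) = (A ^+ 2 - B ^+ 2 * psi).[a].
Proof.
by move=> onab; rewrite /ev !expr2 hornerD hornerN !hornerM -onab; ring.
Qed.

(** If z is regular at both points above a, one denominator can be found
    which vanishes at neither (add two denominators, each vanishing at one
    point only); its norm is then a denominator in F[x]. *)
Lemma regular_below z a : (forall b, b ^+ 2 = psi.[a] -> regular a b z) ->
  exists H A B, H.[a] != 0 /\ z * px H = el A B.
Proof.
move=> regz; have [b onb] := closed_sqrt psi.[a].
have onb' : (- b) ^+ 2 = psi.[a] by rewrite sqrrN.
suff [A [B [C [E [n1 n2 e]]]]] : exists A B C E,
    [/\ ev C E a b != 0, ev C E a (- b) != 0 & z * el C E = el A B].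
  exists (C ^+ 2 - E ^+ 2 * psi), (A * C - B * E * psi), (B * C - A * E).
  rewrite -(ev_conj _ _ onb) mulf_neq0 // -el_conj mulrA e elM; split=> //.
  by congr el; ring.
have [_ [A [B [C [E [n1 e1 _]]]]]] := regz _ onb.
have [_ [A' [B' [C' [E' [n1' e1' _]]]]]] := regz _ onb'.
have [z2|n2] := eqVneq (ev C E a (- b)) 0; last by exists A, B, C, E.
have [z2'|n2'] := eqVneq (ev C' E' a b) 0; last by exists A', B', C', E'.
exists (A + A'), (B + B'), (C + C'), (E + E').
by rewrite -!evD -!elD mulrDr e1 e1' z2 z2' addr0 add0r; split.
Qed.

(** The denominators of z in F[x] form an ideal which has an element
    nonvanishing at any given a.  A denominator of minimal degree is thus
    without roots, by Bezout. *)
Lemma regular_everywhere z :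
  (forall a b, b ^+ 2 = psi.[a] -> regular a b z) -> exists A B, z = el A B.
Proof.
move=> regz; have [A [B [C [C0 e]]]] := el_den k z.
have [n] := ubnP (size C); elim: n => // n IH in A B C C0 e *; rewrite ltnS => ltn.
have [s1|/closed_rootP[a ra]] := eqVneq (size C) 1.
  have Cc := size1_polyC (eq_leq s1); have c0 : C`_0 != 0 by rewrite -polyC_eq0 -Cc.
  exists (A * (C`_0)^-1%:P), (B * (C`_0)^-1%:P); rewrite /el !rmorphM /=.
  rewrite mulrAC -mulrDl -/(el A B) -e -mulrA -rmorphM {1}Cc -polyCM mulfV //.
  by rewrite rmorph1 mulr1.
have [H [A' [B' [Ha eH]]]] := regular_below (regz a).
have [[u v] /= uv] := Bezoutp C H.
set g := u * C + v * H in uv.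
have gH : g %| H by rewrite (eqp_dvdl _ uv) dvdp_gcdr.
have gC : g %| C by rewrite (eqp_dvdl _ uv) dvdp_gcdl.
have g0 : g != 0 by apply: contraTneq gC => ->; rewrite dvd0p.
apply: (IH (A * u + A' * v) (B * u + B' * v) g) => //.
  rewrite rmorphD !rmorphM mulrDr mulrCA e [z * _](_ : _ = px v * (z * px H)).
    by rewrite eH /el !(rmorphD, rmorphM) /=; ring.
  by ring.
apply: leq_trans ltn; rewrite ltn_neqAle dvdp_leq // andbT.
apply/negP => /eqP sz; move: Ha; apply/negP; rewrite negbK -/(root H a).
have : root g a by rewrite (eqp_root (q := C)) // -dvdp_size_eqp // sz.
by move: gH => /dvdpP[q ->]; rewrite rootM => ->; rewrite orbT.
Qed.

Section Smooth.
Hypothesis psi_sep : forall a, psi.[a] = 0 -> dpsi.[a] != 0.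

Lemma poly_decomp (A : {poly F}) a :
  exists A1, A = A1 * ('X - a%:P) + (A.[a])%:P.
Proof.
have /factor_theorem[A1 e] : root (A - (A.[a])%:P) a.
  by rewrite /root hornerD hornerN hornerC subrr.
by exists A1; rewrite -e subrK.
Qed.

(** The uniformizer is Y at a branch point and x - a elsewhere.  Its
    derivative is a unit, so that D t / t has a simple pole; the last clause
    computes the residue of the functions u_R of [uhat] in these terms. *)
Lemma uniformizer_at a b : b ^+ 2 = psi.[a] -> exists t dt, [/\ val_at a b t 0,
  dt != 0 /\ val_at a b (D t) dt,
  forall z, val_at a b z 0 -> exists2 w, regular a b w & z = t * w,
  exists e w v, [/\ (0 < e)%N, val_at a b w v, v != 0 & px ('X - a%:P) = t ^+ e * w] &
  forall c d, d ^+ 2 = psi.[c] ->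
    val_at a b (t * (yy + px d%:P) / (2%:R * px ('X - c%:P)))
           (((a, b) == (c, d))%:R * dt)].
Proof.
move=> onab.
have px0 c : px ('X - c%:P) != 0 by rewrite px_eq0 polyXsubC_eq0.
have K2 : 2%:R != 0 :> K by rewrite -(rmorph_nat px) px_eq0 -polyC_natr polyC_eq0 char0.
have reduce t : (forall A B, ev A B a b = 0 -> exists2 w, regular a b w & el A B = t * w) ->
    forall z, val_at a b z 0 -> exists2 w, regular a b w & z = t * w.
  move=> ht z [A [B [C [E [n1 e1]]]]]; rewrite mul0r => /esym /ht[w [v rw] e2].
  exists (w / el C E).
    exists (v / ev C E a b).
    apply: val_div => //; exact: val_el.
  by apply: (mulIf (ev_neq0 k n1)); rewrite e1 e2 mulrA divfK // (ev_neq0 k n1).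
have far t c d : val_at a b t 0 -> a != c ->
    val_at a b (t * (yy + px d%:P) / (2%:R * px ('X - c%:P))) 0.
  move=> vt nac; rewrite -mulrA; apply: val0_mul => //.
  exists ((b + d) / (2%:R * (a - c))); apply: val_div => //.
  - by apply: val_add => //; [apply: val_yy|apply: val_cst].
  - apply: val_mul => //; first exact: val_nat.
    by have := val_px k a b ('X - c%:P); rewrite hornerXsubC.
  - by rewrite mulf_neq0 ?char0 // subr_eq0.
have valX : val_at a b (px ('X - a%:P)) 0.
  by have := val_px k a b ('X - a%:P); rewrite hornerXsubC subrr.
have [psi1 epsi] := poly_decomp psi a.
have epx := congr1 px epsi.
have ddpsi : psi.[a] = 0 -> psi1.[a] = 2%:R * dpsi.[a].
  move=> _; rewrite /dpsi hornerZ mulrA mulfV ?char0 // mul1r epsi derivD derivM.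
  by rewrite derivC derivXsubC mulr1 addr0 hornerD hornerM hornerXsubC subrr mulr0 add0r.
have [b0|b0] := eqVneq b 0.
- have psia : psi.[a] = 0 by rewrite -onab b0 expr0n.
  have psi1a := ddpsi psia; have nd := psi_sep psia.
  have psi1a0 : psi1.[a] != 0 by rewrite psi1a mulf_neq0 ?char0.
  have vpsi1 := val_px k a b psi1.
  have vt : val_at a b yy 0 by rewrite -[X in val_at _ _ _ X]b0; apply: val_yy.
  have eX : px ('X - a%:P) = yy ^+ 2 / px psi1.
    apply: (canRL (mulfK _)); first exact: val_neq0 vpsi1 psi1a0.
    by rewrite yy_sqr epx psia addr0 rmorphM mulrC.
  exists yy, dpsi.[a]; split=> //.
  + by split=> //; rewrite D_yy; apply: val_px.
  + apply: reduce => A B evz.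
    have Aa : A.[a] = 0 by rewrite -evz /ev b0 mulr0 addr0.
    have [A1 eA] := poly_decomp A a.
    exists (px B + px A1 * (yy / px psi1)); last first.
      by rewrite /el eA Aa addr0 rmorphM eX; ring.
    eexists; exact: (val_add onab (val_px k a b B) (val_mul onab
      (val_px k a b A1) (val_div onab vt vpsi1 psi1a0))).
  + exists 2%N, (px psi1)^-1, (psi1.[a])^-1; split=> //.
    * by apply: val_inv.
    * by rewrite invr_eq0.
  + move=> c d oncd; have [eac|nac] := eqVneq a c; last first.
      by rewrite xpair_eqE (negPf nac) mul0r; apply: far.
    move: oncd; rewrite -eac psia => /eqP; rewrite sqrf_eq0 => /eqP ->.
    rewrite b0 eqxx mul1r rmorph0 addr0 -expr2 eX.
    have ps0 : px psi1 != 0 := val_neq0 onab vpsi1 psi1a0.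
    have y0 : yy != 0.
      by apply/eqP => y0; have := px0 a; rewrite eX y0 expr0n mul0r eqxx.
    have -> : yy ^+ 2 / (2%:R * (yy ^+ 2 / px psi1)) = px psi1 / 2%:R.
      by field; rewrite ?K2 ?ps0 ?y0.
    rewrite (_ : dpsi.[a] = psi1.[a] / 2%:R); last by rewrite psi1a; field; exact: char0.
    by rewrite -b0; exact: (val_div onab vpsi1 (val_nat k a b 2) (char0 1)).
- have b2 : b + b != 0 by rewrite -mulr2n -mulr_natl mulf_neq0 ?char0.
  have vyb : val_at a b (yy + px b%:P) (b + b).
    by apply: val_add => //; [apply: val_yy|apply: val_cst].
  have yb0 : yy + px b%:P != 0 := val_neq0 onab vyb b2.
  have ey : yy - px b%:P = px ('X - a%:P) * (px psi1 / (yy + px b%:P)).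
    rewrite mulrA; apply: (canRL (mulfK yb0)).
    have -> : (yy - px b%:P) * (yy + px b%:P) = yy ^+ 2 - px b%:P ^+ 2 by ring.
    rewrite yy_sqr epx -onab polyC_exp rmorphD rmorphM rmorphXn /=; ring.
  exists (px ('X - a%:P)), b; split=> //.
  + split=> //; rewrite D_px derivXsubC rmorph1 mul1r; exact: val_yy.
  + apply: reduce => A B evz.
    have [A1 eA] := poly_decomp A a; have [B1 eB] := poly_decomp B a.
    have Aa : A.[a] = - (B.[a] * b) by apply/eqP; rewrite -addr_eq0; apply/eqP.
    exists (px A1 + px B1 * yy + px (B.[a])%:P * (px psi1 / (yy + px b%:P))).
      eexists; exact: (val_add onab (val_el k a b A1 B1) (val_mul onab
        (val_cst k a b _) (val_div onab (val_px k a b psi1) vyb b2))).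
    rewrite mulrDr [_ * (_ * (_ / _))]mulrCA -ey /el {1}eA {1}eB Aa.
    rewrite !(rmorphD, rmorphM, polyCN, rmorphN, polyCM) /=; ring.
  + exists 1%N, (px 1%:P), 1; rewrite oner_eq0 expr1 rmorph1 mulr1; split=> //.
    by have := val_cst k a b 1; rewrite rmorph1.
  + move=> c d oncd; have [eac|nac] := eqVneq a c; last first.
      by rewrite xpair_eqE (negPf nac) mul0r; apply: far.
    rewrite -eac in oncd *; rewrite xpair_eqE eqxx /=.
    have -> : px ('X - a%:P) * (yy + px d%:P) / (2%:R * px ('X - a%:P))
              = (yy + px d%:P) / 2%:R by move: (px0 a); move: (px ('X - a%:P)) => u u0; field; rewrite K2 u0.
    have -> : (b == d)%:R * b = (b + d) / 2%:R.
      have /eqP : (b - d) * (b + d) = 0 by rewrite -[RHS](subrr psi.[a]) -{1}onab -oncd; ring.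
      have [->|nbd] := eqVneq b d; first by move=> _; rewrite mul1r; field; exact: (char0 1).
      rewrite mulf_eq0 subr_eq0 (negPf nbd) /= => /eqP ->; ring.
    exact: (val_div onab (val_add onab (val_yy k a b) (val_cst k a b d))
      (val_nat k a b 2) (char0 1)).
Qed.

End Smooth.
End Global.

(** * Functions with a given logarithmic derivative *)

Section Principal.
Variables (F : closedFieldType) (psi : {poly F}) (K : fieldType).
Hypothesis char0 : forall n, n.+1%:R != 0 :> F.
Variable k : hyperelliptic_field psi K.
Local Notation px := (px k).
Local Notation yy := (yy k).
Local Notation el := (el k).
Local Notation D := (D k).
Local Notation val_at := (val_at k).
Local Notation regular := (regular k).
Local Notation dpsi := (dpsi psi).
Hypothesis psi_sep : forall a, psi.[a] = 0 -> dpsi.[a] != 0.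

(** The factor Y + Y_R cancels the pole at the conjugate point -R: among
    affine points, R is the only pole, and it is simple with the residue of
    a logarithmic derivative D t / t. *)
Definition uhat (p : F * F) : K := (yy + px p.2%:P) / (2%:R * px ('X - p.1%:P)).

Lemma K2_neq0 : 2%:R != 0 :> K.
Proof. by rewrite -(rmorph_nat px) px_eq0 -polyC_natr polyC_eq0 char0. Qed.

Lemma pxX_neq0 c : px ('X - c%:P) != 0.
Proof. by rewrite px_eq0 polyXsubC_eq0. Qed.

(** Write F0 = t^v w with w a unit.  Then D F0 / F0 has residue v, which
    is the natural number n; in particular v >= 0. *)
Lemma regular_of_dlog F0 g a b : b ^+ 2 = psi.[a] -> F0 != 0 -> D F0 = g * F0 ->
  (forall t dt, val_at a b t 0 ->
     (forall c d, d ^+ 2 = psi.[c] ->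
        val_at a b (t * uhat (c, d)) (((a, b) == (c, d))%:R * dt)) ->
     exists n, val_at a b (t * g) (n%:R * dt)) ->
  regular a b F0.
Proof.
move=> onab F00 dF hg.
have [t [dt [vt [dt0 vdt] div_t [e [u [uv [e0 vu uv0 eX]]]] tu]]] :=
  uniformizer_at char0 k psi_sep onab.
have [n vtg] := hg t dt vt (fun c d h => ltac:(rewrite /uhat mulrA; exact: tu)).
have u0 := val_neq0 onab vu uv0.
have t0 : t != 0.
  by apply/eqP => t0; have := pxX_neq0 a; rewrite eX t0 expr0n eqn0Ngt e0 mul0r eqxx.
have pxfact N : N != 0 -> exists r w v,
    [/\ val_at a b w v, v != 0 & px N = t ^+ r * w].
  move=> N0; have [m [q]] := multiplicity_XsubC N a.
  rewrite N0 /= => qa ->; exists (e * m)%N, (u ^+ m * px q), (uv ^+ m * q.[a]).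
  split; first by apply: val_mul => //; [apply: val_exp|apply: val_px].
    by rewrite mulf_neq0 // expf_neq0.
  by rewrite rmorphM rmorphXn eX exprMn exprM /=; ring.
have elfact A B : el A B != 0 -> exists r w v,
    [/\ val_at a b w v, v != 0 & el A B = t ^+ r * w].
  move=> E0; have E0' : el A (- B) != 0.
    apply: contra E0 => /eqP /el_eq0[-> /eqP]; rewrite oppr_eq0 => /eqP ->.
    by rewrite /el !rmorph0 mul0r addr0.
  have N0 : A ^+ 2 - B ^+ 2 * psi != 0.
    by rewrite -(px_eq0 k) -el_conj mulf_neq0.
  have [r [w [v [hw v0 eN]]]] := pxfact _ N0.
  rewrite -el_conj in eN.
  have bound j z : regular a b z -> el A B = t ^+ j * z -> (j <= r)%N.
    move=> [zv hz] ez; rewrite leqNgt; apply/negP => ltrj.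
    have ew : w = t ^+ (j - r) * (z * el A (- B)).
      apply: (mulfI (expf_neq0 r t0)); rewrite -eN ez.
      by rewrite -{1}(subnKC (ltnW ltrj)) exprD; ring.
    suff : val_at a b w 0 by move=> /(val_unique onab hw) v00; rewrite v00 eqxx in v0.
    rewrite ew; apply: val0_mul => //.
      by have := val_exp onab (j - r) vt; rewrite expr0n subn_eq0 leqNgt ltrj.
    by eexists; apply: (val_mul onab hz (val_el k a b _ _)).
  suff : forall d j z, regular a b z -> el A B = t ^+ j * z -> (r - j < d)%N ->
      exists r w v, [/\ val_at a b w v, v != 0 & el A B = t ^+ r * w].
    move=> /(_ r.+1 0%N (el A B)); apply.
    - by eexists; apply: val_el.
    - by rewrite expr0 mul1r.
    - by rewrite subn0.
  elim=> // d IH j z [zv hz] ez lt; have [z0|nz] := eqVneq zv 0; last first.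
    by exists j, z, zv.
  rewrite z0 in hz; have [z' rz' ez'] := div_t _ hz.
  have ez1 : el A B = t ^+ j.+1 * z' by rewrite ez ez' exprSr; ring.
  have := bound _ _ rz' ez1 => le1.
  by apply: (IH _ _ rz' ez1); lia.
have [A [B [C [C0 eF]]]] := el_den k F0.
have E0 : el A B != 0 by rewrite -eF mulf_neq0 // px_eq0.
have [i [w [v [hw v0 ei]]]] := elfact _ _ E0.
have [j [w' [v' [hw' v'0 ej]]]] := pxfact _ C0.
have w'0 := val_neq0 onab hw' v'0.
have hq := val_div onab hw hw' v'0.
have q0 : v / v' != 0 by rewrite mulf_neq0 // invr_eq0.
have eq : F0 * t ^+ j = t ^+ i * (w / w').
  by apply: (mulIf w'0); rewrite -[LHS]mulrA -ej eF ei -mulrA divfK.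
have [le|lt] := leqP j i.
  have -> : F0 = t ^+ (i - j) * (w / w').
    apply: (mulIf (expf_neq0 j t0)); rewrite eq -{1}(subnK le) exprD; ring.
  by eexists; apply: (val_mul onab (val_exp onab (i - j) vt) hq).
have {}eq : F0 * t ^+ (j - i) = w / w'.
  apply: (mulfI (expf_neq0 i t0)); rewrite -eq -{2}(subnKC (ltnW lt)) exprD; ring.
have dj : (j - i = (j - i).-1.+1)%N by rewrite prednK // subn_gt0.
have deq := congr1 D eq.
have vD : exists z, val_at a b (D (w / w')) z.
  by apply: D_regular => //; exists (v / v').
case: vD => z vz.
have : val_at a b (t * D (w / w')) ((n%:R * dt) * (v / v') + (j - i)%:R * dt * (v / v')).
  have -> : t * D (w / w') = (t * g) * (w / w') + (j - i)%:R * D t * (w / w').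
    rewrite -eq D_mul // dF D_exp // dj exprS /=; ring.
  by repeat (first [exact: (val_nat k a b _) | eassumption | apply: val_mul => //
             | apply: val_add => //]).
move=> /(val_unique onab (val_mul onab vt vz)); rewrite mul0r.
rewrite -mulrA -[(j - i)%:R * _ * _]mulrA -mulrDl -natrD => /esym /eqP.
rewrite !mulf_eq0 (negPf dt0) (negPf v0) invr_eq0 (negPf v'0) !orbF dj addnS.
by rewrite (negPf (char0 _)).
Qed.

(** The degrees of A^2 and B^2 psi have different parities, so the leading
    terms cannot cancel. *)
Lemma size_norm A B : size psi = 4 ->
  size (A ^+ 2 - B ^+ 2 * psi) =
    maxn (if A == 0 then 0 else (size A).*2.-1) (if B == 0 then 0 else (size B).*2.+2).
Proof.
move=> s4; have psi0 : psi != 0 by rewrite -size_poly_gt0 s4.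
have sA : size (A ^+ 2) = if A == 0 then 0 else (size A).*2.-1.
  have [->|A0] := eqVneq A 0; first by rewrite expr0n size_poly0.
  by rewrite expr2 size_mul // addnn.
have sB : size (- (B ^+ 2 * psi)) = if B == 0 then 0 else (size B).*2.+2.
  have [->|B0] := eqVneq B 0; first by rewrite expr0n mul0r oppr0 size_poly0.
  rewrite size_polyN size_mul ?expf_neq0 // s4 expr2 size_mul // addnn.
  by move: B0; rewrite -size_poly_gt0; move: (size B) => n; lia.
have [lt|lt|e] := ltngtP (size (A ^+ 2)) (size (- (B ^+ 2 * psi))).
- by rewrite addrC size_polyDl // -sA -sB; lia.
- by rewrite size_polyDl // -sA -sB; lia.
move: e; rewrite sA sB; case: eqP => [A0|/eqP A0]; case: eqP => [B0|/eqP B0].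
- by rewrite A0 B0 !expr0n mul0r subrr size_poly0.
- by [].
- by move: A0; rewrite -size_poly_gt0; move: (size A) => n; lia.
- move: A0 B0; rewrite -(size_poly_gt0 A) -(size_poly_gt0 B).
  by move: (size A) (size B) => n n'; lia.
Qed.

(** Only the coefficient of Y matters: that of u_R is 1 / (2 (x - x_R)), so
    the sum gives half of the logarithmic derivative of the product. *)
Lemma comp_uhat (s : seq (F * F)) (c : F) :
  exists p, px (\prod_(q <- s) ('X - q.1%:P)) * (\sum_(q <- s) uhat q + px c%:P)
     = el p (2%:R^-1 *: (\prod_(q <- s) ('X - q.1%:P))^`()).
Proof.
elim: s c => [|[a b] s IH] c.
  exists c%:P; rewrite !big_nil -polyC1 derivC scaler0 el_px rmorph1 mul1r add0r //.
rewrite !big_cons /= derivM derivXsubC mul1r.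
have [p ep] := IH c; set m := \prod_(q <- s) _ in ep *.
exists (2%:R^-1 *: (b *: m) + p * ('X - a%:P)).
rewrite rmorphM -addrA mulrDr -[px _ * px m * (_ + _)]mulrA ep /uhat /=.
rewrite /el -!mul_polyC !(rmorphD, rmorphM) /= -[px 'X + _]rmorphD.
have -> : px 2%:R^-1%:P = 2%:R^-1.
  apply: (mulIf K2_neq0); rewrite mulVf ?K2_neq0 // -(rmorph_nat px) -rmorphM.
  by rewrite -polyC_natr -polyCM mulVf ?char0 // rmorph1.
move: (pxX_neq0 a) K2_neq0; move: (px ('X - a%:P)) => u u0 k2; field.
by rewrite u0 k2.
Qed.

(** F0 is a polynomial A + BY by [regular_everywhere].  The coefficient of Y
    in D F0 / F0 is half the logarithmic derivative of the norm of F0, so by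
    [comp_uhat] the norm is, up to a constant, the product of the x - x_q: the
    divisor of affine zeros of F0 has the degree of s. *)
Theorem principal (s : seq (F * F)) (c : F) F0 : size psi = 4 ->
  (forall q, q \in s -> q.2 ^+ 2 = psi.[q.1]) -> F0 != 0 ->
  D F0 = (\sum_(q <- s) uhat q + px c%:P) * F0 ->
  exists A B, F0 = el A B /\ size (A ^+ 2 - B ^+ 2 * psi) = (size s).+1.
Proof.
move=> s4 ons F00 dF.
have [A [B eF]] : exists A B, F0 = el A B.
  apply: regular_everywhere => a b onab; apply: (regular_of_dlog onab F00 dF).
  move=> t dt vt ut; exists (count_mem (a, b) s); rewrite mulrDr -[X in val_at _ _ _ X]addr0.
  apply: val_add => //; last by apply: val0_mul => //; exists c; apply: val_cst.
  elim: s ons {dF} => [|[x y] s IH] ons.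
    by rewrite big_nil mulr0 mul0r; apply: val0.
  rewrite big_cons mulrDr /= natrD mulrDl; apply: val_add => //.
    by rewrite eq_sym; apply: ut; apply: (ons (x, y)); rewrite mem_head.
  by apply: IH => q qs; apply: ons; rewrite in_cons qs orbT.
exists A, B; split=> //.
have [p ep] := comp_uhat s c; set m := \prod_(q <- s) ('X - q.1%:P) in ep.
have m_mon : m \is monic by apply: monic_prod_XsubC.
have m0 := monic_neq0 m_mon.
have N0 : A ^+ 2 - B ^+ 2 * psi != 0.
  rewrite -(px_eq0 k) -el_conj mulf_neq0 //; first by rewrite -eF.
  apply: contra F00 => /eqP /el_eq0[A0 /eqP]; rewrite oppr_eq0 => /eqP B0.
  by rewrite eF A0 B0 /el !rmorph0 mul0r addr0.
rewrite (log_deriv_size char0 N0 m0); first by rewrite size_prod_XsubC.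
have := congr1 (fun z => px m * z) dF; rewrite mulrA ep eF D_el // /del.
rewrite -[px m]el_px !elM => /el_inj[].
rewrite !mul0r !addr0 -!mul_polyC => e1 e2.
have dpsi2 : psi^`() = 2%:R * dpsi.
  by rewrite /dpsi mulr_natl -scaler_nat scalerA mulfV ?scale1r // char0.
set h := (2%:R^-1)%:P in e1 e2.
have hh : 2%:R * h = 1 by rewrite /h -polyC_natr -polyCM mulfV // char0.
rewrite derivB derivM !expr2 !derivM dpsi2.
transitivity (2%:R * (A * (m * A^`()) - B * (m * (B^`() * psi + B * dpsi)))); first by ring.
rewrite e1 e2.
transitivity (2%:R * h * (m^`() * (A * A - B * B * psi))); first by ring.
by rewrite hh mul1r.
Qed.

End Principal.

(** * Chords and tangents in the coordinates x, Y *)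

Section Hyper.
Variables (F : fieldType) (E : weierstrass F).
Local Notation a1 := (wa1 E).
Local Notation a2 := (wa2 E).
Local Notation a3 := (wa3 E).
Local Notation a4 := (wa4 E).
Local Notation a6 := (wa6 E).

(** The cubic Y^2 = psi(x) obtained by completing the square; [yhat] is
    its Y. *)
Definition psiE : {poly F} :=
  4%:R *: 'X^3 + wb2 E *: 'X^2 + (2%:R * wb4 E) *: 'X + (wb6 E)%:P.
Definition yhat (x y : F) := 2%:R * y + a1 * x + a3.
(** Half of psi'. *)
Definition dpsiE (x : F) := 6%:R * x ^+ 2 + wb2 E * x + wb4 E.
(** The derivative of Y / 2 with respect to x: the slope of the tangent in
    the coordinates (x, Y / 2), which is that of the chord-tangent law plus
    a1 / 2. *)
Definition slope (R : point F) : F :=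
  if R is Aff x y then dpsiE x / (2%:R * yhat x y) else 0.
Definition dbl (R : point F) := addp E R R.

Lemma psiE_horner x :
  psiE.[x] = 4%:R * x ^+ 3 + wb2 E * x ^+ 2 + 2%:R * wb4 E * x + wb6 E.
Proof. by rewrite /psiE !hornerD !hornerZ !hornerXn hornerX hornerC. Qed.

Lemma size_psiE : 2%:R != 0 :> F -> size psiE = 4.
Proof.
move=> c2; have c4 : 4%:R != 0 :> F.
  by rewrite (_ : 4%:R = 2%:R * 2%:R :> F) ?mulf_neq0 //; ring.
rewrite /psiE -!addrA size_polyDl ?size_scale ?size_polyXn //.
apply: leq_ltn_trans (size_polyD _ _) _; rewrite gtn_max.
rewrite (leq_ltn_trans (size_scale_leq _ _)) ?size_polyXn //=.
apply: leq_ltn_trans (size_polyD _ _) _; rewrite gtn_max.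
rewrite (leq_ltn_trans (size_scale_leq _ _)) ?size_polyX //=.
by rewrite (leq_ltn_trans (size_polyC_leq1 _)).
Qed.

Lemma on_curveE x y : on_curve E (Aff x y) -> yhat x y ^+ 2 = psiE.[x].
Proof.
rewrite /= psiE_horner /yhat /wb2 /wb4 /wb6 => e.
have : 4%:R * (y ^+ 2 + a1 * x * y + a3 * y)
  = 4%:R * (x ^+ 3 + a2 * x ^+ 2 + a4 * x + a6) by rewrite e.
move=> {}e; apply/eqP; rewrite -subr_eq0; move/eqP: e; rewrite -subr_eq0.
by move=> /eqP e; apply/eqP; rewrite -[RHS]e; ring.
Qed.

Lemma on_curveI x y : 2%:R != 0 :> F -> yhat x y ^+ 2 = psiE.[x] -> on_curve E (Aff x y).
Proof.
move=> c2; have c4 : 4%:R != 0 :> F.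
  by rewrite (_ : 4%:R = 2%:R * 2%:R :> F) ?mulf_neq0 //; ring.
rewrite /= psiE_horner /yhat /wb2 /wb4 /wb6 => /eqP; rewrite -subr_eq0 => /eqP e.
apply: (mulfI c4); apply/eqP; rewrite -subr_eq0; apply/eqP; rewrite -[RHS]e; ring.
Qed.

(** A common root x of psi and psi' expresses b4 and b6 through b2 and x,
    and the discriminant becomes identically zero. *)
Lemma psiE_sep x : 2%:R != 0 :> F -> elliptic E -> psiE.[x] = 0 -> dpsiE x != 0.
Proof.
move=> c2 ell psi0; apply/eqP => d0; move: ell; rewrite /elliptic.
have c4 : 4%:R != 0 :> F.
  by rewrite (_ : 4%:R = 2%:R * 2%:R :> F) ?mulf_neq0 //; ring.
have e8 : 4%:R * wb8 E = wb2 E * wb6 E - wb4 E ^+ 2.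
  by rewrite /wb2 /wb4 /wb6 /wb8; ring.
have e4 : wb4 E = - (6%:R * x ^+ 2 + wb2 E * x).
  by apply/eqP; rewrite -addr_eq0 addrC; apply/eqP.
have e6 : wb6 E = - (4%:R * x ^+ 3 + wb2 E * x ^+ 2 + 2%:R * wb4 E * x).
  by apply/eqP; rewrite -addr_eq0 addrC -psiE_horner; apply/eqP.
suff : 4%:R * wdisc E = 0 by move=> /eqP; rewrite mulf_eq0 (negPf c4) /= => ->.
have -> : 4%:R * wdisc E = - wb2 E ^+ 2 * (4%:R * wb8 E)
    - 32%:R * wb4 E ^+ 3 - 108%:R * wb6 E ^+ 2 + 36%:R * wb2 E * wb4 E * wb6 E.
  by rewrite /wdisc; ring.
rewrite e8 e6 e4; ring.
Qed.

(** The chord-tangent law, read as a factorization: psi / 4 minus the square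
    of the equation of the line is the monic cubic with the abscissas of the
    three points as roots. *)
Lemma addp_collinear x1 y1 x2 y2 : 2%:R != 0 :> F ->
  on_curve E (Aff x1 y1) -> on_curve E (Aff x2 y2) ->
  ~~ ((x1 == x2) && (y1 + y2 + a1 * x2 + a3 == 0)) ->
  exists l nu x3 y3,
  [/\ addp E (Aff x1 y1) (Aff x2 y2) = Aff x3 y3,
      yhat x1 y1 = 2%:R * (l * x1 + nu), yhat x2 y2 = 2%:R * (l * x2 + nu),
      yhat x3 y3 = - (2%:R * (l * x3 + nu)) &
      [/\ psiE = 4%:R *: (('X - x1%:P) * ('X - x2%:P) * ('X - x3%:P)
                     + (l *: 'X + nu%:P) ^+ 2) &
      (x1 = x2 -> y1 = y2 -> l = slope (Aff x1 y1))]].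
Proof.
move=> c2 on1 on2 ndeg.
have c4 : 4%:R != 0 :> F.
  by rewrite (_ : 4%:R = 2%:R * 2%:R :> F) ?mulf_neq0 //; ring.
rewrite {1}/addp (negPf ndeg).
set l := (if _ then _ else _); set nu := _ - _ * _; set x3 := _ - x2.
exists (l + a1 / 2%:R), (nu + a3 / 2%:R), x3, (- (l + a1) * x3 - nu - a3).
have h1 := on_curveE on1; have h2 := on_curveE on2.
have l1 : yhat x1 y1 = 2%:R * ((l + a1 / 2%:R) * x1 + (nu + a3 / 2%:R)).
  by rewrite /yhat /nu; field.
have Y0 : x1 = x2 -> y1 = y2 /\ yhat x1 y1 != 0.
  move=> e12; have : (y1 - y2) * (y1 + y2 + a1 * x2 + a3) = 0.
    have : (y1 ^+ 2 + a1 * x1 * y1 + a3 * y1) - (y2 ^+ 2 + a1 * x2 * y2 + a3 * y2) = 0.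
      by rewrite on1 on2 e12; ring.
    by move=> <-; rewrite e12; ring.
  move: ndeg; rewrite e12 eqxx /= => nd /eqP; rewrite mulf_eq0 (negPf nd) orbF.
  rewrite subr_eq0 => /eqP ey; split=> //; move: nd; apply: contra => /eqP e.
  by apply/eqP; rewrite -[RHS]e ey /yhat; ring.
have l2 : yhat x2 y2 = 2%:R * ((l + a1 / 2%:R) * x2 + (nu + a3 / 2%:R)).
  have [e12|ne] := eqVneq x1 x2.
    by have [ey _] := Y0 e12; rewrite -{2}e12 -l1 e12 ey.
  have ne' : x2 - x1 != 0 by rewrite subr_eq0 eq_sym.
  by rewrite /yhat /nu /l (negPf ne); field; rewrite c2 ne'.
split=> //; first by rewrite /yhat; field.
split; last first.
  move=> e12 ey; have [_ Yn0] := Y0 e12.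
  have eY : yhat x1 y1 = 2%:R * y1 + a1 * x1 + a3 by [].
  rewrite /l e12 eqxx /slope -e12 eY /dpsiE /wb2 /wb4; field.
  by rewrite -eY Yn0 c2.
move: l1 l2; set L := l + _; set M := nu + _ => l1 l2.
(* psi and 4 ((x - x1) (x - x2) (x - x3) + (L x + M)^2) have the same terms of
   degree 3 and 2; al x + be is what remains, and it vanishes at x1 and x2. *)
pose al := 2%:R * wb4 E - 4%:R * (2%:R * L * M) - 4%:R * (x1 * x2 + x1 * x3 + x2 * x3).
pose be := wb6 E - 4%:R * M ^+ 2 + 4%:R * (x1 * x2 * x3).
have x3E : 4%:R * (x1 + x2 + x3) = 4%:R * L ^+ 2 - wb2 E.
  by rewrite /x3 /L /wb2; field.
have expand x : psiE.[x] - 4%:R * ((x - x1) * (x - x2) * (x - x3) + (L * x + M) ^+ 2)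
   = al * x + be.
  rewrite psiE_horner.
  have -> : wb2 E = 4%:R * L ^+ 2 - 4%:R * (x1 + x2 + x3) by rewrite x3E; ring.
  by rewrite /al /be; ring.
have r1 : al * x1 + be = 0 by rewrite -expand -h1 l1; ring.
have r2 : al * x2 + be = 0 by rewrite -expand -h2 l2; ring.
have al0 : al = 0.
  have [e12|ne] := eqVneq x1 x2; last first.
    apply: (mulIf (x := x1 - x2)); first by rewrite subr_eq0.
    by rewrite mul0r mulrBr -[RHS](subrr 0) -{1}r1 -r2; ring.
  have [ey Yn0] := Y0 e12.
  have sl : dpsiE x1 = L * (2%:R * yhat x1 y1).
    have eY : yhat x1 y1 = 2%:R * y1 + a1 * x1 + a3 by [].
    rewrite /L /l e12 eqxx -e12 eY /dpsiE /wb2 /wb4; field.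
    by rewrite -eY c2 Yn0.
  have -> : al = 2%:R * (dpsiE x1 - 4%:R * L * (L * x1 + M)).
    have e2 : wb2 E = 4%:R * L ^+ 2 - 4%:R * (x1 + x2 + x3) by rewrite x3E; ring.
    by rewrite /al /dpsiE e2 -e12; ring.
  by rewrite sl l1; ring.
have be0 : be = 0 by rewrite -[RHS]r1 al0 mul0r add0r.
have e2 : wb2 E = 4%:R * L ^+ 2 - 4%:R * (x1 + x2 + x3) by rewrite x3E; ring.
have e4 : 2%:R * wb4 E = 4%:R * (2%:R * L * M) + 4%:R * (x1 * x2 + x1 * x3 + x2 * x3).
  by rewrite -[RHS]add0r -al0 /al; ring.
have e6 : wb6 E = 4%:R * M ^+ 2 - 4%:R * (x1 * x2 * x3).
  by rewrite -[RHS]add0r -be0 /be; ring.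
rewrite /psiE e2 e4 e6 -!mul_polyC !(polyCD, polyCB, polyCM, polyCN, polyC_exp, polyC_natr).
by ring.
Qed.

End Hyper.

(** * Logarithmic derivatives on an elliptic curve *)

Section Pic.
Variables (F : closedFieldType) (E : weierstrass F) (K : fieldType).
Hypothesis char0 : forall n, n.+1%:R != 0 :> F.
Hypothesis ell : elliptic E.
Variable k : hyperelliptic_field (psiE E) K.
Local Notation px := (px k).
Local Notation yy := (yy k).
Local Notation el := (el k).
Local Notation D := (D k).
Local Notation psi := (psiE E).
Local Notation uhat := (uhat k).
Local Notation yhat := (yhat E).

Let c2 : 2%:R != 0 :> F := char0 1.
Let s4 : size psi = 4 := size_psiE E c2.

Lemma dpsi_horner x : (dpsi psi).[x] = dpsiE E x.
Proof.
have e4 : 4%:R != 0 :> F := char0 3.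
rewrite /dpsi /psiE /dpsiE hornerZ !derivD !derivZ !derivXn derivX derivC.
rewrite !hornerD !hornerZ !hornerMn !hornerXn horner0 hornerC /=.
by field.
Qed.

Lemma sepE a : psi.[a] = 0 -> (dpsi psi).[a] != 0.
Proof. by rewrite dpsi_horner; apply: psiE_sep. Qed.

(** Modulo such elements, a combination of the u_R and of constants stands
    for the class of a divisor together with a connection on it. *)
Definition dlog (g : K) := exists2 T, T != 0 & D T = g * T.

Lemma dlog_add g h : dlog g -> dlog h -> dlog (g + h).
Proof.
move=> [T T0 dT] [S S0 dS]; exists (T * S); first by rewrite mulf_neq0.
by rewrite D_mul // dT dS; ring.
Qed.

Lemma dlog_opp g : dlog g -> dlog (- g).
Proof.
move=> [T T0 dT]; exists T^-1; first by rewrite invr_eq0.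
by rewrite D_inv // dT; field.
Qed.

Lemma dlog_sub g h : dlog g -> dlog h -> dlog (g - h).
Proof. by move=> hg hh; apply: dlog_add => //; apply: dlog_opp. Qed.

Lemma dlog0 : dlog 0.
Proof. by exists 1; rewrite ?oner_eq0 // D1 mul0r. Qed.

Lemma dlog_natmul n g : dlog g -> dlog (n%:R * g).
Proof.
move=> hg; elim: n => [|n IH]; first by rewrite mul0r; apply: dlog0.
by rewrite -natr1 mulrDl mul1r; apply: dlog_add.
Qed.

Lemma pxC_nat n (c : F) : n%:R * px c%:P = px (n%:R * c)%:P.
Proof. by rewrite polyCM rmorphM polyC_natr rmorph_nat. Qed.

Lemma dlog_principal s c : (forall q, q \in s -> q.2 ^+ 2 = psi.[q.1]) ->
  dlog (\sum_(q <- s) uhat q + px c%:P) ->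
  exists A B, [/\ el A B != 0, D (el A B) = (\sum_(q <- s) uhat q + px c%:P) * el A B
   & size (A ^+ 2 - B ^+ 2 * psi) = (size s).+1].
Proof.
move=> ons [T T0 dT].
have [A [B [eT sz]]] := principal char0 sepE s4 ons T0 dT.
by exists A, B; rewrite -eT.
Qed.

(** A nonzero B makes the norm of degree at least 3, the degree of psi. *)
Lemma norm_small A B d : (d < 3)%N -> size (A ^+ 2 - B ^+ 2 * psi) = d.+1 ->
  B = 0 /\ (size A).*2 = d.+2.
Proof.
move=> ltd; rewrite size_norm //; have [->|B0] := eqVneq B 0.
  have [->|A0] := eqVneq A 0; first by rewrite size_poly0.
  move=> e; split=> //; move: A0 e; rewrite -(size_poly_gt0 A).
  by move: (size A) => n; lia.
rewrite -(size_poly_gt0 B) in B0; move: B0; case: eqP => _;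
  by move: (size A) (size B) => n n'; lia.
Qed.

Lemma dlog_cst0 c : dlog (px c%:P) -> c = 0.
Proof.
move=> hc; have [//||A [B [T0 dT]]] := @dlog_principal [::] c.
  by rewrite big_nil add0r.
move: dT; rewrite big_nil add0r => dT /(norm_small (isT : (0 < 3)%N)) [B0 sA].
have {}sA : size A = 1%N by move: sA; move: (size A) => n; lia.
move: dT T0; rewrite B0 el_px D_px (size1_polyC (eq_leq sA)) derivC rmorph0 mul0r.
move/esym/eqP; rewrite mulf_eq0 => /orP[|/eqP ->]; last by rewrite eqxx.
by rewrite px_eq0 polyC_eq0 => /eqP.
Qed.

(** A function with a single affine zero would have norm of degree 1, which
    is not a norm: no function has a divisor of the form (R) - (0_E). *)
Lemma dlog_single q c : q.2 ^+ 2 = psi.[q.1] -> ~ dlog (uhat q + px c%:P).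
Proof.
move=> onq hq; have [||A [B [_ _]]] := @dlog_principal [:: q] c.
- by move=> q'; rewrite inE => /eqP ->.
- by rewrite big_seq1.
move=> /(norm_small (isT : (1 < 3)%N)) [_]; move: (size A) => n; lia.
Qed.

(** A function with two affine zeros r and s is a polynomial in x of degree
    1, so its zeros are conjugate. *)
Lemma dlog_pair (r s : F * F) c : r.2 ^+ 2 = psi.[r.1] -> s.2 ^+ 2 = psi.[s.1] ->
  dlog (uhat r + uhat s + px c%:P) -> s = (r.1, - r.2).
Proof.
move=> onr ons hrs; have [||A [B [_]]] := @dlog_principal [:: r; s] c.
- by move=> q'; rewrite !inE => /orP[] /eqP ->.
- by rewrite big_cons big_seq1.
rewrite big_cons big_seq1 => dT /(norm_small (isT : (2 < 3)%N)) [B0 sA].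
have {}sA : size A = 2 by move: sA; move: (size A) => n; lia.
have A0 : A != 0 by rewrite -size_poly_gt0 sA.
move: dT; rewrite B0 el_px D_px => dT.
have : el ((r.2 *: ('X - s.1%:P) + s.2 *: ('X - r.1%:P)
           + (2%:R * c) *: (('X - r.1%:P) * ('X - s.1%:P))) * A)
          ((('X - s.1%:P) + ('X - r.1%:P)) * A)
     = el 0 (2%:R * (('X - r.1%:P) * ('X - s.1%:P)) * A^`()).
  move: dT; rewrite /uhat /el -!mul_polyC !(rmorphM, rmorphD, rmorph_nat) /=.
  rewrite -![px 'X + _]rmorphD ?polyC_natr ?rmorph_nat rmorph0 add0r.
  move: (pxX_neq0 k r.1) (pxX_neq0 k s.1) (K2_neq0 char0 k).
  move: (px ('X - r.1%:P)) (px ('X - s.1%:P)) => u v u0 v0 k2 e.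
  transitivity (2%:R * u * v * (px A^`() * yy)); last by ring.
  by rewrite e; field; rewrite u0 v0 k2.
move=> /el_inj[/eqP]; rewrite mulf_eq0 (negPf A0) orbF => /eqP eC eY.
have r1s1 : r.1 = s.1.
  apply/eqP; apply: contraT => ne.
  have ne' : s.1 - r.1 != 0 by rewrite subr_eq0 eq_sym.
  have ne2 : r.1 - s.1 != 0 by rewrite subr_eq0.
  have ar : root A r.1.
    have /eqP := congr1 (fun p => p.[r.1]) eY.
    rewrite !hornerM !hornerD !hornerN !hornerX !hornerC subrr addr0 mul0r mulr0 mul0r.
    by rewrite mulf_eq0 (negPf ne2).
  have as1 : root A s.1.
    have /eqP := congr1 (fun p => p.[s.1]) eY.
    rewrite !hornerM !hornerD !hornerN !hornerX !hornerC subrr add0r !mulr0 mul0r.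
    by rewrite mulf_eq0 (negPf ne').
  have := max_poly_roots (rs := [:: r.1; s.1]) A0.
  by rewrite /= ar as1 inE ne /= sA => /(_ isT isT).
have /eqP : 'X - r.1%:P == 0 -> False by rewrite polyXsubC_eq0.
move=> _; have : ((r.2 + s.2)%:P + (2%:R * c) *: ('X - r.1%:P)) * ('X - r.1%:P) = 0.
  by rewrite -eC -r1s1 -!mul_polyC polyCD; ring.
move=> /eqP; rewrite mulf_eq0 polyXsubC_eq0 orbF => /eqP /(congr1 (fun p => p.[r.1])).
rewrite hornerD hornerZ hornerXsubC subrr mulr0 addr0 hornerC horner0 => e.
by rewrite [s]surjective_pairing -r1s1; congr (_, _); apply/eqP; rewrite -addr_eq0 addrC e.
Qed.

Definition xY (x y : F) : F * F := (x, yhat x y).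
Definition U (R : point F) : K := if R is Aff x y then uhat (xY x y) else 0.

Lemma uhat_pm x b : uhat (x, b) + uhat (x, - b) = yy / px ('X - x%:P).
Proof.
rewrite /uhat /= polyCN rmorphN.
move: (pxX_neq0 k x) (K2_neq0 char0 k); move: (px ('X - _)) => u u0 k2.
by field; rewrite u0 k2.
Qed.

Lemma dlog_vertical x b : dlog (uhat (x, b) + uhat (x, - b)).
Proof.
exists (px ('X - x%:P)); first exact: pxX_neq0.
by rewrite uhat_pm divfK ?pxX_neq0 // D_px derivXsubC rmorph1 mul1r.
Qed.

(** The affine zeros of Y - 2 (l x + nu) are the three points of the line. *)
Lemma dlog_line (l nu x1 x2 x3 : F) :
  psi = 4%:R *: (('X - x1%:P) * ('X - x2%:P) * ('X - x3%:P) + (l *: 'X + nu%:P) ^+ 2) ->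
  dlog (uhat (x1, 2%:R * (l * x1 + nu)) + uhat (x2, 2%:R * (l * x2 + nu))
        + uhat (x3, 2%:R * (l * x3 + nu)) + px l%:P).
Proof.
move=> epsi; exists (yy - 2%:R * px (l *: 'X + nu%:P)).
  apply/eqP => e0.
  have : el (- (2%:R * (l *: 'X + nu%:P))) 1 = 0.
    by rewrite /el rmorphN rmorphM rmorph_nat rmorph1 mul1r -[RHS]e0 addrC.
  by move=> /el_eq0[_ /eqP]; rewrite oner_eq0.
have dpsiX : px (dpsi psi) = 2%:R * (px ('X - x2%:P) * px ('X - x3%:P)
     + px ('X - x1%:P) * px ('X - x3%:P) + px ('X - x1%:P) * px ('X - x2%:P)
     + 2%:R * px l%:P * px (l *: 'X + nu%:P)).
  rewrite -!(rmorph_nat px) -!(rmorphM px) -!(rmorphD px) -(rmorphM px).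
  congr (px _).
  rewrite /dpsi epsi derivZ scalerA derivD expr2 !derivM !derivXsubC derivD derivZ derivX derivC.
  have -> : 2%:R^-1 * 4%:R = 2%:R :> F by field; exact: (char0 1).
  by rewrite addr0 scaler_nat -mulr_natl -!mul_polyC; ring.
have yyE : yy ^+ 2 = 4%:R * (px ('X - x1%:P) * px ('X - x2%:P) * px ('X - x3%:P)
     + px (l *: 'X + nu%:P) ^+ 2).
  rewrite yy_sqr -(rmorph_nat px) -!(rmorphM px) -(rmorphXn px) -(rmorphD px) -rmorphM.
  by congr (px _); rewrite {1}epsi scaler_nat mulr_natl.
have lin x : px (2%:R * (l * x + nu))%:P =
    2%:R * px (l *: 'X + nu%:P) - 2%:R * px l%:P * px ('X - x%:P).
  rewrite -!(rmorph_nat px) -!(rmorphM px) -!(rmorphB px).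
  by congr (px _); rewrite !(polyCM, polyCD) -mul_polyC; ring.
have D2 : D 2%:R = 0.
  by rewrite -(rmorph_nat px) D_px -polyC_natr derivC rmorph0 mul0r.
have -> : D (yy - 2%:R * px (l *: 'X + nu%:P)) = px (dpsi psi) - 2%:R * (px l%:P * yy).
  rewrite D_sub D_yy D_mul //.
  have -> : D (px (l *: 'X + nu%:P)) = px l%:P * yy.
    by rewrite D_px derivD derivZ derivX derivC addr0 alg_polyC.
  by rewrite D2; ring.
rewrite dpsiX /uhat /= !lin.
move: (pxX_neq0 k x1) (pxX_neq0 k x2) (pxX_neq0 k x3) (K2_neq0 char0 k) yyE.
move: (px ('X - x1%:P)) (px ('X - x2%:P)) (px ('X - x3%:P)) => u v w u0 v0 w0 k2.
move: (px _) (px _) yy => m n y yE.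
have -> : ((y + (2%:R * n - 2%:R * m * u)) / (2%:R * u)
    + (y + (2%:R * n - 2%:R * m * v)) / (2%:R * v)
    + (y + (2%:R * n - 2%:R * m * w)) / (2%:R * w) + m) * (y - 2%:R * n)
  = (y ^+ 2 - 4%:R * n ^+ 2) / 2%:R * (u^-1 + v^-1 + w^-1) - 2%:R * m * (y - 2%:R * n).
  by field; rewrite u0 v0 w0 k2.
by rewrite yE; field; rewrite u0 v0 w0 k2.
Qed.

End Pic.

(** * The group law modulo logarithmic derivatives *)

Section Points.
Variables (F : closedFieldType) (E : weierstrass F) (K : fieldType).
Hypothesis char0 : forall n, n.+1%:R != 0 :> F.
Hypothesis ell : elliptic E.
Variable k : hyperelliptic_field (psiE E) K.
Local Notation px := (px k).
Local Notation psi := (psiE E).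
Local Notation uhat := (uhat k).
Local Notation yhat := (yhat E).
Local Notation U := (U k).
Local Notation dlog := (dlog k).
Local Notation dbl := (dbl E).

Let c2 : 2%:R != 0 :> F := char0 1.

(** The quotient of the line through R, S by the vertical line through
    R + S; the constant is the slope of the line. *)
Lemma addp_dlog R S : on_curve E R -> on_curve E S ->
  on_curve E (addp E R S) /\ exists c, dlog (U R + U S - U (addp E R S) + px c%:P) /\
    (R = S -> R <> Inf -> addp E R S <> Inf -> c = slope E R).
Proof.
case: R S => [|x1 y1] [|x2 y2] onR onS.
- by split=> //; exists 0; split=> //; rewrite /= !(polyC0, rmorph0, addr0, subr0); apply: dlog0.
- split=> //; exists 0; split=> //; rewrite /= !(polyC0, rmorph0, addr0, add0r) subrr; exact: dlog0.
- split=> //; exists 0; split=> //; rewrite /= !(polyC0, rmorph0, addr0) subrr; exact: dlog0.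
have [deg|ndeg] := boolP ((x1 == x2) && (y1 + y2 + wa1 E * x2 + wa3 E == 0)).
  have e : addp E (Aff x1 y1) (Aff x2 y2) = Inf by rewrite /addp deg.
  rewrite e; split=> //; exists 0; split=> //.
  move/andP: deg => [/eqP e12 /eqP ey]; rewrite /= subr0 polyC0 rmorph0 addr0 /xY.
  have -> : yhat x2 y2 = - yhat x1 y1.
    by apply/eqP; rewrite -addr_eq0 -(mulr0 2%:R) -ey /yhat e12; apply/eqP; ring.
  by rewrite -e12; apply: dlog_vertical.
have [l [nu [x3 [y3 [e h1 h2 h3 [epsi sl]]]]]] := addp_collinear c2 onR onS ndeg.
rewrite e; split.
  apply: on_curveI => //; rewrite h3 epsi hornerZ hornerD horner_exp 2!hornerM.
  by rewrite !hornerXsubC subrr mulr0 add0r hornerD hornerZ hornerX hornerC; ring.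
exists l; split; last by move=> [ex ey] _ _; apply: sl.
rewrite /= /xY h1 h2 h3.
have := dlog_sub char0 (dlog_line char0 k epsi) (dlog_vertical char0 k x3 (2%:R * (l * x3 + nu))).
by congr (dlog _); ring.
Qed.

Lemma mulp_dlog Q n : on_curve E Q -> on_curve E (mulp E n Q) /\
  exists c, dlog (n%:R * U Q - U (mulp E n Q) + px c%:P).
Proof.
move=> onQ; elim: n => [|n [onM [c hc]]].
  by split=> //; exists 0; rewrite /= mul0r subr0 polyC0 rmorph0 addr0; apply: dlog0.
have [onA [c' [hc' _]]] := addp_dlog onQ onM.
rewrite [mulp E n.+1 Q]/(addp E Q (mulp E n Q)); split=> //.
exists (c + c'); have := dlog_add char0 hc hc'.
by congr (dlog _); rewrite -natr1 polyCD rmorphD; ring.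
Qed.

Lemma dbl_dlog Q i : on_curve E Q -> on_curve E (iter i dbl Q) /\
  exists c, dlog ((2 ^ i)%:R * U Q - U (iter i dbl Q) + px c%:P).
Proof.
move=> onQ; elim: i => [|i [onM [c hc]]].
  by split=> //; exists 0; rewrite /= mul1r subrr polyC0 rmorph0 addr0; apply: dlog0.
have [onA [c' [hc' _]]] := addp_dlog onM onM; split=> //.
exists (c * 2%:R + c'); have := dlog_add char0 (dlog_natmul char0 2 hc) hc'.
by congr (dlog _); rewrite expnS natrM polyCD polyCM polyC_natr rmorphD rmorphM rmorph_nat /=; ring.
Qed.

(** Distinct points have distinct divisor classes.  The sign of S is changed
    with a vertical line, so that [dlog_pair] applies. *)
Lemma U_inj R S c : on_curve E R -> on_curve E S -> dlog (U R - U S + px c%:P) -> R = S.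
Proof.
case: R S => [|x1 y1] [|x2 y2] onR onS //= h.
- have := dlog_opp char0 h.
  have -> : - (0 - uhat (xY E x2 y2) + px c%:P) = uhat (xY E x2 y2) + px (- c)%:P.
    by rewrite polyCN rmorphN; ring.
  by move=> /(dlog_single char0 ell); case; apply: on_curveE.
- by move: h; rewrite subr0 => /(dlog_single char0 ell); case; apply: on_curveE.
have h2 := dlog_add char0 h (dlog_vertical char0 k x2 (yhat x2 y2)).
have : dlog (uhat (xY E x1 y1) + uhat (x2, - yhat x2 y2) + px c%:P).
  by move: h2; congr (dlog _); rewrite /=; ring.
have sq z : (- z) ^+ 2 = z ^+ 2 :> F by rewrite sqrrN.
have onS' : (x2, - yhat x2 y2).2 ^+ 2 = psi.[(x2, - yhat x2 y2).1].
  by rewrite /= sq on_curveE.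
move=> h3; have := dlog_pair char0 ell (r := xY E x1 y1) (on_curveE onR) onS' h3.
move=> -[-> /oppr_inj].
rewrite /yhat => /addIr /addIr e; congr Aff.
by apply: (mulfI c2).
Qed.

(** With u n = v m + 1, subtract v times the second relation from u times
    the first. *)
Lemma dlog_bezout n m g c c' : coprime n m -> (0 < n)%N ->
  dlog (n%:R * g + px c%:P) -> dlog (m%:R * g + px c'%:P) ->
  exists c0, dlog (g + px c0%:P).
Proof.
move=> cop n0 hn hm; have [u v e _] := egcdnP m n0.
rewrite (eqP cop) in e.
exists (u%:R * c - v%:R * c').
have := dlog_sub char0 (dlog_natmul char0 u hn) (dlog_natmul char0 v hm).
congr (dlog _); rewrite polyCB !polyCM !polyC_natr rmorphB !rmorphM !rmorph_nat /=.
rewrite !mulrDr !mulrA -!natrM e natrD; ring.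
Qed.

Section Torsion.
Variables (Q : point F) (n : nat).
Hypothesis onQ : on_curve E Q.
Hypothesis nQ : mulp E n Q = Inf.
Hypothesis oddn : odd n.
Hypothesis QInf : Q <> Inf.

(** Otherwise n and 2^i both kill the class of Q up to a constant, and so
    does 1.  Working with classes dispenses with the associativity of the
    addition of points. *)
Lemma dbl_affine i : iter i dbl Q <> Inf.
Proof.
move=> eInf; have [_ [c hc]] := mulp_dlog n onQ; have [_ [c' hc']] := dbl_dlog i onQ.
rewrite nQ subr0 in hc; rewrite eInf subr0 in hc'.
have cop : coprime n (2 ^ i) by rewrite coprimeXr // coprimen2.
have [c0 h0] := dlog_bezout cop (odd_gt0 oddn) hc hc'.
by apply: QInf; apply: (U_inj (c := c0) onQ (S := Inf)) => //; rewrite subr0.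
Qed.

(** Euler's theorem: 2 to the totient of n is 1 modulo n. *)
Lemma dbl_periodic : exists2 j, (0 < j)%N & iter j dbl Q = Q.
Proof.
exists (totient n); first by rewrite totient_gt0 odd_gt0.
have [_ [c hc]] := mulp_dlog n onQ; rewrite nQ subr0 in hc.
have [on2 [c' hc']] := dbl_dlog (totient n) onQ.
have n0 := odd_gt0 oddn.
have e : (2 ^ totient n = 1 + (2 ^ totient n %/ n) * n)%N \/ n = 1%N.
  have [->|n1] := eqVneq n 1%N; [by right|left].
  rewrite {1}(divn_eq (2 ^ totient n) n) Euler_exp_totient ?coprime2n //.
  by rewrite modn_small 1?addnC // ltn_neqAle eq_sym n1.
case: e => [e|n1]; last first.
  by move: nQ; rewrite n1 /= => eQ; case: (QInf); move: eQ; case: (Q).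
apply: esym; apply: (U_inj (c := c' - (2 ^ totient n %/ n)%:R * c) onQ on2).
have := dlog_sub char0 hc' (dlog_natmul char0 (2 ^ totient n %/ n) hc).
congr (dlog _); rewrite {1}e natrD natrM polyCB polyCM polyC_natr rmorphB rmorphM rmorph_nat /=.
ring.
Qed.

(** The constant accumulated by the doublings of Q, in Horner form. *)
Fixpoint slope_sum (i : nat) : F :=
  if i is i'.+1 then 2%:R * slope_sum i' + slope E (iter i' dbl Q) else 0.

Lemma slope_sum_dlog i :
  dlog ((2 ^ i)%:R * U Q - U (iter i dbl Q) + px (slope_sum i)%:P).
Proof.
elim: i => [|i IH].
  by rewrite /= mul1r subrr polyC0 rmorph0 addr0; apply: dlog0.
have [onM _] := dbl_dlog i onQ.
have [_ [c [hc ec]]] := addp_dlog onM onM.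
rewrite (ec erefl (dbl_affine (i := i)) (dbl_affine (i := i.+1))) in hc.
have := dlog_add char0 (dlog_natmul char0 2 IH) hc.
by congr (dlog _); rewrite /= expnS natrM polyCD polyCM polyC_natr rmorphD rmorphM rmorph_nat /=; ring.
Qed.

End Torsion.
End Points.

(** * The function field of a Weierstrass equation *)

Section QuadraticPresentation.
Variables (F : fieldType) (E : weierstrass F) (K : fieldType).
Variable q : {rmorphism {poly {fraction {poly F}}} -> K}.
Hypothesis c2 : 2%:R != 0 :> F.
Hypothesis q_weq : q (weq E) = 0.
Hypothesis q_inj : forall p : {poly {fraction {poly F}}}, (size p <= 2)%N -> q p = 0 -> p = 0.
Hypothesis q_surj : forall z, exists2 p : {poly {fraction {poly F}}}, (size p <= 2)%N & z = q p.

(** The function field is handled through a ring morphism q from the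
    polynomials in Y, so that no computation ever unfolds the quotient. *)
Definition qpx (A : {poly F}) : K := q (tofrac A)%:P.
Lemma qpx_zmod : zmod_morphism qpx.
Proof. by move=> A B; rewrite /qpx !rmorphB. Qed.
Lemma qpx_mon : monoid_morphism qpx.
Proof.
split=> [|A B]; rewrite /qpx; first by rewrite tofrac1 polyC1 (rmorph1 q).
by rewrite tofracM polyCM (rmorphM q).
Qed.
HB.instance Definition _ := GRing.isZmodMorphism.Build _ _ qpx qpx_zmod.
HB.instance Definition _ := GRing.isMonoidMorphism.Build _ _ qpx qpx_mon.

(** 2Y + a1 x + a3, whose square is the cubic [psiE]. *)
Definition qY : K := 2%:R * q 'X + qpx (weq_lin E).

Lemma qpx_eq0 A : (qpx A == 0) = (A == 0).
Proof.
apply/eqP/eqP => [e|->]; last exact: rmorph0.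
have /eqP := q_inj (leq_trans (size_polyC_leq1 _) (isT : (1 <= 2)%N)) e.
by rewrite polyC_eq0 tofrac_eq0 => /eqP.
Qed.

Lemma qX_sqr : q 'X ^+ 2 + qpx (weq_lin E) * q 'X = qpx (weq_rhs E).
Proof.
apply/eqP; rewrite -subr_eq0; apply/eqP; rewrite -[RHS]q_weq /weq /qpx.
by rewrite (rmorphB q) (rmorphD q) (rmorphXn q) (rmorphM q).
Qed.

Lemma psiE_lin : psiE E = weq_lin E ^+ 2 + 4%:R * weq_rhs E.
Proof.
rewrite /psiE /weq_lin /weq_rhs /wb2 /wb4 /wb6 -!mul_polyC.
rewrite !(polyCD, polyCM, polyC_exp); ring.
Qed.

Lemma qY_sqr : qY ^+ 2 = qpx (psiE E).
Proof.
rewrite psiE_lin rmorphD rmorphXn rmorphM rmorph_nat /= -qX_sqr /qY; ring.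
Qed.

Let p2 : 2%:R != 0 :> {poly F}. Proof. by rewrite -polyC_natr polyC_eq0. Qed.
Let K2 : 2%:R != 0 :> K. Proof. by rewrite -(rmorph_nat qpx) qpx_eq0. Qed.

Lemma q_ratio r : exists A B, B != 0 /\ q r%:P = qpx A / qpx B.
Proof.
have [A [B [B0 ->]]] := frac_ratio r; exists A, B; split=> //.
apply: (canRL (mulfK _)); first by rewrite qpx_eq0.
by rewrite /qpx -(rmorphM q) -polyCM divfK // tofrac_eq0.
Qed.

Lemma poly_size2 (R : nzRingType) (p : {poly R}) :
  (size p <= 2)%N -> p = (p`_0)%:P + (p`_1)%:P * 'X.
Proof.
move=> sp; apply/polyP => i; rewrite coefD coefC coefCM coefX.
case: i => [|[|i]]; rewrite /= ?mulr0 ?mulr1 ?addr0 ?add0r //.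
by rewrite nth_default // (leq_trans sp).
Qed.

Lemma lin_poly_eq0 (R : nzRingType) (c d : R) : c%:P + d%:P * 'X = 0 -> c = 0 /\ d = 0.
Proof.
move=> e; have h i : (c%:P + d%:P * 'X)`_i = 0 by rewrite e coef0.
move: (h 0%N) (h 1%N); rewrite !coefD !coefC !coefCM !coefX /=.
by rewrite mulr0 mulr1 addr0 add0r.
Qed.

Lemma q_gen z : exists A B C, C != 0 /\ z = (qpx A + qpx B * qY) / qpx C.
Proof.
have [p sp ez] := q_surj z.
have [A [B [B0 eA]]] := q_ratio p`_0; have [C [G [G0 eC]]] := q_ratio p`_1.
have {}ez : z = qpx A / qpx B + qpx C / qpx G * q 'X.
  apply: (eq_trans ez); apply: (eq_trans (congr1 q (poly_size2 sp))).
  apply: (eq_trans (rmorphD q _ _)); apply: (congr2 +%R eA).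
  exact: (eq_trans (rmorphM q _ _) (congr1 (fun w => w * q 'X) eC)).
rewrite {}ez {eA eC p sp}.
exists (2%:R * A * G - C * B * weq_lin E), (C * B), (2%:R * B * G).
split; first by rewrite !mulf_neq0.
rewrite /qY rmorphB !rmorphM rmorph_nat /=.
move: B0 G0; rewrite -(qpx_eq0 B) -(qpx_eq0 G).
move: (qpx A) (qpx B) (qpx C) (qpx G) (qpx (weq_lin E)) (q 'X) => a b c g l y b0 g0.
by field; rewrite b0 g0 K2.
Qed.

Lemma q_free A B : qpx A + qpx B * qY = 0 -> A = 0 /\ B = 0.
Proof.
rewrite /qY => e.
have : q ((tofrac (A + B * weq_lin E))%:P + (tofrac (2%:R * B))%:P * 'X) = 0.
  apply: (eq_trans (rmorphD q _ _)); apply: (eq_trans (congr1 _ (rmorphM q _ _))).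
  rewrite -[LHS]/(qpx (A + B * weq_lin E) + qpx (2%:R * B) * q 'X).
  have -> : qpx (A + B * weq_lin E) = qpx A + qpx B * qpx (weq_lin E).
    by rewrite rmorphD rmorphM.
  have -> : qpx (2%:R * B) = 2%:R * qpx B by rewrite rmorphM rmorph_nat.
  move: e; move: (qpx A) (qpx B) (qpx (weq_lin E)) (q 'X) => a b l x e.
  by rewrite -[RHS]e; ring.
move=> /q_inj e2.
have {}e2 : (tofrac (A + B * weq_lin E))%:P + (tofrac (2%:R * B))%:P * 'X = 0.
  apply: e2; apply: leq_trans (size_polyD _ _) _; rewrite geq_max.
  rewrite (leq_trans (size_polyC_leq1 _)) //= mul_polyC.
  by rewrite (leq_trans (size_scale_leq _ _)) // size_polyX.
have [/eqP] := lin_poly_eq0 e2.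
rewrite tofrac_eq0 => /eqP eA /eqP; rewrite tofrac_eq0.
rewrite mulf_eq0 (negPf p2) /= => /eqP B0; split=> //.
by rewrite -eA B0 mul0r addr0.
Qed.

Definition hyperelliptic_of : hyperelliptic_field (psiE E) K :=
  @HyperellipticField _ (psiE E) K qpx qY qY_sqr q_gen q_free.

End QuadraticPresentation.

Section FunFieldPresentation.
Variables (F : fieldType) (E : weierstrass F).

Definition qE : {rmorphism {poly {fraction {poly F}}} -> funfield E} :=
  in_qpoly (weq E).

Lemma weq_mk : mk_monic (weq E) = weq E.
Proof. by rewrite /mk_monic size_weq monic_weq. Qed.

Lemma qE_weq : qE (weq E) = 0.
Proof.
apply: val_inj => /=; rewrite weq_mk; exact: (Pdiv.RingMonic.rmodpp (monic_weq E)).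
Qed.

Lemma qE_inj (p : {poly {fraction {poly F}}}) : (size p <= 2)%N -> qE p = 0 -> p = 0.
Proof.
move=> sp e; have e2 : polyn (in_qpoly (weq E) p) = 0 := congr1 (@polyn _ _) e.
apply: eq_trans e2; apply: esym; apply: in_qpoly_small.
by rewrite weq_mk size_weq ltnS.
Qed.

Lemma qE_surj z : exists2 p : {poly {fraction {poly F}}}, (size p <= 2)%N & z = qE p.
Proof.
have sz := size_mk_monic z; exists (polyn z).
  have e : size (mk_monic (weq E)) = 3 by rewrite weq_mk size_weq.
  by have := leq_trans sz (eq_leq e); rewrite ltnS.
by apply: val_inj; apply: esym; apply: in_qpoly_small.
Qed.

End FunFieldPresentation.

(** * The ramification of a Lame function *)

Section Ramification.
Variables (F : closedFieldType) (psi : {poly F}) (K : fieldType).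
Hypothesis char0 : forall n, n.+1%:R != 0 :> F.
Variable k : hyperelliptic_field psi K.
Hypothesis s4 : size psi = 4.
Local Notation px := (px k).
Local Notation yy := (yy k).
Local Notation el := (el k).
Local Notation D := (D k).
Local Notation val_at := (val_at k).
Local Notation regular := (regular k).
Local Notation dpsi := (dpsi psi).
Local Notation uhat := (uhat k).

Lemma one_root (N : {poly F}) a : N != 0 -> (forall x, root N x -> x = a) ->
  exists m c, N = c *: ('X - a%:P) ^+ m.
Proof.
move=> N0 hr; have [m [q]] := multiplicity_XsubC N a; rewrite N0 /= => qa eN.
have [sq|/closed_rootP[x rx]] := eqVneq (size q) 1%N.
  by exists m, q`_0; rewrite eN {1}(size1_polyC (eq_leq sq)) mul_polyC.
have ex : x = a by apply: hr; rewrite eN rootM rx.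
by rewrite -ex rx in qa.
Qed.

Lemma regular_mul a b z w : b ^+ 2 = psi.[a] -> regular a b z -> regular a b w ->
  regular a b (z * w).
Proof. by move=> on [u hu] [v hv]; exists (u * v); apply: val_mul. Qed.
Lemma regular_add a b z w : b ^+ 2 = psi.[a] -> regular a b z -> regular a b w ->
  regular a b (z + w).
Proof. by move=> on [u hu] [v hv]; exists (u + v); apply: val_add. Qed.
Lemma regular_nat a b n : regular a b n%:R.
Proof. by exists n%:R; apply: val_nat. Qed.

Lemma size_XsubC_deriv (p : {poly F}) c : (size (('X - c%:P) * p^`())%R <= size p)%N.
Proof.
have [->|p0] := eqVneq p 0; first by rewrite deriv0 mulr0 size_poly0.
have [d0|d0] := eqVneq p^`() 0; first by rewrite d0 mulr0 size_poly0.
by rewrite size_mul ?polyXsubC_eq0 // size_XsubC lt_size_deriv.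
Qed.

(** The hypotheses say that (x - c) Df / f = al + h Y for f = A + BY.  At
    infinity the left side has a pole of order at most 3, which leaves for al
    a degree at most 1; the bounds on sizes are the elementary form of this. *)
Lemma log_part_size A B al h c : (A != 0) || (B != 0) ->
  ('X - c%:P) * (B^`() * psi + B * dpsi) = al * A + h%:P * B * psi ->
  ('X - c%:P) * A^`() = al * B + h%:P * A -> (size al <= 2)%N.
Proof.
move=> AB0 e1 e2; have psi0 : psi != 0 by rewrite -size_poly_gt0 s4.
have [->|al0] := eqVneq al 0; first by rewrite size_poly0.
have sB : (size (al * B)%R <= size A)%N.
  have -> : al * B = ('X - c%:P) * A^`() - h%:P * A by rewrite e2; ring.
  apply: leq_trans (size_polyD _ _) _; rewrite geq_max size_XsubC_deriv size_polyN.
  by rewrite mul_polyC size_scale_leq.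
have [A0|A0] := eqVneq A 0.
  move: AB0 sB; rewrite A0 eqxx /= size_poly0 leqn0 size_poly_eq0 mulf_eq0 (negPf al0) /=.
  by move=> /negPf ->.
have [B0|B0] := eqVneq B 0.
  have : al * A == 0.
    have -> : al * A = ('X - c%:P) * (B^`() * psi + B * dpsi) - h%:P * B * psi.
      by rewrite e1; ring.
    by rewrite B0 deriv0 !(mul0r, mulr0, addr0, subr0).
  by rewrite mulf_eq0 (negPf al0) (negPf A0).
have sBp : (size (B * psi)%R <= size B + 3)%N.
  by apply: leq_trans (size_polyMleq _ _) _; rewrite s4 !addnS !addn0.
have sBd : (size (B * dpsi)%R <= size B + 2)%N.
  apply: leq_trans (size_polyMleq _ _) _.
  have sd : (size dpsi <= 3)%N.
    apply: leq_trans (size_scale_leq _ _) _.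
    by have := lt_size_deriv psi0; rewrite s4 ltnS.
  apply: (@leq_trans (size B + 3).-1); last by rewrite !addnS.
  by rewrite -!subn1 leq_sub2r // leq_add2l.
have sA : (size (al * A)%R <= size B + 3)%N.
  have -> : al * A = ('X - c%:P) * B^`() * psi + ('X - c%:P) * (B * dpsi) - h%:P * (B * psi).
    by rewrite -!mulrA -mulrDr e1; ring.
  apply: leq_trans (size_polyD _ _) _; rewrite geq_max size_polyN; apply/andP; split.
    apply: leq_trans (size_polyD _ _) _; rewrite geq_max; apply/andP; split.
      apply: leq_trans (size_polyMleq _ _) _; rewrite s4 !addnS !addn0 /= !ltnS.
      exact: size_XsubC_deriv.
    apply: leq_trans (size_polyMleq _ _) _; rewrite size_XsubC add2n /= addnS ltnS.
    exact: sBd.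
  by rewrite mul_polyC; apply: leq_trans (size_scale_leq _ _) _.
move: sA sB; rewrite !size_mul //.
move: al0 A0 B0; rewrite -(size_poly_gt0 al) -(size_poly_gt0 A) -(size_poly_gt0 B).
clear; move: (size al) (size A) (size B) => u v w; lia.
Qed.

Ltac solve_regular := repeat (first [ eassumption | apply: regular_nat
  | apply: D_regular | apply: regular_mul | apply: regular_add ]).

Variables (xP YP xQ YQ : F) (f : K) (n : nat).
Hypothesis onP : YP ^+ 2 = psi.[xP].
Hypothesis onQ : YQ ^+ 2 = psi.[xQ].
Hypothesis YP0 : YP != 0.
Hypothesis n0 : (0 < n)%N.
Hypothesis QP : (xQ, YQ) != (xP, YP).
Hypothesis f_unit : forall a b, b ^+ 2 = psi.[a] -> (a, b) != (xP, YP) ->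
  exists2 v, v != 0 & val_at a b f v.
Hypothesis f_P : exists t s w v, [/\ val_at xP YP t 0, regular xP YP s,
  px ('X - xP%:P) = t * s, v != 0 & val_at xP YP w v /\ f = t ^+ n * w].
Hypothesis f_Q : exists c t w, [/\ val_at xQ YQ t 0, regular xQ YQ w &
  f - px c%:P = t ^+ 3 * w].

(** Since f is a unit outside P, it is a polynomial A + BY whose norm is a
    multiple of (x - x_P)^m.  Hence z = (x - x_P) Df / f is regular
    everywhere, z = al + (m / 2) Y with al of degree at most 1, and al is
    determined up to its slope by the vanishing of z at -P: this is
    Df / f = m (u_P - lambda).  By the ramification at Q, z is divisible by
    (x - x_P) t^2 with t in the maximal ideal of Q, so z and D z vanish at Q:
    these are the two equations on lambda.  If Q = -P, they only say that the
    line is tangent at Q; but then x - x_P vanishes at Q as well, so D D z does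
    too, and this is the last equation. *)
Theorem ramification_equations : exists m lam, [/\ (0 < m)%N,
   f != 0 /\ D f = m%:R * (uhat (xP, YP) - px lam%:P) * f,
   (YQ + YP) = 2%:R * lam * (xQ - xP),
   dpsi.[xQ] = 2%:R * lam * YQ &
   (xQ = xP -> dpsi^`().[xQ] * YQ = 2%:R * lam * dpsi.[xQ])].
Proof.
have f0 : f != 0.
  have [v v0 hv] := f_unit onQ QP; exact: (val_neq0 onQ hv v0).
have f_reg a b : b ^+ 2 = psi.[a] -> regular a b f.
  move=> on; have [e|ne] := eqVneq (a, b) (xP, YP); last first.
    by have [v _ hv] := f_unit on ne; exists v.
  case: e on => -> -> on; have [t [s [w [v [ht _ _ v0 [hw ->]]]]]] := f_P.
  by eexists; apply: val_mul => //; [apply: val_exp ht|exact: hw].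
have [A [B ef]] := regular_everywhere f_reg.
set N := A ^+ 2 - B ^+ 2 * psi.
have AB0 : (A != 0) || (B != 0).
  apply: contraNT f0; rewrite negb_or !negbK => /andP[/eqP A0 /eqP B0].
  by rewrite ef A0 B0 /el !rmorph0 mul0r addr0.
have N0 : N != 0.
  rewrite -(px_eq0 k) -el_conj mulf_neq0 -?ef //.
  apply: contraL AB0 => /eqP /el_eq0[-> /eqP]; rewrite oppr_eq0 => /eqP ->.
  by rewrite eqxx.
have Nroot x : root N x -> x = xP.
  have [b onb] := closed_sqrt psi.[x].
  have onb' : (- b) ^+ 2 = psi.[x] by rewrite sqrrN.
  have unit_ev c : c ^+ 2 = psi.[x] -> ev A B x c = 0 -> x = xP.
    move=> onc ec; apply/eqP; apply: contraT => ne.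
    have [|v v0 hv] := f_unit onc; first by rewrite xpair_eqE (negPf ne).
    have : v = ev A B x c by apply: (val_unique onc hv); rewrite ef; apply: val_el.
    by move=> ev0; rewrite ev0 ec eqxx in v0.
  rewrite /root /N -(ev_conj _ _ onb) mulf_eq0 => /orP[] /eqP; exact: unit_ev.
have [m [c eN]] := one_root N0 Nroot.
have evP : ev A B xP YP = 0.
  have [t [s [w [v [ht _ _ v0 [hw ef2]]]]]] := f_P.
  have h1 : val_at xP YP f 0.
    rewrite ef2; apply: val0_mul => //; last by exists v.
    by have := val_exp onP n ht; rewrite expr0n -leqn0 leqNgt n0.
  by apply: (val_unique onP _ h1); rewrite ef; apply: val_el.
have m0 : (0 < m)%N.
  rewrite lt0n; apply/eqP => m0; have : N.[xP] = 0.
    by rewrite /N -(ev_conj _ _ onP) evP mul0r.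
  rewrite eN m0 expr0 hornerZ hornerC mulr1 => c0.
  by move: N0; rewrite eN c0 scale0r eqxx.
have mF : m%:R != 0 :> F by rewrite -(prednK m0) char0.
pose z := px ('X - xP%:P) * (D f / f).
have dlogf_reg a b : b ^+ 2 = psi.[a] -> (a, b) != (xP, YP) -> regular a b (D f / f).
  move=> on ne; have [v v0 hv] := f_unit on ne.
  have [u hu] := D_regular char0 on (f_reg _ _ on).
  by exists (u / v); apply: val_div.
have z_reg a b : b ^+ 2 = psi.[a] -> regular a b z.
  move=> on; have [e|ne] := eqVneq (a, b) (xP, YP); last first.
    apply: regular_mul => //; last exact: dlogf_reg.
    by eexists; apply: val_px.
  case: e on => -> -> on; have [t [s [w [v [ht hs es v0 [hw ef2]]]]]] := f_P.
  have t0 : t != 0.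
    by apply/eqP => t0; have := pxX_neq0 k xP; rewrite es t0 mul0r eqxx.
  have w0 := val_neq0 onP hw v0.
  have -> : z = n%:R * s * D t + t * s * (D w / w).
    have en : t ^+ n = t * t ^+ n.-1 by rewrite -exprS prednK.
    have tn0 : t ^+ n.-1 != 0 by rewrite expf_neq0.
    rewrite /z es ef2 D_mul // D_exp // en; move: (t ^+ n.-1) tn0 => tn tn0.
    by field; rewrite w0 t0 tn0.
  have rt : regular xP YP t by exists 0.
  have rw : regular xP YP w by exists v.
  have rDt := D_regular char0 onP rt.
  have [u hu] := D_regular char0 onP rw.
  have rDw : regular xP YP (D w / w) by exists (u / v); apply: val_div.
  by apply: regular_add => //; apply: regular_mul => //; apply: regular_mul => //;
    apply: regular_nat.
have [al [be ez]] := regular_everywhere z_reg.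
have zf : z * f = px ('X - xP%:P) * D f by rewrite /z -mulrA divfK.
have : el (('X - xP%:P) * (B^`() * psi + B * dpsi)) (('X - xP%:P) * A^`())
     = el (al * A + be * B * psi) (al * B + be * A).
  rewrite -elM -ez -ef zf ef D_el // /del -[px _]el_px elM.
  by congr el; ring.
move=> /el_inj[e1 e2].
have p2 : 2%:R != 0 :> {poly F} by rewrite -polyC_natr polyC_eq0 char0.
have dpsi2 : psi^`() = 2%:R * dpsi.
  by rewrite /dpsi mulr_natl -scaler_nat scalerA mulfV ?scale1r // char0.
have ebe : 2%:R * be = m%:R%:P.
  apply: (mulIf N0); transitivity (('X - xP%:P) * N^`()).
    rewrite /N derivB derivM !expr2 !derivM dpsi2.
    transitivity (2%:R * (A * (('X - xP%:P) * A^`()) - B * (('X - xP%:P) * (B^`() * psi + B * dpsi)))); last by ring.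
    by rewrite e1 e2; ring.
  rewrite eN derivZ deriv_exp derivXsubC mul1r -[m in RHS](prednK m0) exprS.
  rewrite -[in LHS](prednK m0) /= -!mul_polyC -mulr_natr polyC_natr -(prednK m0) /=; ring.
(* be = m / 2, from the logarithmic derivative of the norm c (x - xP)^m *)
pose h := m%:R / 2%:R : F.
have {}ebe : be = h%:P.
  apply: (mulfI p2); rewrite ebe -polyC_natr -polyCM /h; congr _%:P; field; exact: (char0 1).
have sal : (size al <= 2)%N by apply: (log_part_size (h := h) (c := xP) AB0); rewrite -ebe.
have eal := poly_size2 sal.
have vz a b : val_at a b z (al.[a] + h * b).
  by rewrite ez; have := val_el k a b al be; rewrite /ev ebe hornerC.
have valX a b : val_at a b (px ('X - xP%:P)) (a - xP).
  by have := val_px k a b ('X - xP%:P); rewrite hornerXsubC.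
(* f is a unit at the conjugate of P, where x - xP vanishes *)
have alP : al.[xP] = h * YP.
  have onP' : (- YP) ^+ 2 = psi.[xP] by rewrite sqrrN.
  have neP : (xP, - YP) != (xP, YP).
    rewrite xpair_eqE eqxx /= -subr_eq0 -opprD oppr_eq0 -mulr2n -mulr_natl.
    by rewrite mulf_neq0 ?char0.
  have h0 : val_at xP (- YP) z 0.
    apply: val0_mul => //; last exact: dlogf_reg.
    by have := valX xP (- YP); rewrite subrr.
  have /eqP := val_unique onP' (vz xP (- YP)) h0.
  by rewrite mulrN subr_eq0 => /eqP.
set l1 := al`_1 in eal; set l0 := al`_0 in eal.
have alE x : al.[x] = l0 + l1 * x by rewrite eal hornerD hornerM !hornerC hornerX.
exists m, (- l1 / m%:R).
have r_ex : exists2 r, regular xQ YQ r & exists2 t, val_at xQ YQ t 0 &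
    z = px ('X - xP%:P) * t ^+ 2 * r.
  have [c' [t [w [ht hw ef3]]]] := f_Q.
  have [v v0 hv] := f_unit onQ QP.
  have rt : regular xQ YQ t by exists 0.
  have rDt := D_regular char0 onQ rt; have rDw := D_regular char0 onQ hw.
  exists ((3%:R * D t * w + t * D w) / f).
    apply: regular_mul => //; last by exists v^-1; apply: val_inv.
    by apply: regular_add => //; repeat apply: regular_mul => //; apply: regular_nat.
  exists t => //; have -> : z = px ('X - xP%:P) * (D (f - px c'%:P) / f).
    by rewrite D_sub D_cst subr0.
  by rewrite ef3 D_mul // D_exp //=; ring.
have [r hr [t ht ezt]] := r_ex.
have rt : regular xQ YQ t by exists 0.
have Dreg w : regular xQ YQ w -> regular xQ YQ (D w) := D_regular char0 onQ.
have pxXr : regular xQ YQ (px ('X - xP%:P)) by eexists; apply: valX.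
have val0z : val_at xQ YQ z 0.
  rewrite ezt (_ : _ * r = t * (px ('X - xP%:P) * t * r)); last by ring.
  by apply: val0_mul => //; solve_regular.
have val0Dz : val_at xQ YQ (D z) 0.
  set X := px _ in ezt pxXr *.
  have -> : D z = t * (D X * t * r + 2%:R * D t * X * r + X * t * D r).
    by rewrite ezt !D_mul //; ring.
  by apply: val0_mul => //; solve_regular.
have ez2 : z = px al + px h%:P * yy by rewrite ez ebe.
have eDz : D z = px l1%:P * yy + px h%:P * px dpsi.
  rewrite ez2 D_add // D_mul // D_cst D_yy D_px eal derivD derivM !derivC derivX.
  by rewrite !mul0r add0r mulr1 add0r; ring.
have zQ : l0 + l1 * xQ + h * YQ = 0.
  by rewrite -alE; apply: (val_unique onQ (vz _ _) val0z).
have h2 : 2%:R != 0 :> F := char0 1.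
have DzQ : l1 * YQ + h * dpsi.[xQ] = 0.
  apply: (val_unique onQ _ val0Dz); rewrite eDz; apply: val_add => //;
  apply: val_mul => //; by [apply: val_cst|apply: val_yy|apply: val_px].
have hl : h = m%:R / 2%:R by [].
split=> //.
- split=> //; apply: (mulfI (pxX_neq0 k xP)); rewrite -zf ez2 /uhat /=.
  have km : px (- l1 / m%:R)%:P = - px l1%:P / m%:R.
    apply: (mulIf (_ : m%:R != 0)).
      by rewrite -(rmorph_nat px) px_eq0 -polyC_natr polyC_eq0.
    rewrite divfK; last by rewrite -(rmorph_nat px) px_eq0 -polyC_natr polyC_eq0.
    by rewrite -(rmorph_nat px) -rmorphM -polyC_natr -polyCM divfK // polyCN rmorphN.
  have kh : px h%:P = m%:R / 2%:R.
    apply: (mulIf (K2_neq0 char0 k)); rewrite divfK ?(K2_neq0 char0 k) //.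
    by rewrite -(rmorph_nat px 2) -rmorphM -polyC_natr -polyCM /h divfK ?char0 // polyC_natr rmorph_nat.
  have kal : px al = px h%:P * px YP%:P + px l1%:P * px ('X - xP%:P).
    have eal' : al = h%:P * YP%:P + l1%:P * ('X - xP%:P).
      by rewrite -polyCM -alP alE polyCD polyCM {1}eal; ring.
    by rewrite [in LHS]eal' rmorphD !rmorphM.
  have K0 : m%:R != 0 :> K by rewrite -(rmorph_nat px) px_eq0 -polyC_natr polyC_eq0.
  rewrite kal km kh; move: (pxX_neq0 k xP) (K2_neq0 char0 k).
  move: (px ('X - _)) (px l1%:P) (px YP%:P) yy => X l Y y X0 k2.
  by field; rewrite K0 k2 X0.
- have e3 : l0 = h * YP - l1 * xP by rewrite -alP alE; ring.
  have e4 : h * (YQ + YP) = - (l1 * (xQ - xP)).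
    by apply/eqP; rewrite -addr_eq0 -[X in _ == X]zQ e3; apply/eqP; ring.
  have -> : YQ + YP = h * (YQ + YP) * (2%:R / m%:R) by rewrite hl; field; rewrite mF h2.
  by rewrite e4; field.
- have e4 : h * dpsi.[xQ] = - (l1 * YQ).
    by apply/eqP; rewrite -addr_eq0 addrC DzQ.
  have -> : dpsi.[xQ] = h * dpsi.[xQ] * (2%:R / m%:R) by rewrite hl; field; rewrite mF h2.
  by rewrite e4; field.
move=> exQ.
have val0X : val_at xQ YQ (px ('X - xP%:P)) 0 by have := valX xQ YQ; rewrite exQ subrr.
have val0DDz : val_at xQ YQ (D (D z)) 0.
  set X := px _ in ezt pxXr val0X *.
  have -> : D (D z) = t * (D (D X) * t * r + 4%:R * D X * D t * r + 2%:R * D X * t * D r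
     + 2%:R * X * D (D t) * r + 4%:R * X * D t * D r + X * t * D (D r))
     + X * (2%:R * D t * D t * r).
    have -> : D z = t * (D X * t * r + (D t * X * r + D t * X * r) + X * t * D r).
      by rewrite ezt !D_mul //; ring.
    by rewrite !(D_add, D_mul) //; ring.
  rewrite -[X in val_at _ _ _ X]addr0; apply: val_add => //.
    by apply: val0_mul => //; solve_regular.
  by apply: val0_mul => //; solve_regular.
have : l1 * dpsi.[xQ] + h * (dpsi^`().[xQ] * YQ) = 0.
  apply: (val_unique onQ _ val0DDz); rewrite eDz D_add // !D_mul // !D_cst D_yy D_px.
  rewrite !mul0r !add0r; apply: val_add => //.
    by apply: val_mul => //; [apply: val_cst|apply: val_px].
  apply: val_mul => //; first exact: val_cst.
  by apply: val_mul => //; [apply: val_px|apply: val_yy].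
move=> e5; have e6 : h * (dpsi^`().[xQ] * YQ) = - (l1 * dpsi.[xQ]).
  by apply/eqP; rewrite -addr_eq0 addrC e5.
have -> : dpsi^`().[xQ] * YQ = h * (dpsi^`().[xQ] * YQ) * (2%:R / m%:R).
  by rewrite hl; field; rewrite mF h2.
by rewrite e6; field.
Qed.

End Ramification.

(** * Values of germs *)

Lemma horner_map_at_X (F K : nzRingType) (f : {rmorphism F -> K})
  (p : {rmorphism {poly F} -> K}) c :
  (forall a, p a%:P = f a) -> (map_poly f c).[p 'X] = p c.
Proof.
move=> pC; elim/poly_ind: c => [|c a IH]; first by rewrite !rmorph0 horner0.
by rewrite [in LHS]rmorphD [in LHS]rmorphM /= map_polyC map_polyX hornerD hornerMX
  hornerC IH [in RHS]rmorphD [in RHS]rmorphM pC.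
Qed.

Lemma horner2_MXaddC (R : nzRingType) (K : fieldType) (f : {rmorphism R -> K})
   (g : {poly {poly R}}) c (x y : K) :
  (map_poly (map_poly f) (g * 'X + c%:P)).[y%:P].[x]
  = (map_poly (map_poly f) g).[y%:P].[x] * y + (map_poly f c).[x].
Proof.
by rewrite rmorphD rmorphM /= map_polyC map_polyX hornerD hornerMX hornerC hornerD hornerM hornerC.
Qed.

Lemma horner2_C (R : nzRingType) (K : fieldType) (f : {rmorphism R -> K}) c (x y : K) :
  (map_poly (map_poly f) c%:P).[y%:P].[x] = (map_poly f c).[x].
Proof. by rewrite /= map_polyC hornerC. Qed.

Lemma horner2_1 (R : nzRingType) (K : fieldType) (f : {rmorphism R -> K}) (x y : K) :
  (map_poly (map_poly f) 1).[y%:P].[x] = 1.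
Proof. by rewrite rmorph1 !hornerC. Qed.

Section Germs.
Variables (F : closedFieldType) (E : weierstrass F) (K : fieldType).
Variable q : {rmorphism {poly {fraction {poly F}}} -> K}.
Hypothesis c2 : 2%:R != 0 :> F.
Hypothesis q_weq : q (weq E) = 0.
Hypothesis q_inj : forall p : {poly {fraction {poly F}}}, (size p <= 2)%N -> q p = 0 -> p = 0.
Hypothesis q_surj : forall z, exists2 p : {poly {fraction {poly F}}}, (size p <= 2)%N & z = q p.

Definition qk := hyperelliptic_of c2 q_weq q_inj q_surj.
Local Notation px := (px qk).
Local Notation el := (el qk).
Local Notation yhat := (yhat E).
Local Notation cst := (fun c : F => q (tofrac c%:P)%:P).

Definition qgerm (g : {poly {poly F}}) : K :=
  (map_poly (map_poly cst) g).[(q 'X)%:P].[q (tofrac 'X)%:P].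

Lemma cst_zmod : zmod_morphism cst.
Proof.
move=> a b.
exact: (eq_trans (congr1 (qpx q) (polyCB a b)) (rmorphB (qpx q) _ _)).
Qed.
Lemma cst_mon : monoid_morphism cst.
Proof.
split=> [|a b]; first exact: (eq_trans (congr1 (qpx q) (polyC1 _)) (rmorph1 (qpx q))).
exact: (eq_trans (congr1 (qpx q) (polyCM a b)) (rmorphM (qpx q) _ _)).
Qed.

Lemma qgerm_cst (c : {poly F}) : (map_poly cst c).[q (tofrac 'X)%:P] = qpx q c.
Proof.
pose f : {rmorphism F -> K} := HB.pack cst
  (GRing.isZmodMorphism.Build _ _ cst cst_zmod) (GRing.isMonoidMorphism.Build _ _ cst cst_mon).
exact: (horner_map_at_X (f := f) (p := qpx q)).
Qed.

(** By induction on the degree in Y of the bivariate polynomial, replacing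
    Y^2 by psi at each step. *)
Lemma qgerm_el g a b : on_curve E (Aff a b) ->
  exists A B, qgerm g = el A B /\ eval2 g a b = ev A B a (yhat a b).
Proof.
move=> onab; have onY := on_curveE onab.
pose f : {rmorphism F -> K} := HB.pack cst
  (GRing.isZmodMorphism.Build _ _ cst cst_zmod) (GRing.isMonoidMorphism.Build _ _ cst cst_mon).
have -> : qgerm g = (map_poly (map_poly f) g).[(q 'X)%:P].[q (tofrac 'X)%:P] by [].
elim/poly_ind: g => [|g c [A [B [e1 e2]]]].
  exists 0, 0; rewrite rmorph0 !horner0 /el !rmorph0 mul0r addr0; split=> //.
  by rewrite /eval2 /ev !horner0 mul0r addr0.
have c4 : 4%:R != 0 :> F.
  by rewrite (_ : 4%:R = 2%:R * 2%:R :> F) ?mulf_neq0 //; ring.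
pose h := (2%:R^-1)%:P : {poly F}.
exists (h * (B * psiE E - A * weq_lin E) + c), (h * (A - B * weq_lin E)); split.
  rewrite horner2_MXaddC e1.
  rewrite -[(map_poly f c)]/(map_poly cst c) qgerm_cst /el /=.
  have y2 := yy_sqr qk; rewrite /= in y2.
  have m1 (u v w x y z : {poly F}) : qpx q (u * (v * w - x * y) + z)
     = qpx q u * (qpx q v * qpx q w - qpx q x * qpx q y) + qpx q z.
    by rewrite (rmorphD (qpx q)) (rmorphM (qpx q)) (rmorphB (qpx q)) !(rmorphM (qpx q)).
  have m2 (u x v y : {poly F}) : qpx q (u * (x - v * y)) = qpx q u * (qpx q x - qpx q v * qpx q y).
    by rewrite (rmorphM (qpx q)) (rmorphB (qpx q)) (rmorphM (qpx q)).
  rewrite m1 m2 -y2.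
  have K2 : 2%:R != 0 :> K.
    by rewrite -(rmorph_nat (qpx q)) qpx_eq0 // -polyC_natr polyC_eq0.
  have -> : qpx q h = 2%:R^-1.
    have h1 : 2%:R * h = 1 by rewrite /h -polyC_natr -polyCM mulfV.
    apply: (mulfI K2); rewrite mulfV // -{1}(rmorph_nat (qpx q)) -(rmorphM (qpx q)) h1.
    exact: (rmorph1 (qpx q)).
  have key (u v w l x : K) : (u + v * (2%:R * x + l)) * x + w
     = 2%:R^-1 * (v * (2%:R * x + l) ^+ 2 - u * l) + w + 2%:R^-1 * (u - v * l) * (2%:R * x + l).
    by field.
  exact: key.
have eL : (weq_lin E).[a] = wa1 E * a + wa3 E.
  by rewrite /weq_lin hornerD hornerZ hornerX hornerC.
have -> : eval2 (g * 'X + c%:P) a b = eval2 g a b * b + c.[a].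
  by rewrite /eval2 hornerD hornerMX hornerC hornerD hornerM hornerC.
rewrite e2 /h; move: (psiE E) (weq_lin E) onY eL => psi L onY eL.
rewrite /ev !(hornerD, hornerM, hornerN, hornerC) eL -onY /yhat.
by field.
Qed.

Lemma qgerm_val g h a b z : on_curve E (Aff a b) -> eval2 h a b != 0 ->
  z = qgerm g / qgerm h -> val_at qk a (yhat a b) z (eval2 g a b / eval2 h a b).
Proof.
move=> onab h0 ->; have onY := on_curveE onab.
have [A [B [-> eg]]] := qgerm_el g onab; have [C [G [-> eh]]] := qgerm_el h onab.
by rewrite eg eh; apply: val_div; rewrite -?eh //; rewrite ?eh; apply: val_el.
Qed.

Lemma qgerm_XsubC a : qgerm ('X - a%:P)%:P / qgerm 1 = px ('X - a%:P).
Proof.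
pose f : {rmorphism F -> K} := HB.pack cst
  (GRing.isZmodMorphism.Build _ _ cst cst_zmod) (GRing.isMonoidMorphism.Build _ _ cst cst_mon).
have e1 : qgerm ('X - a%:P)%:P = px ('X - a%:P).
  exact: (eq_trans (horner2_C f _ _ _) (qgerm_cst _)).
have e2 : qgerm 1 = 1 := horner2_1 f _ _.
by rewrite e1 e2 divr1.
Qed.

End Germs.

(** * The cycle of doublings of a Lame curve *)

Lemma pole3_unit (K : fieldType) (t f w : K) : t != 0 -> f = t ^ (- 3%:Z) * w ->
  w = t * (t ^+ 2 * f).
Proof.
move=> t0 ->; have -> : t ^ (- 3%:Z) = (t ^+ 3)^-1 by [].
by field.
Qed.

Lemma pole3_0 (K : fieldType) (t f w : K) : t = 0 -> f = t ^ (- 3%:Z) * w -> f = 0.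
Proof. by move=> -> ->; rewrite exp0rz mul0r. Qed.

Section TangentLine.
Variables (F : closedFieldType) (E : weierstrass F).
Hypothesis c2 : 2%:R != 0 :> F.
Local Notation yhat := (yhat E).

Lemma deriv_dpsi_horner x : (dpsi (psiE E))^`().[x] = 12%:R * x + wb2 E.
Proof.
rewrite /dpsi /psiE !(derivZ, derivD, derivXn, derivX, derivC, derivMn, deriv0) /=.
rewrite !(hornerD, hornerZ, hornerMn, hornerXn, horner0, hornerC, hornerX).
by field.
Qed.

(** The first two equations say that the line of slope lam through Q is the
    tangent at Q and passes through -P.  The abscissa of P is then a root of
    (x - x_Q)^2 (x - x_3), for x_3 the abscissa of 2Q, which gives x_3 = x_P
    if x_P <> x_Q.  Otherwise the third equation says that Q is a flex. *)
Lemma tangent_double xP yP xQ yQ lam :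
  on_curve E (Aff xP yP) -> on_curve E (Aff xQ yQ) -> yhat xQ yQ != 0 ->
  yhat xQ yQ + yhat xP yP = 2%:R * lam * (xQ - xP) ->
  dpsiE E xQ = 2%:R * lam * yhat xQ yQ ->
  (xQ = xP -> (12%:R * xQ + wb2 E) * yhat xQ yQ = 2%:R * lam * dpsiE E xQ) ->
  addp E (Aff xQ yQ) (Aff xQ yQ) = Aff xP yP /\ lam = slope E (Aff xQ yQ).
Proof.
move=> onP onQ YQ0 e1 e2 e3.
have elam : lam = slope E (Aff xQ yQ) by rewrite /= e2; field; rewrite YQ0 c2.
split=> //.
have c4 : 4%:R != 0 :> F.
  by rewrite (_ : 4%:R = 2%:R * 2%:R :> F) ?mulf_neq0 //; ring.
have nd : ~~ ((xQ == xQ) && (yQ + yQ + wa1 E * xQ + wa3 E == 0)).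
  by rewrite eqxx /=; apply: contra YQ0 => /eqP e; apply/eqP; rewrite -[RHS]e /yhat; ring.
have [l [nu [x3 [y3 [-> h1 _ h3 [epsi sl]]]]]] := addp_collinear c2 onQ onQ nd.
have {sl}el : l = lam by rewrite elam; apply: sl.
rewrite {l}el in h1 h3 epsi.
have ev x : (psiE E).[x] = 4%:R * ((x - xQ) * (x - xQ) * (x - x3) + (lam * x + nu) ^+ 2).
  rewrite epsi hornerZ hornerD horner_exp 2!hornerM !hornerXsubC.
  by rewrite hornerD hornerZ hornerX hornerC.
have eYP : yhat xP yP = - (2%:R * (lam * xP + nu)).
  have -> : yhat xP yP = 2%:R * lam * (xQ - xP) - yhat xQ yQ by rewrite -e1; ring.
  by rewrite h1; ring.
have ex3 : x3 = xP.
  have [ex|ne] := eqVneq xQ xP.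
    (* the second difference at 1, 0, -1 isolates the coefficient of x^2 *)
    have b2E : 2%:R * wb2 E = 2%:R * (4%:R * lam ^+ 2 - 4%:R * (xQ + xQ + x3)).
      have : (psiE E).[1] + (psiE E).[-1] - 2%:R * (psiE E).[0] = 2%:R * wb2 E.
        by rewrite !psiE_horner; ring.
      by move=> <-; rewrite !ev; ring.
    have := e3 ex; rewrite e2 mulrA => /(mulIf YQ0) e4.
    rewrite -ex; apply: (mulfI c4).
    have eb : 12%:R * xQ = 2%:R * lam * (2%:R * lam) - wb2 E by rewrite -e4; ring.
    transitivity (12%:R * xQ - 8%:R * xQ); last by ring.
    by rewrite eb (mulfI c2 b2E); ring.
  have h : (xP - xQ) * (xP - xQ) * (xP - x3) = 0.
    apply: (mulfI c4); rewrite mulr0.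
    have -> : 4%:R * ((xP - xQ) * (xP - xQ) * (xP - x3))
       = (psiE E).[xP] - 4%:R * (lam * xP + nu) ^+ 2 by rewrite ev; ring.
    by rewrite -(on_curveE onP) eYP; ring.
  have ne' : xP - xQ != 0 by rewrite subr_eq0 eq_sym.
  by move/eqP: h; rewrite !mulf_eq0 (negPf ne') /= subr_eq0 => /eqP.
rewrite ex3 in h3 *; congr Aff.
have : yhat xP y3 = yhat xP yP by rewrite h3 eYP.
by rewrite /yhat => /addIr /addIr /(mulfI c2).
Qed.
End TangentLine.

(** u, p stand for u_Q and u_P.  Adding m times the first relation to the
    second eliminates p; then 2m times the third minus 2^j - 1 times the
    result is the constant 2m S. *)
Lemma constant_term_zero (F : closedFieldType) (E : weierstrass F) (K : fieldType)
  (k : hyperelliptic_field (psiE E) K) (u p : K) (lam S : F) (m j : nat) :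
  (forall n, n.+1%:R != 0 :> F) -> elliptic E -> (0 < m)%N ->
  dlog k (u + u - p + px k lam%:P) -> dlog k (m%:R * (p - px k lam%:P)) ->
  dlog k ((2 ^ j)%:R * u - u + px k S%:P) -> S = 0.
Proof.
move=> char0 ell m0 h1 h2 h3.
have h4 := dlog_add char0 (dlog_natmul char0 m h1) h2.
have h5 := dlog_sub char0 (dlog_natmul char0 (2 * m) h3) (dlog_natmul char0 (2 ^ j).-1 h4).
have : dlog k (px k ((2 * m)%:R * S)%:P).
  move: h5; congr (dlog _ _); rewrite -pxC_nat natrM.
  have -> : (2 ^ j)%:R = (2 ^ j).-1%:R + 1 :> K by rewrite natr1 prednK // expn_gt0.
  by ring.
move=> /(dlog_cst0 char0 ell) /eqP; rewrite mulf_eq0.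
by rewrite -(prednK m0) mulnS (negPf (char0 _)) /= => /eqP.
Qed.

Section LameCycle.
Variables (F : closedFieldType) (E : weierstrass F).
Hypothesis char0 : forall n, n.+1%:R != 0 :> F.
Let c2 : 2%:R != 0 :> F := char0 1.
Let k := qk c2 (qE_weq E) (@qE_inj F E) (@qE_surj F E).
Local Notation yhat := (yhat E).

Lemma local_ring_val a b f : on_curve E (Aff a b) -> local_ring (Aff a b) f ->
  regular k a (yhat a b) f.
Proof.
move=> on [g [h [h0 e]]]; eexists; exact: (qgerm_val c2 _ _ _ on h0 e).
Qed.

Lemma local_unit_val a b f : on_curve E (Aff a b) -> local_unit (Aff a b) f ->
  exists2 v, v != 0 & val_at k a (yhat a b) f v.
Proof.
move=> on [g [h [g0 h0 e]]]; exists (eval2 g a b / eval2 h a b).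
  by rewrite mulf_neq0 // invr_eq0.
exact: (qgerm_val c2 _ _ _ on h0 e).
Qed.

Lemma max_ideal_val a b f : on_curve E (Aff a b) -> max_ideal (Aff a b) f ->
  val_at k a (yhat a b) f 0.
Proof.
move=> on [g [h [g0 h0 e]]].
have := qgerm_val c2 (qE_weq E) (@qE_inj F E) (@qE_surj F E) on h0 e.
by move: g0; rewrite /value_at => ->; rewrite mul0r.
Qed.

Lemma max_ideal_X a b : max_ideal (Aff a b) (px k ('X - a%:P)).
Proof.
exists ('X - a%:P)%:P, 1; rewrite /value_at /eval2 !hornerC hornerXsubC subrr oner_eq0.
split=> //; apply: esym; exact: (qgerm_XsubC c2).
Qed.


Lemma hyper_point a b : b ^+ 2 = (psiE E).[a] ->
  exists2 y, on_curve E (Aff a y) & yhat a y = b.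
Proof.
move=> on; pose y := (b - wa1 E * a - wa3 E) / 2%:R.
have ey : yhat a y = b by rewrite /yhat /y; field; exact: c2.
by exists y => //; apply: on_curveI => //; rewrite ey.
Qed.

Lemma yhat_inj a y y' : yhat a y = yhat a y' -> y = y'.
Proof. by rewrite /yhat => /addIr /addIr /(mulfI c2). Qed.

(** Y = 0 means y = - y - a1 x - a3: the point is its own opposite. *)
Lemma two_torsion x y : on_curve E (Aff x y) -> yhat x y = 0 ->
  mulp E 2 (Aff x y) = Inf.
Proof.
move=> on y0; rewrite /mulp /= eqxx /=.
have -> : y + y + wa1 E * x + wa3 E = 0 by rewrite -[RHS]y0 /yhat; ring.
by rewrite eqxx.
Qed.

Lemma order_unit R f : order_at (E := E) R f 0 -> local_unit R f.
Proof. by move=> [t [w [_ hw ->]]]; rewrite expr0z mul1r. Qed.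

(** The order of P is odd, hence Y_P <> 0.  At Q the function f cannot have a
    pole, because Q is neither P nor at infinity; so the first alternative of
    [cover_index] holds. *)
Lemma lame_equations P n Q : lame_with E P n Q -> odd n -> exists xP yP xQ yQ m lam,
  [/\ [/\ P = Aff xP yP, Q = Aff xQ yQ, on_curve E P, on_curve E Q & (0 < m)%N],
   dlog k (m%:R * (uhat k (xP, yhat xP yP) - px k lam%:P)),
   yhat xQ yQ + yhat xP yP = 2%:R * lam * (xQ - xP),
   dpsiE E xQ = 2%:R * lam * yhat xQ yQ &
   (xQ = xP -> (12%:R * xQ + wb2 E) * yhat xQ yQ = 2%:R * lam * dpsiE E xQ)].
Proof.
move=> [ell [onP n1 _ [_ _ exP]] [onQ QInf QP] [f [[fP fInf fR] [cInf cP cQ] _ _]]] oddn.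
have n2 : (2 < n)%N by case: (n) n1 oddn => [|[|[|]]].
case: P onP fP fR QP cP exP => [|xP yP] onP fP fR QP cP exP.
  by case: (exP 1%N); rewrite ?n1.
case: Q onQ QInf QP cQ => [|xQ yQ] // onQ _ QP cQ.
have YP0 : yhat xP yP != 0.
  by apply/eqP => y0; apply: (exP 2%N); rewrite ?n2 //; apply: two_torsion.
have f_unit a b : b ^+ 2 = (psiE E).[a] -> (a, b) != (xP, yhat xP yP) ->
    exists2 v, v != 0 & val_at k a b f v.
  move=> onab ne; have [y on ey] := hyper_point onab.
  rewrite -ey; apply: local_unit_val => //; apply: order_unit; apply: fR => //.
  by move=> [ea eb]; move: ne; rewrite -ey ea eb eqxx.
have hQ := on_curveE onQ; have hP := on_curveE onP.
have nePQ : (xQ, yhat xQ yQ) != (xP, yhat xP yP).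
  by apply/eqP => -[ex ey]; apply: QP; move: ey; rewrite ex => /yhat_inj ->.
have f_P : exists t s w v, [/\ val_at k xP (yhat xP yP) t 0, regular k xP (yhat xP yP) s,
    px k ('X - xP%:P) = t * s, v != 0 & val_at k xP (yhat xP yP) w v /\ f = t ^+ n * w].
  have [t [w [[mt ut] uw ef]]] := fP.
  have [s ls es] := ut _ (max_ideal_X xP yP).
  have [v v0 hw] := local_unit_val onP uw.
  exists t, s, w, v; split=> //; first exact: max_ideal_val.
  exact: local_ring_val.
have f_Q : exists c t w, [/\ val_at k xQ (yhat xQ yQ) t 0, regular k xQ (yhat xQ yQ) w &
    f - px k c%:P = t ^+ 3 * w].
  case: cQ => _ [[c [t [w [[mt _] uw ef]]]]|[t [w [[mt _] uw ef]]]].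
    have [v _ hw] := local_unit_val onQ uw.
    exists c, t, w; split=> //; first exact: max_ideal_val.
    by exists v.
  have [v v0 hw] := local_unit_val onQ uw.
  have [u u0 hf] := f_unit _ _ hQ nePQ.
  have ht := max_ideal_val onQ mt.
  have [t0|t0] := eqVneq t 0.
    by have := val_neq0 hQ hf u0; rewrite (pole3_0 t0 ef) eqxx.
  have ew : w = t * (t ^+ 2 * f).
    exact: (pole3_unit t0 ef).
  have : val_at k xQ (yhat xQ yQ) w 0.
    rewrite ew; apply: val0_mul => //; eexists.
    by apply: val_mul => //; [apply: val_exp ht|exact: hf].
  by move=> /(val_unique hQ hw) v00; rewrite v00 eqxx in v0.
have [m [lam [m0 [f0 df] e1 e2 e3]]] :=
  ramification_equations char0 (size_psiE E c2) hP hQ YP0 (ltnW n1) nePQ f_unit f_P f_Q.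
exists xP, yP, xQ, yQ, m, lam; split=> //.
- by exists f.
- by rewrite -(dpsi_horner E char0).
move=> ex; rewrite -(dpsi_horner E char0) -(e3 ex); congr (_ * _).
by rewrite deriv_dpsi_horner.
Qed.

(** The equations at Q of [lame_equations] give 2Q = P and lambda = slope Q;
    [constant_term_zero] combines the relations of [addp_dlog],
    [slope_sum_dlog] and f. *)
Theorem lame_cycle P n Q : lame_with E P n Q -> odd n -> exact_order E Q n ->
  [/\ forall i, on_curve E (iter i (dbl E) Q), addp E Q Q = P,
      forall i, iter i (dbl E) Q <> Inf &
      exists2 j, (0 < j)%N & iter j (dbl E) Q = Q /\ slope_sum E Q j = 0].
Proof.
move=> hl oddn [_ nQ _]; have [ell _ [_ QInf _] _] := hl.
have [xP [yP [xQ [yQ [m [lam [[eP eQ onP onQ m0] hP e1 e2 e3]]]]]]] := lame_equations hl oddn.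
have aff i : iter i (dbl E) Q <> Inf := dbl_affine char0 ell k onQ nQ oddn QInf (i := i).
have [j j0 ej] := dbl_periodic char0 ell k onQ nQ oddn QInf.
have hQ := on_curveE (E := E) (x := xQ) (y := yQ); rewrite -eQ in hQ; have {}hQ := hQ onQ.
have YQ0 : yhat xQ yQ != 0.
  apply/eqP => y0; apply: (aff 1%N) => /=; rewrite eQ; apply: two_torsion => //.
  by rewrite -eQ.
have onP' := onP; have onQ' := onQ; rewrite eP in onP'; rewrite eQ in onQ'.
have [QP2 elam] := tangent_double c2 onP' onQ' YQ0 e1 e2 e3.
rewrite -eQ -eP in QP2 elam.
split=> //; first by move=> i; case: (dbl_dlog char0 k i onQ).
exists j => //; split=> //.
have h0 := slope_sum_dlog char0 ell k onQ nQ oddn QInf j.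
rewrite ej in h0.
have [on2 [c [hc ec]]] := addp_dlog char0 k onQ onQ.
have ec' := ec erefl QInf (aff 1%N); rewrite {}ec' QP2 -elam in hc.
rewrite eP in hc.
exact: (constant_term_zero char0 ell m0 hc hP h0).
Qed.

End LameCycle.

(** * Primes above 2 as valuation rings *)

Record valuation_ring (L : fieldType) (A m : L -> Prop) : Prop := ValuationRing {
  vr1 : A 1;
  vr_sub : forall x y, A x -> A y -> A (x - y);
  vr_mul : forall x y, A x -> A y -> A (x * y);
  vr_max : forall x, m x -> A x;
  vm_sub : forall x y, m x -> m y -> m (x - y);
  vm_mul : forall x y, A x -> m y -> m (x * y);
  vm1 : ~ m 1;
  vr_total : forall x, A x \/ m x^-1 }.

(** The maximal ideal of the localization [integral_at] at pp. *)
Definition max_at (L : fieldType) (pp : L -> Prop) (x : L) : Prop :=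
  exists a b, [/\ pp a, is_integer b, ~ pp b & x = a / b].

Section Integers.
Variable L : fieldType.
Local Notation isint := (@is_integer L).

Lemma isint_sub x y : isint x -> isint y -> isint (x - y).
Proof. exact: integral_sub. Qed.
Lemma isint_add x y : isint x -> isint y -> isint (x + y).
Proof. exact: integral_add. Qed.
Lemma isint_mul x y : isint x -> isint y -> isint (x * y).
Proof. exact: integral_mul. Qed.
Lemma isint_int (z : int) : isint z%:~R.
Proof. exact: integral_id. Qed.
Lemma isint_nat n : isint n%:R.
Proof. exact: integral_nat. Qed.
Lemma isint1 : isint 1. Proof. exact: (isint_nat 1). Qed.
Lemma isint0 : isint 0. Proof. exact: (isint_nat 0). Qed.
Lemma isint_exp x n : isint x -> isint (x ^+ n).
Proof.
move=> hx; elim: n => [|n IH]; first by rewrite expr0; apply: isint1.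
by rewrite exprS; apply: isint_mul.
Qed.

Lemma isint_lead (p : {poly L}) x : (forall i, isint p`_i) -> root p x ->
  isint (lead_coef p * x).
Proof.
move=> hp rx; have [->|p0] := eqVneq p 0; first by rewrite lead_coef0 mul0r; apply: isint0.
set c := lead_coef p; have c0 : c != 0 by rewrite lead_coef_eq0.
have s1 : (1 < size p)%N by apply: root_size_gt1 rx.
pose d := (size p).-2; have sp : size p = d.+2 by rewrite /d; case: (size p) s1 => [|[]].
pose E i := if i == d.+1 then 1 else p`_i * c ^+ (d - i).
have sq : size (\poly_(i < d.+2) E i) = d.+2.
  by rewrite size_poly_eq // /E eqxx oner_eq0.
apply: (@integral_root_monic _ _ _ _ (\poly_(i < d.+2) E i)).
- by rewrite monicE lead_coefE sq coef_poly ltnSn /E eqxx.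
- rewrite /root horner_poly; apply/eqP.
  transitivity (c ^+ d * p.[x]); last by rewrite (rootP rx) mulr0.
  rewrite horner_coef sp mulr_sumr; apply: eq_bigr => i _.
  rewrite /E; case: eqP => [->|/eqP ne].
    by rewrite mul1r exprMn -[p`_d.+1]/(p`_(d.+2.-1)) -sp -lead_coefE -/c exprS; ring.
  have le : (i <= d)%N by have := ltn_ord i; rewrite ltnS leq_eqVlt (negPf ne).
  have -> : c ^+ d = c ^+ (d - i) * c ^+ i by rewrite -exprD subnK.
  by rewrite exprMn; ring.
- apply/(integral_poly (intr : int -> L)) => i; rewrite coef_poly; case: ifP => _; last exact: isint0.
  rewrite /E; case: ifP => _; first exact: isint1.
  by apply: isint_mul; [apply: hp|apply: isint_exp; apply: hp].
Qed.

Section Prime.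
Variable pp : L -> Prop.
Hypothesis hpp : prime_over 2 pp.

Let pint x : pp x -> isint x. Proof. by case: hpp => -[h _ _ _] _; apply: h. Qed.
Let p0 : pp 0. Proof. by case: hpp => -[_ [h _ _] _ _] _. Qed.
Let padd x y : pp x -> pp y -> pp (x + y).
Proof. by case: hpp => -[_ [_ h _] _ _] _; apply: h. Qed.
Let pmul x y : isint x -> pp y -> pp (x * y).
Proof. by case: hpp => -[_ [_ _ h] _ _] _; apply: h. Qed.
Let p1 : ~ pp 1. Proof. by case: hpp => -[_ _ h _] _. Qed.
Let pprime x y : isint x -> isint y -> pp (x * y) -> pp x \/ pp y.
Proof. by case: hpp => -[_ _ _ h] _; apply: h. Qed.
Let p2 : pp 2%:R. Proof. by case: hpp. Qed.

Lemma prime_sub x y : pp x -> pp y -> pp (x - y).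
Proof.
move=> hx xY; apply: padd => //; rewrite -mulN1r; apply: pmul => //.
by rewrite -sub0r; apply: isint_sub; [apply: isint0|apply: isint1].
Qed.

Lemma prime_odd (c : int) : ~~ (2 %| c)%Z -> ~ pp c%:~R.
Proof.
move=> odc hc; apply: p1.
have ec : c = (c %/ 2)%Z * 2 + 1.
  rewrite {1}(divz_eq c 2); congr (_ + _).
  have := modz_ge0 c (isT : (2 != 0 :> int)); have := ltz_pmod c (isT : (0 < 2 :> int)).
  have : (c %% 2)%Z != 0 by apply: contra odc => /eqP /dvdz_mod0P.
  by move: (c %% 2)%Z => r; lia.
have -> : 1 = c%:~R - (c %/ 2)%Z%:~R * 2%:R :> L.
  by rewrite {1}ec intrD intrM; ring.
by apply: prime_sub => //; apply: pmul => //; apply: isint_int.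
Qed.

(** Let c be the leading coefficient.  Both c and c x are integers.  If c is
    not in pp, then x = c x / c; if c x is not in pp, then x^-1 = c / (c x).
    If both are in pp, the two leading terms c x^(d+1) + p_d x^d are merged
    into (c x + p_d) x^d, which lowers the degree and leaves the coefficients
    unchanged modulo pp. *)
Lemma root_dichotomy n (p : {poly L}) x : (size p <= n)%N -> (forall i, isint p`_i) ->
  root p x -> (exists i, ~ pp p`_i) -> integral_at pp x \/ max_at pp x^-1.
Proof.
elim: n p => [|n IH] p.
  by rewrite leqn0 size_poly_eq0 => /eqP -> _ _ [i]; rewrite coef0.
move=> sp hp rx [i hi]; have [p00|pn0] := eqVneq p 0.
  by move: hi; rewrite p00 coef0.
set c := lead_coef p; have hcx := isint_lead hp rx; rewrite -/c in hcx.
have hc : isint c by apply: hp.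
have c0 : c != 0 by rewrite lead_coef_eq0.
have s1 : (1 < size p)%N by apply: root_size_gt1 rx.
pose d := (size p).-2; have esp : size p = d.+2 by rewrite /d; case: (size p) s1 => [|[]].
have [pc|npc] := pselect (pp c); last by left; exists (c * x), c; split=> //; field.
have [pcx|npcx] := pselect (pp (c * x)); last first.
  by right; exists c, (c * x); split=> //; rewrite invfM mulrA mulfV // mul1r.
pose q := p - c *: 'X^(d.+1) + (c * x) *: 'X^d.
have qE j : q`_j = p`_j - c * (j == d.+1)%:R + c * x * (j == d)%:R.
  by rewrite coefD coefB !coefZ !coefXn.
apply: (IH q).
- apply/leq_sizeP => j lej; rewrite qE.
  have [->|nj] := eqVneq j d.+1.
    rewrite -[p`_d.+1]/(p`_(d.+2.-1)) -esp -lead_coefE -/c mulr1 subrr add0r.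
    by rewrite gtn_eqF // mulr0.
  have lt : (d.+1 < j)%N by rewrite ltn_neqAle eq_sym nj; move: sp; rewrite esp; lia.
  rewrite nth_default ?esp // (gtn_eqF (ltnW lt)) mulr0 mulr0; ring.
- move=> j; rewrite qE; apply: isint_add.
    by apply: isint_sub => //; apply: isint_mul => //; apply: isint_nat.
  by apply: isint_mul => //; apply: isint_nat.
- rewrite /root /q !hornerD hornerN !hornerZ !hornerXn (rootP rx) exprS; apply/eqP; ring.
exists i; rewrite qE => hq; apply: hi.
have -> : p`_i = (p`_i - c * (i == d.+1)%:R + c * x * (i == d)%:R)
   - ((i == d)%:R * (c * x) - (i == d.+1)%:R * c) by ring.
by apply: prime_sub => //; apply: prime_sub; apply: pmul => //; apply: isint_nat.
Qed.

Hypothesis alg : forall x : L, exists p : {poly int},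
  (exists i, ~~ (2 %| p`_i)%Z) /\ root (map_poly intr p) x.

(** Every element is a root of a primitive integer polynomial, so that
    [root_dichotomy] applies. *)
Lemma valuation_at : valuation_ring (integral_at pp) (max_at pp).
Proof.
have ne0 b : ~ pp b -> b != 0.
  by move=> hb; apply/eqP => b0; apply: hb; rewrite b0.
have nmul b d : isint b -> isint d -> ~ pp b -> ~ pp d -> ~ pp (b * d).
  by move=> hb hd nb nd /pprime[].
split.
- by exists 1, 1; split; rewrite ?divr1 //; apply: isint1.
- move=> x y [a [b [ha hb nb ->]]] [c [d [hc hd nd ->]]].
  exists (a * d - c * b), (b * d); split; try by auto using isint_mul, isint_sub.
  by field; rewrite !ne0.
- move=> x y [a [b [ha hb nb ->]]] [c [d [hc hd nd ->]]].
  exists (a * c), (b * d); split; try by auto using isint_mul, isint_sub.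
  by field; rewrite !ne0.
- by move=> x [a [b [ha hb nb ->]]]; exists a, b; split=> //; apply: pint.
- move=> x y [a [b [ha hb nb ->]]] [c [d [hc hd nd ->]]].
  exists (d * a - b * c), (b * d); split; try by auto using isint_mul, isint_sub, prime_sub, pmul.
  by field; rewrite !ne0.
- move=> x y [a [b [ha hb nb ->]]] [c [d [hc hd nd ->]]].
  exists (a * c), (b * d); split; try by auto using isint_mul, pmul.
  by field; rewrite !ne0.
- move=> [a [b [ha hb nb e]]]; apply: nb.
  have b0 : b != 0 by apply/eqP => b0; move: e; rewrite b0 invr0 mulr0 => /eqP; rewrite oner_eq0.
  by rewrite -[b]mul1r e divfK.
move=> x; have [p [[i hi] rx]] := alg x.
apply: (root_dichotomy (leqnn _) _ rx).
  by move=> j; rewrite coef_map; apply: isint_int.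
by exists i; rewrite coef_map; apply: prime_odd.
Qed.

Lemma max_at2 : max_at pp 2%:R.
Proof. by exists 2%:R, 1; split; rewrite ?divr1 //; apply: isint1. Qed.

End Prime.
End Integers.

Lemma int_relation (L : fieldType) (j : {rmorphism L -> algC}) (x : L) :
  exists p : {poly int}, (exists i, ~~ (2 %| p`_i)%Z) /\ root (map_poly intr p) x.
Proof.
have [p [ep mp _]] := minCpolyP (j x); have [q [a a0 eq]] := rat_poly_scale p.
have p0 := monic_neq0 mp.
have q0 : q != 0 by apply: contraNneq p0 => q0; rewrite eq q0 rmorph0 scaler0.
exists (zprimitive q); split.
  apply: contrapT => h; have : zprimitive q \is a polyOver (dvdz 2).
    apply/polyOverP => i; apply: contrapT => hi; apply: h; exists i; exact/negP.
  by rewrite -dvdz_contents zcontents_primitive q0.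
rewrite -(fmorph_root j) -map_poly_comp.
have e (r : {poly int}) : map_poly (j \o intr) r = map_poly intr r :> {poly algC}.
  by apply: eq_map_poly => z /=; rewrite rmorph_int.
rewrite e; have := root_minCpoly (j x); rewrite ep eq.
rewrite map_polyZ rootZ ?fmorph_eq0 ?invr_eq0 ?intr_eq0 // -map_poly_comp.
have -> : map_poly (ratr \o intr) q = map_poly intr q :> {poly algC}.
  by apply: eq_map_poly => z /=; rewrite ratr_int.
rewrite {1}(zpolyEprim q) map_polyZ rootZ // intr_eq0 zcontents_eq0 //.
Qed.

(** * Doubling cycles over a valuation ring *)

(** The cycle of doublings on y^2 + a x y + b y = x^3, with tangent slopes l.
    The coefficient b is there for the rescaling [cyc_scale].  The last
    equation is the identity between the slopes, since 2 l + a is twice the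
    slope of Y / 2. *)
Record doubling_cycle (L : fieldType) (a b : L) (k : nat) (x y l : nat -> L) : Prop := DoublingCycle {
  cy_k : (0 < k)%N;
  cy_curve : forall i, y i ^+ 2 + a * x i * y i + b * y i = x i ^+ 3;
  cy_ne : forall i, 2%:R * y i + a * x i + b != 0;
  cy_l : forall i, l i * (2%:R * y i + a * x i + b) = 3%:R * x i ^+ 2 - a * y i;
  cy_x : forall i, x i.+1 = l i ^+ 2 + a * l i - 2%:R * x i;
  cy_y : forall i, y i.+1 = - (l i + a) * x i.+1 - (y i - l i * x i) - b;
  cy_per : forall i, x (i + k)%N = x i /\ y (i + k)%N = y i;
  cy_sum : \sum_(i < k) 2%:R ^+ (k.-1 - i) * (2%:R * l i + a) = 0 }.

Section CycAlgebra.
Variables (L : fieldType) (a b : L) (k : nat) (x y l : nat -> L).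
Hypothesis C : doubling_cycle a b k x y l.

Lemma cyc_dup i : x i.+1 * (4%:R * x i ^+ 3 + a ^+ 2 * x i ^+ 2 + 2%:R * a * b * x i + b ^+ 2)
  = x i ^+ 4 - a * b * x i ^+ 2 - 2%:R * b ^+ 2 * x i.
Proof.
have Y0 := cy_ne C i; set Y := 2%:R * y i + a * x i + b in Y0.
have Y2 : 4%:R * x i ^+ 3 + a ^+ 2 * x i ^+ 2 + 2%:R * a * b * x i + b ^+ 2 = Y ^+ 2.
  by rewrite -(cy_curve C i) /Y; ring.
have e : x i.+1 * Y ^+ 2 = (l i * Y) ^+ 2 + a * (l i * Y) * Y - 2%:R * x i * Y ^+ 2.
  by rewrite (cy_x C); ring.
have {}e : x i.+1 * Y ^+ 2 = (3%:R * x i ^+ 2 - a * y i) ^+ 2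
    + a * (3%:R * x i ^+ 2 - a * y i) * Y - 2%:R * x i * Y ^+ 2.
  by rewrite e (cy_l C i).
have ey : y i ^+ 2 = x i ^+ 3 - a * x i * y i - b * y i by rewrite -(cy_curve C i); ring.
have eY2 : Y ^+ 2 = 4%:R * y i ^+ 2 + 4%:R * y i * (a * x i + b) + (a * x i + b) ^+ 2.
  by rewrite /Y; ring.
rewrite Y2 e eY2 /Y.
transitivity (9%:R * x i ^+ 4 - 6%:R * a * y i * x i ^+ 2 + a ^+ 2 * y i ^+ 2
  + 3%:R * a * x i ^+ 2 * (2%:R * y i + a * x i + b)
  - a ^+ 2 * (2%:R * y i ^+ 2 + y i * (a * x i + b))
  - 2%:R * x i * (4%:R * y i ^+ 2 + 4%:R * y i * (a * x i + b) + (a * x i + b) ^+ 2)).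
  by ring.
by rewrite ey; ring.
Qed.

Lemma cyc_per_mul n i : x (i + n * k)%N = x i /\ y (i + n * k)%N = y i.
Proof.
elim: n => [|n [ex ey]]; first by rewrite mul0n addn0.
by rewrite mulSn (addnC k) addnA; have [-> ->] := cy_per C (i + n * k).
Qed.

Lemma cyc_mod i : x (i %% k)%N = x i /\ y (i %% k)%N = y i.
Proof.
rewrite {2 4}(divn_eq i k) addnC.
by have [-> ->] := cyc_per_mul (i %/ k) (i %% k).
Qed.

Lemma cyc_scale u : u != 0 ->
  doubling_cycle (a / u) (b / u ^+ 3) k (fun i => x i / u ^+ 2) (fun i => y i / u ^+ 3) (fun i => l i / u).
Proof.
move=> u0; split=> [|i|i|i|i|i|i|]; first exact: cy_k C.
- transitivity ((y i ^+ 2 + a * x i * y i + b * y i) / u ^+ 6); first by field.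
  by rewrite (cy_curve C i); field.
- have -> : 2%:R * (y i / u ^+ 3) + a / u * (x i / u ^+ 2) + b / u ^+ 3
      = (2%:R * y i + a * x i + b) / u ^+ 3 by field.
  by rewrite mulf_neq0 ?(cy_ne C) // invr_eq0 expf_neq0.
- transitivity ((l i * (2%:R * y i + a * x i + b)) / u ^+ 4); first by field.
  by rewrite (cy_l C i); field.
- by rewrite (cy_x C i); field.
- by rewrite (cy_y C i); field.
- by have [-> ->] := cy_per C i.
transitivity ((\sum_(i < k) 2%:R ^+ (k.-1 - i) * (2%:R * l i + a)) / u).
  rewrite mulr_suml; apply: eq_bigr => i _; move: (2%:R ^+ _) => c; by field.
by rewrite (cy_sum C) mul0r.
Qed.

(** In the sum, the term of index k - 1 has weight 1 and its part 2 l is even;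
    all other weights are even. *)
Lemma cyc_a_even (S : L -> Prop) : S 1 -> (forall u v, S u -> S v -> S (u - v)) ->
  (forall u v, S u -> S v -> S (u * v)) -> S a -> (forall i, S (l i)) ->
  exists2 s, S s & a = 2%:R * s.
Proof.
move=> S1 Ssub Smul gen_a gen_l.
have gen0 : S 0 by rewrite -(subrr 1); apply: (Ssub).
have gen_opp u : S u -> S (- u) by move=> hu; rewrite -sub0r; apply: (Ssub).
have gen_add u v : S u -> S v -> S (u + v).
  by move=> hu hv; rewrite -[v]opprK; apply: (Ssub) => //; apply: (gen_opp).
have gen_nat n : S n%:R by elim: n => [|n IH] //; rewrite -natr1; apply: (gen_add).
have gen_exp u n : S u -> S (u ^+ n).
  by move=> hu; elim: n => [|n IH]; rewrite ?expr0 // exprS; apply: (Smul).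
have := cy_sum C; have ek : k = k.-1.+1 by rewrite prednK // (cy_k C).
rewrite ek big_ord_recr /= subnn expr0 mul1r.
have [t St ->] : exists2 t, S t &
    \sum_(i < k.-1) 2%:R ^+ (k.-1 - i) * (2%:R * l i + a) = 2%:R * t.
  exists (\sum_(i < k.-1) 2%:R ^+ (k.-1 - i).-1 * (2%:R * l i + a)).
    elim/big_ind: _ => //; move=> i _; apply: (Smul); first exact: gen_exp (gen_nat 2).
    by apply: (gen_add) => //; apply: (Smul) => //.
  rewrite mulr_sumr; apply: eq_bigr => i _; rewrite mulrA -exprS prednK // subn_gt0.
  exact: ltn_ord.
move=> e; exists (- (t + l k.-1)); first by apply: (gen_opp); apply: (gen_add).
apply/eqP; rewrite -subr_eq0; apply/eqP; rewrite -[RHS]e; ring.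
Qed.

End CycAlgebra.

Section Valuation.
Variables (L : fieldType) (A m : L -> Prop).
Hypothesis V : valuation_ring A m.
Hypothesis m2 : m 2%:R.

Let Asub := vr_sub V. Let Amul := vr_mul V. Let A1 := vr1 V.
Let msub := vm_sub V. Let mmul := vm_mul V. Let mA := vr_max V.

Lemma vr0 : A 0. Proof. by rewrite -(subrr 1); apply: (Asub). Qed.
Lemma vr_opp u : A u -> A (- u).
Proof. by move=> hu; rewrite -sub0r; apply: (Asub) => //; apply: vr0. Qed.
Lemma vr_add u v : A u -> A v -> A (u + v).
Proof. by move=> hu hv; rewrite -[v]opprK; apply: (Asub) => //; apply: vr_opp. Qed.
Lemma vr_nat n : A n%:R.
Proof. by elim: n => [|n IH]; [apply: vr0|rewrite -natr1; apply: vr_add]. Qed.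
Lemma vr_exp u n : A u -> A (u ^+ n).
Proof. by move=> hu; elim: n => [|n IH]; rewrite ?expr0 // exprS; apply: (Amul). Qed.
Lemma vm0 : m 0. Proof. by rewrite -(subrr 2%:R); apply: (msub). Qed.
Lemma vm_opp u : m u -> m (- u).
Proof. by move=> hu; rewrite -sub0r; apply: (msub) => //; apply: vm0. Qed.
Lemma vm_add u v : m u -> m v -> m (u + v).
Proof. by move=> hu hv; rewrite -[v]opprK; apply: (msub) => //; apply: vm_opp. Qed.
Lemma vm_mulr u v : m u -> A v -> m (u * v).
Proof. by move=> hu hv; rewrite mulrC; apply: (mmul). Qed.
Lemma vm_exp u n : (0 < n)%N -> m u -> m (u ^+ n).
Proof.
by case: n => // n _ hu; rewrite exprS; apply: vm_mulr => //; apply: vr_exp; apply: (mA).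
Qed.
Lemma vm_even n : m (n%:R * 2%:R). Proof. by apply: (mmul) => //; apply: vr_nat. Qed.

Lemma unit_neq0 u : ~ m u -> u != 0.
Proof. by move=> hu; apply/eqP => u0; apply: hu; rewrite u0; apply: vm0. Qed.

Lemma vr_inv u : ~ m u -> A u^-1.
Proof. by move=> hu; case: (vr_total V u^-1) => //; rewrite invrK. Qed.

Lemma vm_1add u : m u -> ~ m (1 + u).
Proof.
by move=> hu h; apply: (vm1 V); rewrite -(addrK u 1); apply: (msub).
Qed.

Lemma vm_odd n : ~ m (n.*2.+1)%:R.
Proof.
rewrite -addn1 natrD addrC; apply: vm_1add => //.
by rewrite -muln2 natrM; apply: vm_even.
Qed.

Lemma vr_quadratic z u v : A u -> A v -> z ^+ 2 + u * z + v = 0 -> A z.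
Proof.
move=> hu hv e; have [->|z0] := eqVneq z 0; first exact: vr0.
case: (vr_total V z) => // hz; exfalso; apply: (vm1 V).
have -> : 1 = - (u * z^-1 + v * (z^-1 * z^-1)).
  have e' : z ^+ 2 = - (u * z + v) by apply/eqP; rewrite -addr_eq0 addrA e.
  apply: (mulIf (expf_neq0 2 z0)); rewrite mul1r {1}e'; by field.
by apply: vm_opp; apply: vm_add; apply: (mmul) => //; apply: (mmul) => //; apply: (mA).
Qed.

Section Cycle.
Variables (a b : L) (k : nat) (x y l : nat -> L).
Hypothesis C : doubling_cycle a b k x y l.
Hypothesis Aa : A a.
Hypothesis Ab : A b.

(** Divided by x_i^4, [cyc_dup] reads x_(i+1) g = x_i v, where v is a unit and
    g = 4 + a^2 / x_i + .. is in m. *)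
Lemma pole_grows i : x i != 0 -> m (x i)^-1 ->
  [/\ x i.+1 != 0, m (x i.+1)^-1 & m (x i / x i.+1)].
Proof.
move=> x0 mu; have := cyc_dup C i; set u := (x i)^-1 in mu *.
have ex : x i = u^-1 by rewrite invrK.
have u0 : u != 0 by rewrite invr_eq0.
have Au := mA mu.
pose g := 4%:R + a ^+ 2 * u + 2%:R * a * b * u ^+ 2 + b ^+ 2 * u ^+ 3.
pose w := a * b * u ^+ 2 + 2%:R * b ^+ 2 * u ^+ 3.
have mg : m g.
  have m4 : m 4%:R by rewrite (_ : 4%:R = 2%:R * 2%:R); [exact: vm_mulr m2 (vr_nat 2)|ring].
  have A2 := vr_nat 2; apply: vm_add; [apply: vm_add; [apply: vm_add|]|] => //.
  - by apply: (mmul) => //; apply: vr_exp.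
  - by apply: (mmul); [apply: (Amul); [apply: (Amul)|]|apply: vm_exp].
  - by apply: (mmul); [apply: vr_exp|apply: vm_exp].
have mw : m (- w).
  apply: vm_opp; apply: vm_add.
    by apply: (mmul); [apply: (Amul)|apply: vm_exp].
  by apply: (mmul); [apply: (Amul); [apply: vr_nat|apply: vr_exp]|apply: vm_exp].
have w0 := unit_neq0 (@vm_1add _ mw); have Aw := vr_inv (@vm_1add _ mw).
move=> e; have {}e : x i.+1 * (u * g) = 1 - w.
  apply: (mulIf (expf_neq0 4 (x0))); transitivity (x i.+1 * (4%:R * x i ^+ 3
     + a ^+ 2 * x i ^+ 2 + 2%:R * a * b * x i + b ^+ 2)).
    by rewrite ex /g; field.
  by rewrite e ex /w; field.
have x1 : x i.+1 != 0.
  by apply: contraNneq w0 => x1; rewrite -e x1 mul0r.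
have einv : (x i.+1)^-1 = u * g * (1 - w)^-1.
  apply: (mulfI x1); rewrite mulfV // mulrA e mulfV //.
split=> //.
  by rewrite einv -mulrA; apply: (mmul) => //; apply: vm_mulr.
by rewrite ex einv !mulrA mulVf // mul1r; apply: vm_mulr.
Qed.

(** By [pole_grows], x_i / x_(i+k) would be in m, whereas it is 1. *)
Lemma cyc_x_int i : A (x i).
Proof.
have [->|x0] := eqVneq (x i) 0; first exact: vr0.
case: (vr_total V (x i)) => // mi; exfalso; apply: (vm1 V).
have h j : [/\ x (i + j.+1)%N != 0, m (x (i + j.+1)%N)^-1 & m (x i / x (i + j.+1)%N)].
  elim: j => [|j [n1 h1 h2]]; first by rewrite addn1; apply: pole_grows.
  rewrite addnS; have [n3 h3 h4] := pole_grows n1 h1; split=> //.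
  have -> : x i / x (i + j.+1).+1 = x i / x (i + j.+1)%N * (x (i + j.+1)%N / x (i + j.+1).+1).
    by field; rewrite n1 n3.
  by apply: (mmul) => //; apply: (mA).
have := h k.-1; rewrite prednK ?(cy_k C) //; have [-> _] := cy_per C i.
by rewrite mulfV // => -[].
Qed.

Lemma cyc_y_int i : A (y i).
Proof.
apply: (@vr_quadratic _ (a * x i + b) (- x i ^+ 3)).
- by apply: vr_add => //; apply: (Amul) => //; apply: cyc_x_int.
- by apply: vr_opp; apply: vr_exp; apply: cyc_x_int.
by rewrite -(cy_curve C i); ring.
Qed.

Lemma cyc_l_int i : A (l i).
Proof.
apply: (@vr_quadratic _ a (- (x i.+1 + 2%:R * x i))) => //; last by rewrite (cy_x C); ring.
by apply: vr_opp; apply: vr_add; [|apply: (Amul); first exact: vr_nat]; apply: cyc_x_int.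
Qed.

(** The slopes being integral, [cyc_a_even] applies to A.  The name comes from
    the reduction: a is its Hasse invariant. *)
Lemma cyc_supersingular : m a.
Proof.
have [s As ->] := cyc_a_even C A1 Asub Amul Aa cyc_l_int.
by apply: vm_mulr.
Qed.
End Cycle.

Section DeuringCycle.
Variables (a : L) (k : nat) (x y l : nat -> L).
Hypothesis C : doubling_cycle a 1 k x y l.

(** A non-integral a can be rescaled to 1, with b = a^-3 still integral;
    then 1 would be in m. *)
Lemma cyc_a_max : m a.
Proof.
have [->|a0] := eqVneq a 0; first exact: vm0.
case: (vr_total V a) => [Aa|mi]; first exact: (cyc_supersingular C).
exfalso; apply: (vm1 V).
have C1 := cyc_scale C a0; rewrite mulfV // mul1r in C1.
apply: (cyc_supersingular C1) => //.
by rewrite -exprVn; apply: vr_exp; apply: (mA).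
Qed.

Lemma deuring_disc_unit : ~ m (a ^+ 3 - 27%:R).
Proof.
move=> h; apply: (@vm_odd 13); rewrite (_ : 13.*2.+1 = 27%N) //.
rewrite -[27%:R]opprK -[- 27%:R](addKr (a ^+ 3)) opprD opprK.
apply: (msub); last exact: h.
by apply: vm_exp => //; apply: cyc_a_max.
Qed.

Lemma cyc_unit i : ~ m (2%:R * y i + a * x i + 1).
Proof.
have ma := cyc_a_max; have Aa := mA ma.
rewrite addrC; apply: vm_1add => //; apply: vm_add; apply: vm_mulr => //.
  exact: (cyc_y_int C Aa A1).
exact: (cyc_x_int C Aa A1).
Qed.

End DeuringCycle.
End Valuation.

(** * The local ring generated by a doubling cycle *)

(** The smallest subring containing G in which the elements outside m are
    invertible; congruences are proved by induction on this predicate. *)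
Inductive local_gen (L : fieldType) (m G : L -> Prop) : L -> Prop :=
| lg_base z : G z -> local_gen m G z
| lg_one : local_gen m G 1
| lg_sub z w : local_gen m G z -> local_gen m G w -> local_gen m G (z - w)
| lg_mul z w : local_gen m G z -> local_gen m G w -> local_gen m G (z * w)
| lg_inv z : local_gen m G z -> ~ m z -> local_gen m G z^-1.

Lemma poly_decomp_int (q : {poly int}) : exists q1, q = q1 * 'X + (q`_0)%:P.
Proof.
elim/poly_ind: q => [|q c _]; first by exists 0; rewrite coef0 mul0r add0r.
by exists q; rewrite coefD coefMX coefC /= add0r.
Qed.

Section Unramified.
Variables (L : fieldType) (A m : L -> Prop).
Hypothesis V : valuation_ring A m.
Hypothesis m2 : m 2%:R.
Variables (a : L) (k : nat) (x y l : nat -> L).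
Hypothesis C : doubling_cycle a 1 k x y l.

Definition cyc_gen z := z = a \/ exists i, z = x i \/ z = y i.
Local Notation S := (local_gen m cyc_gen).

Let ma : m a := cyc_a_max V m2 C.
Let Aa : A a := vr_max V ma.
Let Ax i : A (x i) := cyc_x_int V m2 C Aa (vr1 V) i.
Let Ay i : A (y i) := cyc_y_int V m2 C Aa (vr1 V) i.

Lemma gen_integral z : S z -> A z.
Proof.
elim=> {z} [z|||z w _ Az _ Aw|z _ Az nz].
- by move=> [->|[i [] ->]].
- exact: vr1 V.
- by move=> z w _ Az _ Aw; apply: vr_sub V _ _ Az Aw.
- exact: vr_mul V _ _ Az Aw.
- exact: (vr_inv V nz).
Qed.

Lemma gen0 : S 0. Proof. by rewrite -(subrr 1); apply: lg_sub; apply: lg_one. Qed.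
Lemma gen_opp u : S u -> S (- u).
Proof. by move=> hu; rewrite -sub0r; apply: lg_sub => //; apply: gen0. Qed.
Lemma gen_add u v : S u -> S v -> S (u + v).
Proof. by move=> hu hv; rewrite -[v]opprK; apply: lg_sub => //; apply: gen_opp. Qed.
Lemma gen_nat n : S n%:R.
Proof. by elim: n => [|n IH]; [apply: gen0|rewrite -natr1; apply: gen_add => //; apply: lg_one]. Qed.
Lemma gen_exp u n : S u -> S (u ^+ n).
Proof.
by move=> hu; elim: n => [|n IH]; rewrite ?expr0 ?exprS; [apply: lg_one|apply: lg_mul].
Qed.
Lemma gen_x i : S (x i). Proof. by apply: lg_base; right; exists i; left. Qed.
Lemma gen_y i : S (y i). Proof. by apply: lg_base; right; exists i; right. Qed.
Lemma gen_a : S a. Proof. by apply: lg_base; left. Qed.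
Lemma gen_l i : S (l i).
Proof.
have -> : l i = (3%:R * x i ^+ 2 - a * y i) * (2%:R * y i + a * x i + 1)^-1.
  by rewrite -(cy_l C i) mulfK // (cy_ne C).
apply: lg_mul.
  by apply: lg_sub; apply: lg_mul; [apply: gen_nat|apply: gen_exp; apply: gen_x|apply: gen_a|apply: gen_y].
apply: lg_inv; last exact: (cyc_unit V m2 C).
apply: gen_add; last exact: lg_one.
by apply: gen_add; apply: lg_mul; [apply: gen_nat|apply: gen_y|apply: gen_a|apply: gen_x].
Qed.

Definition cong z w := exists2 s, S s & z - w = 2%:R * s.

Lemma cong_refl z : cong z z.
Proof. by exists 0; [apply: gen0|rewrite subrr mulr0]. Qed.
Lemma cong_sym z w : cong z w -> cong w z.
Proof. by move=> [s Ss e]; exists (- s); [apply: gen_opp|rewrite -opprB e mulrN]. Qed.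
Lemma cong_trans z w v : cong z w -> cong w v -> cong z v.
Proof.
move=> [s Ss e] [t St f]; exists (s + t); first exact: gen_add.
by rewrite mulrDr -e -f; ring.
Qed.
Lemma cong_add z w z' w' : cong z z' -> cong w w' -> cong (z + w) (z' + w').
Proof.
move=> [s Ss e] [t St f]; exists (s + t); first exact: gen_add.
by rewrite mulrDr -e -f; ring.
Qed.
Lemma cong_sub z w z' w' : cong z z' -> cong w w' -> cong (z - w) (z' - w').
Proof.
move=> [s Ss e] [t St f]; exists (s - t); first exact: lg_sub.
by rewrite mulrBr -e -f; ring.
Qed.
Lemma cong_mul z w z' w' : S w -> S z' -> cong z z' -> cong w w' -> cong (z * w) (z' * w').
Proof.
move=> Sw Sz [s Ss e] [t St f]; exists (s * w + z' * t); first by apply: gen_add; apply: lg_mul.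
have -> : z * w - z' * w' = (z - z') * w + z' * (w - w') by ring.
by rewrite e f; ring.
Qed.
Lemma cong_exp z z' n : S z -> S z' -> cong z z' -> cong (z ^+ n) (z' ^+ n).
Proof.
move=> Sz Sz' h; elim: n => [|n IH]; first by rewrite !expr0; apply: cong_refl.
by rewrite !exprS; apply: cong_mul => //; apply: gen_exp.
Qed.

Local Notation frob e z := (z ^+ (2 ^ e)).

Lemma frob_add e z w : S z -> S w -> cong (frob e (z + w)) (frob e z + frob e w).
Proof.
move=> Sz Sw; elim: e => [|e IH]; first by rewrite !expr1; apply: cong_refl.
rewrite expnSr !exprM; set u := z ^+ _; set v := w ^+ _; set t := (z + w) ^+ _.
have Su : S u by apply: gen_exp.
have Sv : S v by apply: gen_exp.
have St : S t by apply: gen_exp; apply: gen_add.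
apply: (cong_trans (w := (u + v) ^+ 2)).
  by apply: cong_exp => //; apply: gen_add.
by exists (u * v); [apply: lg_mul|ring].
Qed.

Lemma frob_sub e z w : S z -> S w -> cong (frob e (z - w)) (frob e z - frob e w).
Proof.
move=> Sz Sw; have h := frob_add e (lg_sub Sz Sw) Sw; rewrite subrK in h.
apply: cong_sym; have := cong_sub h (cong_refl (frob e w)).
by rewrite addrK.
Qed.

Lemma a_even : exists2 s, S s & a = 2%:R * s.
Proof.
apply: (cyc_a_even C); [exact: lg_one|exact: lg_sub|exact: lg_mul|exact: gen_a|exact: gen_l].
Qed.

(** The duplication formula modulo 2, as a is even. *)
Lemma frob_x_step i : cong (frob 2 (x i)) (x i.+1).
Proof.
have [s Ss ea] := a_even; have := cyc_dup C i.
rewrite expr1n !mulr1 ea => e.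
exists (x i.+1 * (2%:R * x i ^+ 3 + 2%:R * s ^+ 2 * x i ^+ 2 + 2%:R * s * x i)
  + s * x i ^+ 2 + x i); last first.
  rewrite -[(2 ^ 2)%N]/4%N.
  have -> : x i ^+ 4 = x i.+1 * (4%:R * x i ^+ 3 + (2%:R * s) ^+ 2 * x i ^+ 2
      + 2%:R * (2%:R * s) * x i + 1) + 2%:R * s * x i ^+ 2 + 2%:R * x i by rewrite e; ring.
  by ring.
have S2 := gen_nat 2.
by repeat (first [exact: gen_x|exact: Ss|exact: S2|apply: gen_exp|apply: lg_mul|apply: gen_add]).
Qed.

Lemma frob_x j i : cong (frob (2 * j) (x i)) (x (i + j)%N).
Proof.
elim: j => [|j IH]; first by rewrite muln0 expr1 addn0; apply: cong_refl.
rewrite mulnS addnC expnD exprM addnS.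
apply: cong_trans (frob_x_step _).
by apply: cong_exp => //; [apply: gen_exp|]; apply: gen_x.
Qed.

Lemma y_sqr i : cong (y i ^+ 2) (y i + x i ^+ 3).
Proof.
have [s Ss ea] := a_even; have := cy_curve C i; rewrite ea mul1r => e.
exists (- (y i + s * x i * y i)).
  apply: gen_opp; apply: gen_add; first exact: gen_y.
  by do !apply: lg_mul => //; [apply: gen_x|apply: gen_y].
by rewrite -e; ring.
Qed.

(** Each squaring adds x^3 to y, by the equation of the curve modulo 2.  The
    accumulated s is a sum of powers of x, hence fixed by the same power of
    Frobenius as x. *)
Lemma frob_y e i : exists2 s, S s & cong (frob e (y i)) (y i + s) /\
  cong (frob (2 * k) s) s.
Proof.
elim: e => [|e [s Ss [h1 h2]]].
  exists 0; first exact: gen0.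
  rewrite expr1 addr0; split; first exact: cong_refl.
  by rewrite expr0n expn_eq0 /=; apply: cong_refl.
have Sx3 : S (x i ^+ 3) by apply: gen_exp; apply: gen_x.
exists (x i ^+ 3 + s ^+ 2); first by apply: gen_add => //; apply: gen_exp.
split.
  rewrite expnSr exprM; apply: (cong_trans (w := (y i + s) ^+ 2)).
    apply: cong_exp => //; first by apply: gen_exp; apply: gen_y.
    by apply: gen_add => //; apply: gen_y.
  apply: (cong_trans (w := y i ^+ 2 + s ^+ 2)).
    by apply: (frob_add 1) => //; apply: gen_y.
  by rewrite addrA; apply: cong_add; [apply: y_sqr|apply: cong_refl].
apply: (cong_trans (frob_add _ Sx3 (gen_exp 2 Ss))); apply: cong_add.
  rewrite -exprM mulnC exprM; apply: cong_exp; [apply: gen_exp; apply: gen_x|apply: gen_x|].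
  by have := frob_x k i; have [-> _] := cy_per C i.
by rewrite -exprM mulnC exprM; apply: cong_exp => //; apply: gen_exp.
Qed.

(** The elements fixed by a power of Frobenius modulo 2 are closed under all
    the operations of [local_gen].  After 2k squarings y has moved by some s
    fixed by them, so after 4k it has moved by 2s. *)
Lemma frob_gen z : S z -> cong (frob (4 * k) z) z.
Proof.
have e4 : (4 * k = 2 * k + 2 * k)%N by rewrite -mulnDl.
elim=> {z} [z|||z w Sz IHz Sw IHw|z Sz IH nz].
- move=> [->|[i [] ->]].
  + have [s Ss ->] := a_even.
    exists (2%:R ^+ (2 ^ (4 * k)).-1 * s ^+ (2 ^ (4 * k)) - s).
      by apply: lg_sub => //; apply: lg_mul; apply: gen_exp => //; apply: gen_nat.
    rewrite exprMn -{1}(prednK (expn_gt0 2 (4 * k))) exprS; ring.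
  + have := frob_x (k + k) i; have := cyc_per_mul C 2 i; rewrite mul2n -addnn => -[-> _].
    by rewrite mulnDr -e4.
  + have [s Ss [h1 h2]] := frob_y (2 * k) i.
    rewrite e4 expnD exprM.
    apply: (cong_trans (w := frob (2 * k) (y i + s))).
      apply: cong_exp => //; first by apply: gen_exp; apply: gen_y.
      by apply: gen_add => //; apply: gen_y.
    apply: (cong_trans (frob_add _ (gen_y i) Ss)).
    apply: (cong_trans (cong_add h1 h2)).
    by exists s => //; ring.
- by rewrite expr1n; apply: cong_refl.
- move=> z w Sz IHz Sw IHw.
  by apply: (cong_trans (frob_sub _ Sz Sw)); apply: cong_sub.
- by rewrite exprMn; apply: cong_mul => //; apply: gen_exp.
have z0 := unit_neq0 V m2 nz.
have Si := lg_inv Sz nz; rewrite exprVn.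
case: IH => s Ss e; exists (- (s * (z^-1 ^+ (2 ^ (4 * k)) * z^-1))).
  by apply: gen_opp; apply: lg_mul => //; apply: lg_mul => //; apply: gen_exp.
rewrite exprVn; move: e; set q := z ^+ _ => e; have q0 : q != 0 by apply: expf_neq0.
have -> : q^-1 - z^-1 = - (q - z) * (q^-1 * z^-1) by field; rewrite q0 z0.
by rewrite e; ring.
Qed.

(** z^q = z + 2s and z in m: then z (1 - z^(q-1)) = - 2s, and the factor is a
    unit. *)
Lemma max_gen_even z : S z -> m z -> exists2 s, S s & z = 2%:R * s.
Proof.
move=> Sz mz; have [s Ss e] := frob_gen Sz.
set q := (2 ^ (4 * k))%N in e.
have q1 : (1 < q)%N by rewrite /q -{1}(expn0 2) ltn_exp2l // muln_gt0 (cy_k C).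
have eq : q = q.-2.+2 by case: (q) q1 => [|[]].
have nu : ~ m (1 + - z ^+ q.-1).
  by apply: (vm_1add V); apply: (vm_opp V m2); apply: (vm_exp V) mz; rewrite eq.
have Su : S (1 + - z ^+ q.-1) by apply: lg_sub; [apply: lg_one|apply: gen_exp].
exists (- s / (1 + - z ^+ q.-1)).
  by apply: lg_mul; [apply: gen_opp|apply: lg_inv].
apply: (mulIf (unit_neq0 V m2 nu)); rewrite mulrA divfK ?(unit_neq0 V m2 nu) //.
have ez : z ^+ q = z * z ^+ q.-1 by rewrite -exprS prednK // ltnW.
by rewrite mulrN -e ez; ring.
Qed.

Hypothesis alg : forall z : L, exists p : {poly int},
  (exists i, ~~ (2 %| p`_i)%Z) /\ root (map_poly intr p) z.
Hypothesis frac : forall z, exists g h, [/\ S g, S h, h != 0 & z = g / h].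

Hypothesis two_neq0 : 2%:R != 0 :> L.

Lemma vr_int (c : int) : A c%:~R.
Proof. by case: c => n; rewrite ?NegzE ?mulrNz; [|apply: (vr_opp V)]; exact: (vr_nat V). Qed.

Lemma dvd2_of_int n (c : int) s : A s -> c%:~R = 2%:R ^+ n * s -> (2 ^+ n %| c)%Z.
Proof.
move=> As; elim: n c => [|n IH] c ec; first by rewrite expr0 dvd1z.
have [/dvdzP[d ed]|odc] := boolP (2 %| c)%Z.
  rewrite ed exprSr dvdz_mul2r //; apply: IH; apply: (mulIf two_neq0).
  by rewrite -[2%:R]/(2%:~R) -intrM -ed ec exprSr; ring.
exfalso; have mc : m c%:~R.
  rewrite ec exprS -mulrA; apply: (vm_mulr V) => //.
  by apply: (vr_mul V) => //; apply: (vr_exp V); apply: (vr_nat V).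
have nz : (c %% 2)%Z != 0 by apply: contra odc => /eqP /dvdz_mod0P.
have ec1 : c = (c %/ 2)%Z * 2 + 1.
  rewrite {1}(divz_eq c 2); congr (_ + _).
  have := modz_ge0 c (isT : (2 != 0 :> int)); have := ltz_pmod c (isT : (0 < 2 :> int)).
  by move: nz; move: (c %% 2)%Z => r; lia.
apply: (vm1 V); have -> : 1 = c%:~R - (c %/ 2)%Z%:~R * 2%:R :> L.
  by rewrite {1}ec1 intrD intrM; ring.
by apply: (vm_sub V) => //; apply: (vm_mul V) => //; apply: vr_int.
Qed.

(** z divides in A the constant coefficient of an integer polynomial of which it
    is a root, and this can be chosen nonzero; a nonzero integer is divisible
    by finitely many powers of 2 only. *)
Lemma krull z : A z -> z != 0 -> exists n, forall w, A w -> z <> 2%:R ^+ n * w.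
Proof.
move=> Az z0; have [p [[i hi] rp]] := alg z.
have p0 : p != 0 by apply: contraNneq hi => ->; rewrite coef0 dvdz0.
have [r [q]] := multiplicity_XsubC p 0; rewrite p0 subr0 /= => q0 ep.
have rq : root (map_poly intr q) z.
  move: rp; rewrite ep rmorphM rmorphXn /= map_polyX rootM => /orP[//|].
  by rewrite /root hornerXn expf_eq0 (negPf z0) andbF.
have c0 : q`_0 != 0 by move: q0; rewrite /root -horner_coef0.
(* 2^c > c bounds the power of 2 dividing the constant coefficient c *)
exists (absz q`_0) => w Aw ez.
have [t At et] : exists2 t, A t & (q`_0)%:~R = z * t.
  have [q1 eq] := poly_decomp_int q.
  exists (- (map_poly intr q1).[z]).
    apply: (vr_opp V); elim/poly_ind: q1 {eq} => [|q1 c IH].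
      by rewrite rmorph0 horner0; apply: (vr0 V).
    rewrite rmorphD rmorphM /= map_polyX map_polyC hornerD hornerMX hornerC.
    by apply: (vr_add V); [apply: (vr_mul V)|apply: vr_int].
  move: rq; rewrite {1}eq rmorphD rmorphM /= map_polyX map_polyC /root hornerD hornerMX hornerC.
  by rewrite addrC addr_eq0 => /eqP ->; ring.
have : (2 ^+ (absz q`_0) %| q`_0)%Z.
  by apply: (@dvd2_of_int _ _ (w * t)); [apply: (vr_mul V)|rewrite et {1}ez; ring].
rewrite dvdzE abszX => /dvdn_leq; rewrite absz_gt0 c0 => /(_ isT).
by rewrite leqNgt ltn_expl.
Qed.

Lemma gen_factor z : S z -> z != 0 -> exists n u, [/\ S u, ~ m u & z = 2%:R ^+ n * u].
Proof.
move=> Sz z0; have [n hn] := krull (gen_integral Sz) z0.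
suff : forall d j w, S w -> z = 2%:R ^+ j * w -> (n - j < d)%N ->
    exists n u, [/\ S u, ~ m u & z = 2%:R ^+ n * u].
  by move=> /(_ n.+1 0%N z Sz); rewrite expr0 mul1r subn0; apply.
elim=> // d IH j w Sw ez lt; have [mw|] := pselect (m w); last by exists j, w.
have [s Ss es] := max_gen_even Sw mw.
apply: (IH j.+1 s Ss); first by rewrite ez es exprSr mulrA.
suff : (j < n)%N by lia.
rewrite ltnNge; apply/negP => le; apply: (hn (2%:R ^+ (j - n) * w)).
  by apply: (vr_mul V); [apply: (vr_exp V); apply: (vr_nat V)|apply: gen_integral].
by rewrite mulrA -exprD subnKC.
Qed.

(** Every element of the field is a quotient of elements of S, and each of
    these is a power of 2 times a unit by [gen_factor]: A is a discrete
    valuation ring with uniformizer 2. *)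
Lemma max_div2 z : m z -> A (z / 2%:R).
Proof.
move=> mz; have [->|z0] := eqVneq z 0; first by rewrite mul0r; apply: (vr0 V).
have [g [h [Sg Sh h0 ez]]] := frac z.
have g0 : g != 0 by apply: contraNneq z0 => g0; rewrite ez g0 mul0r.
have [i [u [Su nu eg]]] := gen_factor Sg g0; have [j [v [Sv nv eh]]] := gen_factor Sh h0.
have u0 := unit_neq0 V m2 nu; have v0 := unit_neq0 V m2 nv.
have t0 := two_neq0.
have [le|lt] := leqP i j.
  exfalso; apply: (vm1 V).
  have -> : 1 = (2%:R ^+ (j - i) * (v / u)) * z.
    rewrite ez eg eh -{2}(subnKC le) exprD; field.
    by rewrite u0 v0 !expf_neq0.
  apply: (vm_mul V) => //; apply: (vr_mul V); first by apply: (vr_exp V); apply: (vr_nat V).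
  by apply: (vr_mul V); [apply: gen_integral|apply: (vr_inv V) nu].
have -> : z / 2%:R = 2%:R ^+ (i - j).-1 * (u / v).
  have ei : i = (j + (i - j).-1.+1)%N by rewrite prednK ?subn_gt0 // subnKC // ltnW.
  rewrite ez eg eh {1}ei exprD exprS; field.
  by rewrite v0 t0 expf_neq0.
apply: (vr_mul V); first by apply: (vr_exp V); apply: (vr_nat V).
by apply: (vr_mul V); [apply: gen_integral|apply: (vr_inv V) nv].
Qed.

End Unramified.

(** * Changes of variables *)

(** The curve y^2 + a x y + y = x^3, on which the origin is a flex with a
    horizontal tangent, that is, a point of order 3. *)
Definition deuring (F : fieldType) (a : F) : weierstrass F := Weierstrass a 0 1 0 0.

Section Change.
Variables (F : fieldType) (u r s t : F) (E E' : weierstrass F).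
Hypothesis u0 : u != 0.
Hypothesis ch : weierstrass_change u r s t E E'.
Local Notation pc := (point_change u r s t).

Lemma change_a1 : wa1 E = u * wa1 E' - 2%:R * s.
Proof. by case: ch => -> _ _ _ _; ring. Qed.
Lemma change_a2 : wa2 E = u ^+ 2 * wa2 E' + s * (u * wa1 E' - 2%:R * s) - 3%:R * r + s ^+ 2.
Proof. by rewrite -change_a1; case: ch => _ -> _ _ _; ring. Qed.
Lemma change_a3 : wa3 E = u ^+ 3 * wa3 E' - r * (u * wa1 E' - 2%:R * s) - 2%:R * t.
Proof. by rewrite -change_a1; case: ch => _ _ -> _ _; ring. Qed.
Lemma change_a4 : wa4 E = u ^+ 4 * wa4 E'
  + s * (u ^+ 3 * wa3 E' - r * (u * wa1 E' - 2%:R * s) - 2%:R * t)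
  - 2%:R * r * (u ^+ 2 * wa2 E' + s * (u * wa1 E' - 2%:R * s) - 3%:R * r + s ^+ 2)
  + (t + r * s) * (u * wa1 E' - 2%:R * s) - 3%:R * r ^+ 2 + 2%:R * s * t.
Proof. by rewrite -change_a3 -change_a2 -change_a1; case: ch => _ _ _ -> _; ring. Qed.
Lemma change_a6 : wa6 E = u ^+ 6 * wa6 E' - r * wa4 E - r ^+ 2 * wa2 E - r ^+ 3
   + t * wa3 E + t ^+ 2 + r * t * wa1 E.
Proof. by case: ch => _ _ _ _ ->; ring. Qed.

Lemma change_yhat x y :
  yhat E (u ^+ 2 * x + r) (u ^+ 3 * y + s * u ^+ 2 * x + t) = u ^+ 3 * yhat E' x y.
Proof. by rewrite /yhat change_a3 change_a1; ring. Qed.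

Lemma change_dbl R : dbl E (pc R) = pc (dbl E' R).
Proof.
case: R => [|x y] //; rewrite /dbl /= !eqxx /=.
set c := (_ == 0); set c' := (_ == 0).
have eY (W : weierstrass F) v w : w + w + wa1 W * v + wa3 W = yhat W v w.
  by rewrite /yhat; ring.
have -> : c = c'.
  by rewrite /c /c' !eY change_yhat mulf_eq0 expf_eq0 (negPf u0).
rewrite /c'; case: ifP => // /negbT; rewrite eY => Y0.
set l := _ / _; set l' := _ / _.
have el : l = u * l' + s.
  have eY' (W : weierstrass F) v w : 2%:R * w + wa1 W * v + wa3 W = yhat W v w by [].
  rewrite /l /l' !eY' change_yhat.
  have uY : u ^+ 3 * yhat E' x y != 0 by rewrite mulf_neq0 ?expf_neq0.
  apply: (mulIf uY); rewrite divfK //.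
  transitivity (u ^+ 4 * ((3 * x ^+ 2 + 2 * wa2 E' * x + wa4 E' - wa1 E' * y))
    + s * u ^+ 3 * (2%:R * y + wa1 E' * x + wa3 E')).
    by rewrite change_a4 change_a2 change_a1; ring.
  by rewrite eY'; field.
have e3 : l ^+ 2 + wa1 E * l - wa2 E - (u ^+ 2 * x + r) - (u ^+ 2 * x + r)
   = u ^+ 2 * (l' ^+ 2 + wa1 E' * l' - wa2 E' - x - x) + r.
  by rewrite el change_a2 change_a1; ring.
rewrite e3; set x3 := _ - x; congr Aff.
by rewrite el change_a3 change_a1; ring.
Qed.

Lemma change_iter_dbl R i : iter i (dbl E) (pc R) = pc (iter i (dbl E') R).
Proof. by elim: i => //= i ->; rewrite change_dbl. Qed.

Lemma change_slope R : slope E (pc R) = u * slope E' R.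
Proof.
case: R => [|x y] /=; first by rewrite mulr0.
rewrite change_yhat.
have -> : dpsiE E (u ^+ 2 * x + r) = u ^+ 4 * dpsiE E' x.
  by rewrite /dpsiE /wb2 /wb4 change_a4 change_a3 change_a2 change_a1; ring.
have -> : 2%:R * (u ^+ 3 * yhat E' x y) = u ^+ 3 * (2%:R * yhat E' x y) by ring.
by rewrite invfM; move: (2%:R * yhat E' x y)^-1 => w; field.
Qed.

Lemma change_surj R : exists R', R = pc R'.
Proof.
case: R => [|x y]; first by exists Inf.
exists (Aff ((x - r) / u ^+ 2) ((y - s * (x - r) - t) / u ^+ 3)) => /=.
by congr Aff; field.
Qed.

Lemma change_on_curveV R : on_curve E (pc R) -> on_curve E' R.
Proof.
case: R => [|x y] //=; rewrite change_a6 change_a4 change_a3 change_a2 change_a1 => e.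
apply: (mulfI (expf_neq0 6 u0)); apply/eqP; rewrite -subr_eq0; apply/eqP.
move/eqP: e; rewrite -subr_eq0 => /eqP e; by rewrite -[RHS]e; ring.
Qed.

Lemma change_disc : wdisc E = u ^+ 12 * wdisc E'.
Proof.
by rewrite /wdisc /wb2 /wb4 /wb6 /wb8 change_a6 change_a4 change_a3 change_a2 change_a1; ring.
Qed.

Lemma change_c4 : wc4 E = u ^+ 4 * wc4 E'.
Proof.
have e2 : wb2 E = u ^+ 2 * wb2 E' - 12%:R * r.
  by rewrite /wb2 change_a2 change_a1; ring.
have e4 : wb4 E = u ^+ 4 * wb4 E' - r * u ^+ 2 * wb2 E' + 6%:R * r ^+ 2.
  by rewrite /wb4 /wb2 change_a4 change_a3 change_a1; ring.
by rewrite /wc4 e2 e4; ring.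
Qed.

End Change.

(** * Isomorphic pairs and the normal form with a flex at the origin *)

Section PairIso.
Variable F : fieldType.
Implicit Types (E : weierstrass F) (P : point F).


Lemma point_change_comp u r s t u' r' s' t' P :
  point_change u r s t (point_change u' r' s' t' P) =
  point_change (u * u') (u ^+ 2 * r' + r) (u * s' + s)
    (u ^+ 3 * t' + s * u ^+ 2 * r' + t) P.
Proof. by case: P => //= x y; congr Aff; ring. Qed.

Lemma change_comp u r s t u' r' s' t' E E' E'' :
  weierstrass_change u r s t E E' -> weierstrass_change u' r' s' t' E' E'' ->
  weierstrass_change (u * u') (u ^+ 2 * r' + r) (u * s' + s)
    (u ^+ 3 * t' + s * u ^+ 2 * r' + t) E E''.
Proof.
move=> ch ch'.
by split; rewrite ?(change_a6 ch) ?(change_a4 ch) ?(change_a3 ch) ?(change_a2 ch)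
  ?(change_a1 ch) ?(change_a6 ch') ?(change_a4 ch') ?(change_a3 ch') ?(change_a2 ch')
  ?(change_a1 ch'); ring.
Qed.

Lemma change_inv u r s t E E' : u != 0 -> weierstrass_change u r s t E E' ->
  weierstrass_change u^-1 (- r / u ^+ 2) (- s / u) ((r * s - t) / u ^+ 3) E' E.
Proof.
move=> u0 ch.
by split; rewrite ?(change_a6 ch) ?(change_a4 ch) ?(change_a3 ch) ?(change_a2 ch)
  ?(change_a1 ch); field.
Qed.

Lemma point_change_inv u r s t P : u != 0 ->
  point_change u^-1 (- r / u ^+ 2) (- s / u) ((r * s - t) / u ^+ 3)
    (point_change u r s t P) = P.
Proof. by move=> u0; case: P => //= x y; congr Aff; field. Qed.

Lemma pair_iso_sym E P E' P' : pair_iso E P E' P' -> pair_iso E' P' E P.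
Proof.
move=> [u [r [s [t [u0 ch ->]]]]].
exists u^-1, (- r / u ^+ 2), (- s / u), ((r * s - t) / u ^+ 3); split.
- by rewrite invr_eq0.
- exact: change_inv.
- by rewrite point_change_inv.
Qed.

Lemma pair_iso_trans E P E' P' E'' P'' :
  pair_iso E P E' P' -> pair_iso E' P' E'' P'' -> pair_iso E P E'' P''.
Proof.
move=> [u [r [s [t [u0 ch ->]]]]] [u' [r' [s' [t' [u'0 ch' ->]]]]].
rewrite point_change_comp; do 4 eexists; split; [|exact: change_comp ch ch'|reflexivity].
by rewrite mulf_neq0.
Qed.

Definition opp_point E P := if P is Aff x y then Aff x (- y - wa1 E * x - wa3 E) else Inf.

Lemma pair_iso_neg E P : pair_iso E P E (opp_point E P).
Proof.
exists (-1), 0, (- wa1 E), (- wa3 E); split; first by rewrite oppr_eq0 oner_eq0.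
  by split; ring.
by case: P => //= x y; congr Aff; ring.
Qed.

(** c4 is scaled by u^4 and the discriminant by u^12. *)
Lemma jinv_iso E P E' P' : elliptic E -> pair_iso E P E' P' ->
  elliptic E' /\ jinv E = jinv E'.
Proof.
rewrite /elliptic /jinv => ell [u [r [s [t [u0 ch _]]]]].
have eD := change_disc ch; have eC := change_c4 ch.
have D0 : wdisc E' != 0 by apply: contraNneq ell => e; rewrite eD e mulr0.
by split=> //; rewrite eD eC; field; rewrite D0 u0.
Qed.

End PairIso.

Section Deuring.
Variables (F : closedFieldType) (E : weierstrass F).
Hypothesis c2 : 2%:R != 0 :> F.
Hypothesis c3 : 3%:R != 0 :> F.
Hypothesis ell : elliptic E.

(** The roots of 3 x^4 + b2 x^3 + 3 b4 x^2 + 3 b6 x + b8 are the abscissas of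
    the points of order 3.  One such point is moved to the origin and its
    tangent to the line y = 0; the tangent is not vertical because E is
    smooth.  A cube root then normalizes a3 to 1. *)
Lemma deuring_form : exists u r s t a, u != 0 /\ weierstrass_change u r s t E (deuring a).
Proof.
pose p3 : {poly F} := 3%:R *: 'X^4 + wb2 E *: 'X^3 + (3%:R * wb4 E) *: 'X^2
   + (3%:R * wb6 E) *: 'X + (wb8 E)%:P.
have [|r] := closed_rootP p3 _.
  rewrite /p3 -!addrA size_polyDl ?size_scale ?size_polyXn //.
  apply: leq_ltn_trans (size_polyD _ _) _; rewrite gtn_max.
  rewrite (leq_ltn_trans (size_scale_leq _ _)) ?size_polyXn //=.
  apply: leq_ltn_trans (size_polyD _ _) _; rewrite gtn_max.
  rewrite (leq_ltn_trans (size_scale_leq _ _)) ?size_polyXn //=.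
  apply: leq_ltn_trans (size_polyD _ _) _; rewrite gtn_max.
  rewrite (leq_ltn_trans (size_scale_leq _ _)) ?size_polyX //=.
  by rewrite (leq_ltn_trans (size_polyC_leq1 _)).
rewrite /root /p3 !hornerD !hornerZ !hornerXn hornerX hornerC => /eqP e3.
pose q : {poly F} := 'X^2 + (wa1 E * r + wa3 E) *: 'X
   - (r ^+ 3 + wa2 E * r ^+ 2 + wa4 E * r + wa6 E)%:P.
have [|t] := closed_rootP q _.
  rewrite /q -!addrA size_polyDl ?size_polyXn //.
  apply: leq_ltn_trans (size_polyD _ _) _; rewrite gtn_max size_polyN.
  rewrite (leq_ltn_trans (size_scale_leq _ _)) ?size_polyX //=.
  by rewrite (leq_ltn_trans (size_polyC_leq1 _)).
rewrite /root /q !hornerD hornerN !hornerZ !hornerXn hornerX hornerC subr_eq0 => /eqP et.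
have a6E : wa6 E = t ^+ 2 + (wa1 E * r + wa3 E) * t - (r ^+ 3 + wa2 E * r ^+ 2 + wa4 E * r).
  by rewrite et; ring.
pose Y := wa3 E + r * wa1 E + 2%:R * t.
pose N := wa4 E + 2%:R * r * wa2 E - t * wa1 E + 3%:R * r ^+ 2.
have flex : (wa2 E + 3%:R * r) * Y ^+ 2 - wa1 E * N * Y - N ^+ 2 = 0.
  by rewrite -[RHS]e3 /Y /N /wb2 /wb4 /wb6 /wb8 a6E; ring.
have on : on_curve E (Aff r t) by rewrite /= a6E; ring.
have Y0 : Y != 0.
  apply/eqP => Y0.
  have eY : yhat E r t = 0 by rewrite -[RHS]Y0 /yhat /Y; ring.
  have psi0 : (psiE E).[r] = 0 by rewrite -(on_curveE on) eY expr0n.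
  have /eqP := psiE_sep c2 ell psi0; apply.
  move: flex; rewrite Y0 expr0n /= !mulr0 !sub0r oppr0 add0r => /eqP.
  rewrite oppr_eq0 sqrf_eq0 => /eqP N0.
  have -> : dpsiE E r = 2%:R * N + wa1 E * Y by rewrite /dpsiE /wb2 /wb4 /N /Y; ring.
  by rewrite N0 Y0; ring.
have [|u] := closed_rootP ('X^3 - Y%:P) _; first by rewrite size_XnsubC.
rewrite /root hornerD hornerXn hornerN hornerC subr_eq0 => /eqP uY.
have u0 : u != 0 by apply: contraNneq Y0 => u0; rewrite -uY u0 expr0n.
pose s := N / Y.
exists u, r, s, t, ((wa1 E + 2%:R * s) / u); split=> //.
split=> /=.
- by rewrite mulrC divfK.
- rewrite mulr0; apply/esym; apply: (mulIf (expf_neq0 2 Y0)); rewrite mul0r -[RHS]flex /s.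
  by field.
- by rewrite mulr1 uY /Y; ring.
- rewrite mulr0; have -> : 0 = N - s * Y by rewrite /s divfK // subrr.
  by rewrite /N /Y; ring.
- by rewrite mulr0 a6E; ring.
Qed.

End Deuring.

Section CycOfDbl.
Variables (F : fieldType) (a : F) (Q : point F) (j : nat).
Local Notation E := (deuring a).
Hypothesis onQ : forall i, on_curve E (iter i (dbl E) Q).
Hypothesis aff : forall i, iter i (dbl E) Q <> Inf.
Hypothesis j0 : (0 < j)%N.
Hypothesis per : iter j (dbl E) Q = Q.
Hypothesis c2 : 2%:R != 0 :> F.
Hypothesis sum0 : \sum_(i < j) 2%:R ^+ (j.-1 - i) * slope E (iter i (dbl E) Q) = 0.

Definition xcoord (R : point F) := if R is Aff x _ then x else 0.
Definition ycoord (R : point F) := if R is Aff _ y then y else 0.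

Lemma cyc_of_dbl :
  let x i := xcoord (iter i (dbl E) Q) in let y i := ycoord (iter i (dbl E) Q) in
  doubling_cycle a 1 j x y (fun i => (3%:R * x i ^+ 2 - a * y i) / (2%:R * y i + a * x i + 1)).
Proof.
move=> x y; have eQ i : iter i (dbl E) Q = Aff (x i) (y i).
  by rewrite /x /y; case: (iter i _ Q) (@aff i).
have Y0 i : 2%:R * y i + a * x i + 1 != 0.
  apply/eqP => e0; apply: (@aff i.+1) => /=; rewrite eQ /dbl /addp eqxx /=.
  by rewrite -e0 (_ : _ == _) //; apply/eqP; ring.
have step i : Aff (x i.+1) (y i.+1) = addp E (Aff (x i) (y i)) (Aff (x i) (y i)).
  by rewrite -!eQ.
have ne i : (y i + y i + a * x i + 1 == 0) = false.
  by apply/negbTE; apply: contraNneq (Y0 i) => <-; apply/eqP; ring.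
split=> //.
- by move=> i; have := onQ i; rewrite eQ /= => ->; ring.
- by move=> i; rewrite divfK.
- by move=> i; have := step i; rewrite /addp /= eqxx ne /= => -[-> _]; field.
- by move=> i; have := step i; rewrite /addp /= eqxx ne /= => -[-> ->]; field.
- by move=> i; have : iter (i + j) (dbl E) Q = iter i (dbl E) Q;
    [rewrite iterD per|rewrite !eQ => -[-> ->]].
transitivity (2%:R * \sum_(i < j) 2%:R ^+ (j.-1 - i) * slope E (iter i (dbl E) Q)).
  rewrite mulr_sumr; apply: eq_bigr => i _; rewrite eQ /slope /dpsiE /yhat /wb2 /wb4 /=.
  by move: (2%:R ^+ _) => c; field; rewrite c2 Y0.
by rewrite sum0 mulr0.
Qed.

End CycOfDbl.

(** * Good reduction above 2 *)

Section CycTransfer.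
Variables (L M : fieldType) (iota : {rmorphism L -> M}).

(** All conditions are polynomial equations and inequations, which an embedding
    of fields reflects. *)
Lemma cyc_pull a b k x y l : doubling_cycle (iota a) (iota b) k (iota \o x) (iota \o y) (iota \o l) ->
  doubling_cycle a b k x y l.
Proof.
case=> k0 h1 h2 h3 h4 h5 h6 h7; split=> //.
- by move=> i; apply: (fmorph_inj iota); rewrite !(rmorphD, rmorphM, rmorphXn) /=; apply: h1.
- by move=> i; rewrite -(fmorph_eq0 iota) !rmorphD !rmorphM rmorph_nat; apply: h2.
- move=> i; apply: (fmorph_inj iota).
  by rewrite rmorphM !rmorphD rmorphN !rmorphM !rmorph_nat ?rmorphXn; apply: h3.
- move=> i; apply: (fmorph_inj iota).
  by rewrite !rmorphD rmorphN !rmorphM !rmorph_nat ?rmorphXn; apply: h4.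
- move=> i; apply: (fmorph_inj iota).
  by rewrite !(rmorphD, rmorphN, rmorphM); apply: h5.
- by move=> i; have [e1 e2] := h6 i; split; apply: (fmorph_inj iota).
apply: (fmorph_inj iota); rewrite rmorph0 -[RHS]h7 rmorph_sum; apply: eq_bigr => i _.
by rewrite rmorphM rmorphXn rmorph_nat rmorphD rmorphM rmorph_nat.
Qed.
End CycTransfer.

Lemma algC_char0 n : n.+1%:R != 0 :> algC.
Proof. by rewrite pnatr_eq0. Qed.

Lemma slope_sumE (F : closedFieldType) (E : weierstrass F) Q j :
  slope_sum E Q j = \sum_(i < j) 2%:R ^+ (j.-1 - i) * slope E (iter i (dbl E) Q).
Proof.
elim: j => [|j IH]; first by rewrite big_ord0.
rewrite /= IH big_ord_recr /= subnn expr0 mul1r mulr_sumr; congr (_ + _).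
apply: eq_bigr => i _; rewrite mulrA -exprS; congr (_ ^+ _ * _).
by have := ltn_ord i; lia.
Qed.

(** Everything that the arithmetic needs from a Lame curve: the cycle of Q on
    its normal form, with P = 2Q in position 1. *)
Lemma lame_data (E : weierstrass algC) P n : odd n -> signature E P n 1 ->
  exists (a : algC) k x y l, [/\ doubling_cycle a 1 k x y l, elliptic E,
    pair_iso E P (deuring a) (Aff (x 1%N) (y 1%N)) &
    forall i, Aff (x i.+1) (y i.+1) = addp (deuring a) (Aff (x i) (y i)) (Aff (x i) (y i))].
Proof.
move=> oddn [Q hl [[_ exQ]|[] //]].
have [ell _ _ _] := hl.
have [onQ QP aff [j j0 [per sum0]]] := lame_cycle algC_char0 hl oddn exQ.
have c2 := algC_char0 1.
have [u [r [s [t [a [u0 ch]]]]]] := deuring_form c2 (algC_char0 2) ell.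
have [Q' eQ] := change_surj r s t u0 Q.
have itE i : iter i (dbl E) Q = point_change u r s t (iter i (dbl (deuring a)) Q').
  by rewrite eQ (change_iter_dbl u0 ch).
have pinj R R' : point_change u r s t R = point_change u r s t R' -> R = R'.
  by move=> e; rewrite -(point_change_inv r s t R u0) e point_change_inv.
have onQ' i : on_curve (deuring a) (iter i (dbl (deuring a)) Q').
  by apply: (change_on_curveV u0 ch); rewrite -itE.
have aff' i : iter i (dbl (deuring a)) Q' <> Inf.
  by move=> e; apply: (aff i); rewrite itE e.
have per' : iter j (dbl (deuring a)) Q' = Q'.
  by apply: pinj; rewrite -itE per eQ.
have sum0' : \sum_(i < j) 2%:R ^+ (j.-1 - i) * slope (deuring a) (iter i (dbl (deuring a)) Q') = 0.
  apply: (mulfI u0); rewrite mulr0 -[RHS]sum0 slope_sumE mulr_sumr.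
  by apply: eq_bigr => i _; rewrite itE (change_slope u0 ch); ring.
have C := cyc_of_dbl onQ' aff' j0 per' c2 sum0'.
have eA i : iter i (dbl (deuring a)) Q' =
  Aff (xcoord (iter i (dbl (deuring a)) Q')) (ycoord (iter i (dbl (deuring a)) Q')).
  by case: (iter i _ Q') (@aff' i).
do 5 eexists; split; first exact: C.
- by [].
- exists u, r, s, t; split=> //; rewrite -QP -[addp E Q Q]/(iter 1 (dbl E) Q) itE.
  by rewrite -eA.
by move=> i; rewrite -!eA.
Qed.

Lemma deuring_j (F : fieldType) (a : F) :
  wdisc (deuring a) = a ^+ 3 - 27%:R /\ jinv (deuring a) = a ^+ 3 * (a ^+ 3 - 24%:R) ^+ 3 / (a ^+ 3 - 27%:R).
Proof.
have e : wdisc (deuring a) = a ^+ 3 - 27%:R.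
  by rewrite /wdisc /wb2 /wb4 /wb6 /wb8 /=; ring.
split=> //; rewrite /jinv e; congr (_ / _).
by rewrite /wc4 /wb2 /wb4 /=; ring.
Qed.

Lemma good_reduction (L : fieldType) (A m : L -> Prop) a k x y l :
  valuation_ring A m -> m 2%:R -> doubling_cycle a 1 k x y l -> A (jinv (deuring a)).
Proof.
move=> V m2 C; have [_ ->] := deuring_j a.
have Aa := vr_max V (cyc_a_max V m2 C).
have Aa3 := vr_exp V 3 Aa.
apply: (vr_mul V); last exact: (vr_inv V (deuring_disc_unit V m2 C)).
apply: (vr_mul V) => //; apply: (vr_exp V); apply: (vr_sub V) => //; exact: (vr_nat V).
Qed.

Lemma alg_algC (z : algC) : exists p : {poly int},
  (exists i, ~~ (2 %| p`_i)%Z) /\ root (map_poly intr p) z.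
Proof. exact: (int_relation (idfun : {rmorphism algC -> algC})). Qed.

Theorem lame_good_reduction (E : weierstrass algC) P n : odd n -> signature E P n 1 ->
  forall pp : algC -> Prop, prime_over 2 pp -> potentially_good_reduction pp E.
Proof.
move=> oddn sg pp hpp; have [a [k [x [y [l [C ell iso _]]]]]] := lame_data oddn sg.
have [_ ej] := jinv_iso ell iso; rewrite /potentially_good_reduction ej.
exact: (good_reduction (valuation_at hpp alg_algC) (max_at2 hpp) C).
Qed.

(** If 2 were in the square of pp, it would be 4 times an element of the
    localization. *)
Lemma ramification_one (L : fieldType) (pp : L -> Prop) :
  prime_over 2 pp ->
  valuation_ring (integral_at pp) (max_at pp) -> 2%:R != 0 :> L ->
  (forall z, max_at pp z -> integral_at pp (z / 2%:R)) ->
  ramification_index 2 pp 1.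
Proof.
move=> hpp V t0 hdiv; have [[pint [p0 padd pmul] p1 pprime] p2] := hpp.
have ptom z : pp z -> max_at pp z.
  by move=> hz; exists z, 1; split; rewrite ?divr1 //; apply: isint1.
split.
  exists 1%N, (fun _ => 2%:R), (fun _ => 1); split=> //=.
  - by move=> _; apply: isint1.
  - by rewrite big_ord1 mulr1.
move=> [n [u [v [hu hv e]]]].
have hv' i : pp (v i).
  have [n' [u' [v' [hu' hv2 ->]]]] := hv i.
  by elim/big_ind: _ => // j _; rewrite mulrC; apply: pmul.
apply: (vm1 V).
have -> : 1 = 2%:R * \sum_i (u i / 2%:R) * (v i / 2%:R) :> L.
  apply: (mulfI t0); rewrite mulr1 {1}e mulrA mulr_sumr; apply: eq_bigr => i _.
  by field.
rewrite mulrC; apply: (vm_mul V); last exact: ptom.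
elim/big_ind: _ => [|z w|i _]; first exact: (vr0 V).
- exact: (vr_add V).
by apply: (vr_mul V); apply: hdiv; apply: ptom.
Qed.

Section Fractions.
Variables (K : fieldExtType rat) (m G : K -> Prop).
Local Notation S := (local_gen m G).
(** The field of fractions of the local ring; it is all of K as soon as
    the generators G generate K over the rationals. *)
Definition fracp (z : K) := exists g h, [/\ S g, S h, h != 0 & z = g / h].

Lemma lg_zero : S 0.
Proof. by rewrite -(subrr 1); apply: lg_sub; apply: lg_one. Qed.
Lemma fracp_base z : S z -> fracp z.
Proof. by move=> h; exists z, 1; split; rewrite ?divr1 ?oner_eq0 //; apply: lg_one. Qed.
Lemma fracp_add z w : fracp z -> fracp w -> fracp (z + w).
Proof.
move=> [g [h [Sg Sh h0 ->]]] [g' [h' [Sg' Sh' h'0 ->]]].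
exists (g * h' - (- (g' * h))), (h * h'); split.
- apply: lg_sub; first exact: lg_mul.
  rewrite -sub0r -(subrr 1); apply: lg_sub; last exact: lg_mul.
  by apply: lg_sub; apply: lg_one.
- exact: lg_mul.
- exact: mulf_neq0.
- by field; rewrite h0 h'0.
Qed.
Lemma fracp_mul z w : fracp z -> fracp w -> fracp (z * w).
Proof.
move=> [g [h [Sg Sh h0 ->]]] [g' [h' [Sg' Sh' h'0 ->]]].
exists (g * g'), (h * h'); split; try exact: lg_mul; first exact: mulf_neq0.
by field; rewrite h0 h'0.
Qed.
Lemma fracp_nat n : fracp n%:R.
Proof.
elim: n => [|n IH]; first exact: (fracp_base lg_zero).
by rewrite -natr1; apply: fracp_add => //; apply: fracp_base; apply: lg_one.
Qed.
Lemma fracp_inv z : fracp z -> fracp z^-1.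
Proof.
move=> [g [h [Sg Sh h0 ->]]]; have [->|g0] := eqVneq g 0.
  by rewrite mul0r invr0; apply: (fracp_nat 0).
by exists h, g; split=> //; rewrite invf_div.
Qed.
Lemma fracp_rat (c : rat) : fracp (c *: 1).
Proof.
have fint (z : int) : fracp z%:~R.
  case: z => n; first exact: fracp_nat.
  rewrite NegzE mulrNz -mulN1r; apply: fracp_mul; last exact: fracp_nat.
  apply: fracp_base; rewrite -sub0r -{1}(subrr 1).
  by do !(apply: lg_sub); apply: lg_one.
have -> : c *: 1 = (numq c)%:~R / (denq c)%:~R :> K.
  have d0 : (denq c)%:~R != 0 :> rat by rewrite intr_eq0 denq_neq0.
  have d0' : (denq c)%:~R != 0 :> K.
    by rewrite -(rmorph_int (in_alg K)) fmorph_eq0.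
  apply: (mulIf d0'); rewrite divfK // -!(rmorph_int (in_alg K)) /= -scalerAl mul1r.
  by rewrite scalerA -{1}(divq_num_den c) divfK.
by apply: fracp_mul; rewrite ?fracp_inv //; apply: fracp_inv || apply: fint; apply: fint.
Qed.

Lemma fracp_adjoin (s : seq K) : (forall z, z \in s -> G z) ->
  forall z, z \in <<1 & s>>%VS -> fracp z.
Proof.
elim/last_ind: s => [|s w IH] hG z.
  by rewrite Fadjoin_nil => /vlineP[c ->]; apply: fracp_rat.
rewrite adjoin_rcons => /Fadjoin_polyP[p pK ->].
have hp i : fracp p`_i.
  by apply: IH => [u us|]; [apply: hG; rewrite mem_rcons in_cons us orbT|apply: (polyOverP pK)].
have hw : fracp w by apply: fracp_base; apply: lg_base; apply: hG; rewrite mem_rcons mem_head.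
rewrite horner_coef; elim/big_ind: _ => [||i _].
- exact: (fracp_nat 0).
- exact: fracp_add.
apply: fracp_mul => //; elim: (nat_of_ord i) => [|n IHn]; first exact: (fracp_nat 1).
by rewrite exprS; apply: fracp_mul.
Qed.
End Fractions.

(** * Fields of definition unramified above 2 *)

Lemma map_deuring (L M : fieldType) (f : {rmorphism L -> M}) a :
  map_weierstrass f (deuring a) = deuring (f a).
Proof. by rewrite /map_weierstrass /= !rmorph0 rmorph1. Qed.

Lemma elliptic_map (L M : fieldType) (f : {rmorphism L -> M}) a :
  elliptic (deuring (f a)) = elliptic (deuring a).
Proof.
rewrite /elliptic !(deuring_j _).1; congr negb.
rewrite -(fmorph_eq0 f) rmorphB rmorphXn; congr (_ - _ == _).
by rewrite rmorph_nat.
Qed.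

(** The number field generated by a and by the coordinates over one period. *)
Lemma cyc_field_of_definition (a : algC) k x y l : doubling_cycle a 1 k x y l ->
  exists (K : fieldExtType rat) (iota : {rmorphism K -> algC}) aK xK yK lK,
  [/\ doubling_cycle aK 1 k xK yK lK, iota aK = a, (forall i, iota (xK i) = x i),
    (forall i, iota (yK i) = y i) &
    forall m : K -> Prop, forall z, fracp m (cyc_gen aK xK yK) z].
Proof.
move=> C; have k0 := cy_k C; pose s := a :: mkseq x k ++ mkseq y k.
have [K [iota [s1 es1 full]]] := num_field_exists s.
have ss1 : size s1 = (k + k).+1.
  by rewrite -(size_map iota) es1 /= size_cat !size_mkseq.
have nthE j : (j < (k + k).+1)%N -> iota (nth 0 s1 j) = nth 0 s j.
  by move=> lt; rewrite -es1 (nth_map 0) // ss1.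
pose aK := nth 0 s1 0; pose xK i := nth 0 s1 (i %% k).+1.
pose yK i := nth 0 s1 (k + i %% k).+1.
pose lK i := (3%:R * xK i ^+ 2 - aK * yK i) / (2%:R * yK i + aK * xK i + 1).
have ea : iota aK = a by rewrite nthE.
have ltm i : (i %% k < k)%N by rewrite ltn_pmod.
have ex i : iota (xK i) = x i.
  rewrite nthE /=; last by rewrite ltnS; apply: (leq_trans (ltm i) (leq_addr _ _)).
  by rewrite nth_cat size_mkseq ltm nth_mkseq // (cyc_mod C i).1.
have ey i : iota (yK i) = y i.
  rewrite nthE /=; last by rewrite ltnS ltn_add2l.
  by rewrite nth_cat size_mkseq ltnNge leq_addr /= addKn nth_mkseq // (cyc_mod C i).2.
have el i : iota (lK i) = l i.
  have eD : iota (2%:R * yK i + aK * xK i + 1) = 2%:R * y i + a * x i + 1.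
    by rewrite !rmorphD !rmorphM rmorph_nat rmorph1 ex ey ea.
  have eN : iota (3%:R * xK i ^+ 2 - aK * yK i) = 3%:R * x i ^+ 2 - a * y i.
    by rewrite rmorphB !rmorphM rmorph_nat ?rmorphXn ex ey ea -?expr2.
  by rewrite /lK rmorphM fmorphV eD eN -(cy_l C) mulfK // (cy_ne C).
exists K, iota, aK, xK, yK, lK; split=> //.
  apply: (@cyc_pull _ _ iota).
  have -> : iota \o xK = x by apply: funext.
  have -> : iota \o yK = y by apply: funext.
  have -> : iota \o lK = l by apply: funext.
  by rewrite rmorph1 [iota aK]ea.
move=> m z; apply: (@fracp_adjoin K m _ s1); last by rewrite full memvf.
move=> w /(nthP 0)[[|j]]; rewrite ss1; first by move=> _ <-; left.
rewrite ltnS => lt <-; right; have [ltk|lek] := ltnP j k.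
  by exists j; left; rewrite /xK modn_small.
exists (j - k)%N; right; rewrite /yK modn_small ?subnKC //.
by rewrite ltn_subLR.
Qed.

Theorem lame_unramified (E : weierstrass algC) P n : odd n -> signature E P n 1 ->
  exists (K : fieldExtType rat) (iota : {rmorphism K -> algC}),
    unramified_above K 2 /\ defined_over iota E P.
Proof.
move=> oddn sg; have [a [k [x [y [l [C ell iso _]]]]]] := lame_data oddn sg.
have [ellD _] := jinv_iso ell iso.
have [K [iota [aK [xK [yK [lK [CK ea ex ey frac]]]]]]] := cyc_field_of_definition C.
exists K, iota; split.
  move=> pp hpp; have V := valuation_at hpp (int_relation iota).
  have t0 : 2%:R != 0 :> K by rewrite -(fmorph_eq0 iota) rmorph_nat algC_char0.
  apply: (ramification_one hpp V t0) => z.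
  exact: (max_div2 V (max_at2 hpp) CK (int_relation iota) (frac _) t0).
exists (deuring aK), (Aff (xK 1%N) (yK 1%N)); split.
- by rewrite -(elliptic_map iota) ea.
- by have := cy_curve CK 1 => /= ->; ring.
by rewrite map_deuring ea /= ex ey.
Qed.

(** * Primes of the algebraic integers and residue classes *)

Lemma half_not_integer (z : algC) : is_integer z -> 2%:R * z <> 1.
Proof.
move=> [p mp rp] e.
have zA : z \in Aint.
  apply: (root_monic_Aint rp); first exact: monic_map.
  by apply/polyOverP => i; rewrite coef_map /= intr_int.
have ez : z = 2%:R^-1 by apply: (mulfI (_ : 2%:R != 0)); rewrite ?pnatr_eq0 // e mulfV ?pnatr_eq0.
have /intrP[c ec] : z \is a Num.int by apply: Cint_rat_Aint => //; rewrite ez rpredV rpred_nat.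
have : (2 * c)%:~R = 1%:~R :> algC by rewrite intrM -ec e.
by move/intr_inj; lia.
Qed.

(** The clause on 1 says that the ideal generated by X and 2 is proper.  The
    empty set qualifies, so that chains need no special case. *)
Definition proper_with_2 (X : algC -> Prop) := [/\ forall x, X x -> is_integer x,
  forall x y, X x -> X y -> X (x + y), forall x y, is_integer x -> X y -> X (x * y)
  & forall x z, X x -> is_integer z -> x + 2%:R * z <> 1].

(** A maximal X as above.  It contains 0 and 2 because they can be adjoined
    (1/2 is not an integer), so it is a maximal ideal; and maximal ideals
    are prime. *)
Lemma exists_prime_over2 : exists pp : algC -> Prop, prime_over 2 pp.
Proof.
have [F FP tot|M [[Mi Ma Mm M1] max]] := @classical_sets.Zorn_bigcup algC proper_with_2.
  split=> [x [X /FP[h _ _ _]] /h //| x y [X FX Xx] [Y FY Yy] | x y ix [Y FY Yy] | x z [X FX Xx]].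
  - have [sub|sub] := tot X Y FX FY; [exists Y|exists X] => //.
      by have [_ h _ _] := FP _ FY; apply: h => //; apply: sub.
    by have [_ h _ _] := FP _ FX; apply: h => //; apply: sub.
  - by exists Y => //; have [_ _ h _] := FP _ FY; apply: h.
  - by have [_ _ _ h] := FP _ FX; apply: h.
have ext X : proper_with_2 X -> (forall x, M x -> X x) -> forall x, X x -> M x.
  move=> PX sub x Xx; apply: contrapT => nM; apply: (max X) => //.
  by split=> // /(_ x Xx).
have i2 := isint_nat algC 2.
have M0 : M 0 /\ M 2%:R.
  pose X x := exists y z, [/\ M y \/ y = 0, is_integer z & x = y + 2%:R * z].
  have PX : proper_with_2 X.
    split.
    - move=> _ [y [z [xY iz ->]]]; apply: isint_add; last exact: isint_mul.
      by case: xY => [/Mi //|->]; apply: isint0.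
    - move=> _ _ [y [z [xY iz ->]]] [y' [z' [hy' iz' ->]]].
      exists (y + y'), (z + z'); split; [|exact: isint_add|ring].
      by case: xY hy' => [xY|->] [hy'|->]; rewrite ?addr0 ?add0r; auto.
    - move=> x _ ix [y [z [xY iz ->]]]; exists (x * y), (x * z); split; [|exact: isint_mul|ring].
      by case: xY => [xY|->]; rewrite ?mulr0; auto.
    - move=> _ w [y [z [xY iz ->]]] iw; rewrite -addrA -mulrDr.
      have izw := isint_add iz iw.
      case: xY => [xY|->]; first exact: M1.
      by rewrite add0r; apply: half_not_integer.
  have sub x : M x -> X x.
    by move=> hx; exists x, 0; split; [left|exact: isint0|rewrite mulr0 addr0].
  split; apply: (ext X PX sub); [exists 0, 0|exists 0, 1]; split; auto using isint0, isint1; ring.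
case: M0 => M0 M2; exists M; split=> //; split=> //.
  by move=> h1; apply: (M1 1 0 h1 (isint0 _)); rewrite mulr0 addr0.
move=> x y ix iy xy; apply: contrapT => /not_orP[nx ny].
pose X w := exists z c, [/\ M z, is_integer c & w = z + c * x].
apply: nx; apply: (ext X); last by exists 0, 1; split=> //; [exact: isint1|ring].
  split.
  - by move=> _ [z [c [hz hc ->]]]; apply: isint_add; [exact: Mi|exact: isint_mul].
  - move=> _ _ [z [c [hz hc ->]]] [z' [c' [hz' hc' ->]]].
    by exists (z + z'), (c + c'); split; [exact: Ma|exact: isint_add|ring].
  - move=> w _ iw [z [c [hz hc ->]]].
    by exists (w * z), (w * c); split; [exact: Mm|exact: isint_mul|ring].
  - move=> _ w [z [c [hz hc ->]]] iw e; apply: ny.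
    have -> : y = y * z + (c * (x * y) + w * y * 2%:R).
      by rewrite -[LHS](mulr1 y) -[in LHS]e; ring.
    by apply: (Ma); [|apply: (Ma)]; apply: Mm => //; apply: isint_mul.
by move=> z hz; exists z, 0; split=> //; [exact: isint0|ring].
Qed.

Section Restriction.
Variables (K L : fieldType) (iota : {rmorphism K -> L}).

Lemma is_integer_map z : is_integer (iota z) <-> is_integer z.
Proof.
have e (p : {poly int}) : map_poly intr p = map_poly iota (map_poly intr p).
  by rewrite -map_poly_comp; apply: eq_map_poly => c /=; rewrite rmorph_int.
by split=> -[p mp rp]; exists p => //; move: rp; rewrite e fmorph_root.
Qed.

Lemma prime_restrict pp : prime_over 2 pp -> prime_over 2 (fun z => pp (iota z)).
Proof.
move=> [[h1 [h2 h3 h4] h5 h6] h7]; split; last by rewrite rmorph_nat.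
split=> [x /h1 /is_integer_map //||h|x y /is_integer_map hx /is_integer_map xY].
- split=> [|x y hx xY|x y /is_integer_map hx xY]; first by rewrite rmorph0.
    by rewrite rmorphD; apply: h3.
  by rewrite rmorphM; apply: h4.
- by apply: h5; rewrite -(rmorph1 iota).
by rewrite rmorphM; apply: h6.
Qed.

Lemma max_at_map pp z : max_at (fun z => pp (iota z)) z -> max_at pp (iota z).
Proof.
move=> [a [b [ha /is_integer_map hb nb ->]]]; exists (iota a), (iota b).
by rewrite fmorph_div.
Qed.
End Restriction.

(** Addition in F_2 computed on representatives, up to an even number. *)
Lemma F2_add (u v : 'F_2) : exists c : bool,
  (nat_of_ord (u + v)%R + 2 * c = nat_of_ord u + nat_of_ord v)%N.
Proof.
by case: u v => [[|[|//]] iu] [[|[|//]] iv]; (by exists false) || by exists true.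
Qed.

Section Residue.
Variables (K : fieldExtType rat) (pp : K -> Prop).
Hypothesis hpp : prime_over 2 pp.
Hypothesis alg : forall x : K, exists p : {poly int},
  (exists i, ~~ (2 %| p`_i)%Z) /\ root (map_poly intr p) x.

Let pmul x y : is_integer x -> pp y -> pp (x * y).
Proof. by case: hpp => -[_ [_ _ h] _ _] _; apply: h. Qed.
Let p0 : pp 0. Proof. by case: hpp => -[_ [h _ _] _ _] _. Qed.
Let padd x y : pp x -> pp y -> pp (x + y).
Proof. by case: hpp => -[_ [_ h _] _ _] _; apply: h. Qed.
Let p2 : pp 2%:R. Proof. by case: hpp. Qed.

(** Linear independence over F_2 of the classes modulo pp. *)
Definition residue_free d (b : 'I_d -> K) := (forall i, is_integer (b i)) /\
  forall c : 'I_d -> 'F_2, pp (\sum_i (nat_of_ord (c i))%:R * b i) -> forall i, c i = 0.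

Lemma residue_add d (b : 'I_d -> K) (c c' : 'I_d -> 'F_2) : (forall i, is_integer (b i)) ->
  pp (\sum_i (nat_of_ord (c i))%:R * b i + \sum_i (nat_of_ord (c' i))%:R * b i
      - \sum_i (nat_of_ord (c i + c' i)%R)%:R * b i).
Proof.
move=> ib; rewrite -big_split -sumrB /=; elim/big_ind: _ => // i _.
have [e he] := F2_add (c i) (c' i).
have -> : (nat_of_ord (c i))%:R * b i + (nat_of_ord (c' i))%:R * b i
   - (nat_of_ord (c i + c' i)%R)%:R * b i = e%:R * b i * 2%:R.
  by rewrite -mulrDl -natrD -he natrD natrM; ring.
by apply: pmul => //; apply: isint_mul => //; apply: isint_nat.
Qed.

Lemma isint_comb d (b : 'I_d -> K) (c : 'I_d -> 'F_2) : (forall i, is_integer (b i)) ->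
  is_integer (\sum_i (nat_of_ord (c i))%:R * b i).
Proof.
move=> ib; elim/big_ind: _ => [|u v|i _]; [exact: isint0|exact: isint_add|].
by apply: isint_mul => //; exact: isint_nat.
Qed.

(** A rational relation between the b_i can be scaled to a primitive integral
    one, and its reduction modulo 2 is then a nontrivial relation modulo pp.
    So the b_i are independent over the rationals. *)
Lemma residue_free_dim d (b : 'I_d -> K) : residue_free b -> (d <= \dim {:K})%N.
Proof.
move=> [ib fb].
pose X := [tuple of mkseq (fun i => if insub i is Some j then b j else 0) d].
suff fX : free X.
  apply: (leq_trans _ (dimvS (subvf <<X>>%VS))).
  by rewrite (eqP (fX : \dim <<X>>%VS == size X)) size_tuple.
apply/freeP => k e.
have {}e : \sum_(i < d) k i *: b i = 0.
  rewrite -[RHS]e; apply: eq_bigr => i _; rewrite nth_mkseq //.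
  by case: insubP => [j _ ej|]; [congr (_ *: b _); apply: val_inj|rewrite ltn_ord].
pose p : {poly rat} := \poly_(i < d) (if insub i is Some j then k j else 0).
have pE (i : 'I_d) : p`_i = k i.
  by rewrite coef_poly ltn_ord; case: insubP => [j _ ej|]; [congr k; apply: val_inj|rewrite ltn_ord].
have [q [a a0 eq]] := rat_poly_scale p.
have [q0|q0] := eqVneq q 0.
  by move=> i; rewrite -pE eq q0 rmorph0 scaler0 coef0.
pose r := zprimitive q; pose s : rat := a%:~R^-1 * (zcontents q)%:~R.
have s0 : s != 0 by rewrite mulf_neq0 ?invr_eq0 ?intr_eq0 ?zcontents_eq0.
have rE j : p`_j = s * (r`_j)%:~R.
  by rewrite eq coefZ coef_map {1}(zpolyEprim q) coefZ /= intrM mulrA.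
have kE i : k i = s * (r`_i)%:~R by rewrite -pE rE.
clearbody s.
have [i odr] : exists i, ~~ (2 %| r`_i)%Z.
  apply: contrapT => h; have : r \is a polyOver (dvdz 2).
    by apply/polyOverP => i; apply: contrapT => hi; apply: h; exists i; exact/negP.
  by rewrite -dvdz_contents zcontents_primitive q0.
have ltid : (i < d)%N.
  rewrite ltnNge; apply: contraNN odr => led; suff -> : r`_i = 0 by [].
  have /esym/eqP := rE i; rewrite [p`_i]nth_default ?(leq_trans (size_poly _ _)) //.
  by rewrite mulf_eq0 (negPf s0) intr_eq0 => /eqP.
have er : \sum_(i < d) (r`_i)%:~R * b i = 0.
  apply: (scalerI s0); rewrite scaler0 -[RHS]e scaler_sumr; apply: eq_bigr => j _.
  by rewrite kE -scalerA; congr (_ *: _); rewrite scaler_int mulrzl.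
pose c (j : 'I_d) : 'F_2 := if (2 %| r`_j)%Z then 0 else 1.
have hc : pp (\sum_j (nat_of_ord (c j))%:R * b j).
  rewrite -[X in pp X]subr0 -[X in _ - X]er -sumrB; elim/big_ind: _ => // j _.
  have [w ew] : exists w : int, (nat_of_ord (c j))%:Z = r`_j + w * 2.
    rewrite /c; have e2 := divz_eq r`_j 2; have g0 := modz_ge0 r`_j (isT : (2 != 0 :> int)).
    have l2 := ltz_pmod r`_j (isT : (0 < 2 :> int)); exists (- (r`_j %/ 2)%Z).
    case: ifP => /= [/dvdz_mod0P m0|/negbT nd]; first by lia.
    have : (r`_j %% 2)%Z != 0 by apply: contra nd => /eqP /dvdz_mod0P.
    rewrite [modn _ _](_ : _ = 1%N) //; by lia.
  have -> : (nat_of_ord (c j))%:R = (r`_j)%:~R + w%:~R * 2%:R :> K.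
    by rewrite -[LHS]/((nat_of_ord (c j))%:Z%:~R) ew intrD intrM.
  rewrite (_ : _ - _ = w%:~R * b j * 2%:R); last by ring.
  by apply: pmul => //; apply: isint_mul => //; apply: isint_int.
by have := fb c hc (Ordinal ltid); rewrite /c /= (negPf odr).
Qed.

(** A maximal independent family spans: by maximality x enters in a relation,
    and its coefficient there is 1. *)
Lemma residue_free_max : exists d (b : 'I_d -> K), residue_free b /\
  forall x, is_integer x -> exists c : {ffun 'I_d -> 'F_2},
    pp (x - \sum_i (nat_of_ord (c i))%:R * b i).
Proof.
have ex0 : exists d, `[< exists b : 'I_d -> K, residue_free b >].
  by exists 0%N; apply/asboolP; exists (fun _ => 0); split=> [[]|c _ []].
have bd d : `[< exists b : 'I_d -> K, residue_free b >] -> (d <= \dim {:K})%N.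
  by move=> /asboolP[b /residue_free_dim].
case: (ex_maxnP ex0 bd) => d /asboolP[b fb] max; exists d, b; split=> // x ix.
have [ib hb] := fb.
pose b' (i : 'I_d.+1) := if unlift ord0 i is Some j then b j else x.
have nfree : ~ residue_free b'.
  by move=> h; have := max d.+1; rewrite ltnn => F; suff: false by []; apply: F; apply/asboolP; exists b'.
have ib' i : is_integer (b' i) by rewrite /b'; case: unliftP.
have [c [hc [i ci]]] : exists c : 'I_d.+1 -> 'F_2,
    pp (\sum_i (nat_of_ord (c i))%:R * b' i) /\ exists i, c i != 0.
  apply: contrapT => h; apply: nfree; split=> // c hc i; apply/eqP/negPn/negP => ci.
  by apply: h; exists c; split=> //; exists i.
pose c1 : {ffun 'I_d -> 'F_2} := [ffun j => c (lift ord0 j)].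
have {}hc : pp ((nat_of_ord (c ord0))%:R * x + \sum_j (nat_of_ord (c1 j))%:R * b j).
  move: hc; rewrite big_ord_recl /b' unlift_none; congr (pp (_ + _)).
  by apply: eq_bigr => j _; rewrite liftK ffunE.
have c0 : c ord0 != 0.
  apply/eqP => c0; move: ci; case: (unliftP ord0 i) => [j|] ->; last by rewrite c0 eqxx.
  have := hb c1 _ j; rewrite ffunE => ->; rewrite ?eqxx //.
  by move: hc; rewrite c0 mul0r add0r.
have c01 : nat_of_ord (c ord0) = 1%N by move: c0; case: (c ord0) => [[|[|]]].
exists c1.
move: hc; rewrite c01 mul1r; set s := \sum_j _ => hc.
have -> : x - s = (x + s) + (- s) * 2%:R by ring.
apply: padd => //; apply: pmul => //; rewrite -sub0r; apply: isint_sub; first exact: isint0.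
exact: isint_comb.
Qed.

Lemma residue_degree_ex : exists d, residue_degree 2 pp d.
Proof.
have [d [b [[ib fb] span]]] := residue_free_max; exists d, b; split=> // x ix.
have [c hc] := span x ix; exists c; split=> // c' hc'; apply/ffunP => i.
apply/eqP; rewrite -subr_eq0; apply/eqP.
have Z2 (u : 'F_2) : - u = u by case: u => [[|[|//]] lt]; apply: val_inj.
rewrite Z2; apply: (fb (fun i => c i + c' i)).
have := residue_add c c' ib; have := isint_comb c ib; move: hc hc'.
set s := \sum_i _; set s' := \sum_i _; set t := \sum_i _ => hc hc' ins h.
have -> : t = (x - s - (x - s')) + s * 2%:R - (s + s' - t) by ring.
by apply: (prime_sub hpp) => //; apply: padd; [apply: (prime_sub hpp)|apply: pmul].
Qed.

(** Multiplying by a common denominator outside pp makes the elements integral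
    and keeps them incongruent; their coordinates in F_2^d are then distinct. *)
Lemma residue_count d N (z : 'I_N -> K) : residue_degree 2 pp d ->
  (forall i, integral_at pp (z i)) -> (forall i j, max_at pp (z i - z j) -> i = j) ->
  (N <= 2 ^ d)%N.
Proof.
move=> [b [ib sp]] Az inc.
have V := valuation_at hpp alg; have [[_ _ p1 pprime] _] := hpp.
have [D [iD0 nD iD]] : exists D, [/\ is_integer D, ~ pp D & forall i, is_integer (D * z i)].
  have [g hg] := choice Az; have [h {}hg] := choice hg.
  have [iD nD] : is_integer (\prod_i h i) /\ ~ pp (\prod_i h i).
    elim/big_ind: _ => [|u v [iu nu] [iv nv]|i _]; first by split=> //; exact: isint1.
      by split; [exact: isint_mul|case/pprime].
    by case: (hg i).
  exists (\prod_i h i); split=> // i; case: (hg i) => ig ih nh ->.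
  have h0 : h i != 0 by apply/eqP => h0; apply: nh; rewrite h0.
  rewrite (bigD1 i) //= mulrAC (mulrC (h i)) divfK // mulrC.
  apply: isint_mul => //; elim/big_ind: _ => [|u v|j _]; [exact: isint1|exact: isint_mul|].
  by case: (hg j).
have [c hc] := choice (fun i => sp _ (iD i)).
have inj : injective c.
  move=> i j e; apply: inc; exists (D * z i - D * z j), D; split=> //.
  - have [[hi _] [hj _]] := (hc i, hc j); rewrite -e in hj.
    by have := prime_sub hpp hi hj; rewrite opprB addrA subrK.
  - have nz : D != 0 by apply/eqP => D0; apply: nD; rewrite D0.
    by field.
have := leq_card c inj; by rewrite card_ffun card_Fp // !card_ord.
Qed.

End Residue.

(** * Rigidity of doubling cycles *)

Section WeightedSums.
Variables (L : fieldType) (c : nat -> L).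
Local Notation S n := (\sum_(i < n) 2%:R ^+ (n.-1 - i) * c i).

Lemma wsumS n : S n.+1 = 2%:R * S n + c n.
Proof.
rewrite big_ord_recr /= subnn expr0 mul1r mulr_sumr; congr (_ + _).
apply: eq_bigr => i _; rewrite mulrA -exprS; congr (_ ^+ _ * _).
by have := ltn_ord i; lia.
Qed.

Lemma wsumD p n : (forall i, c (i + p)%N = c i) -> S (p + n) = 2%:R ^+ n * S p + S n.
Proof.
move=> per; elim: n => [|n IH]; first by rewrite addn0 expr0 mul1r big_ord0 addr0.
by rewrite addnS !wsumS IH addnC per exprS; ring.
Qed.

(** Over q periods the sum is multiplied by a positive integer, and qp is a
    multiple of both periods when q = k. *)
Lemma wsum_period p k : (forall n, n.+1%:R != 0 :> L) ->
  (forall i, c (i + p)%N = c i) -> (forall i, c (i + k)%N = c i) -> (0 < p)%N -> (0 < k)%N ->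
  S k = 0 -> S p = 0.
Proof.
move=> char0 perp perk p0 k0 Sk.
have Skn n : S (n * k)%N = 0.
  elim: n => [|n IH]; first by rewrite mul0n big_ord0.
  by rewrite mulSn wsumD // Sk IH mulr0 addr0.
have [g hg] : exists g, S (k * p)%N = g.+1%:R * S p.
  case: k k0 {Skn Sk perk} => // k _; elim: k => [|k [g IH]].
    by exists 0%N; rewrite mul1n mul1r.
  exists (2 ^ (k.+1 * p) + g)%N; rewrite mulSn wsumD // IH.
  by rewrite -addnS natrD natrX mulrDl.
move: (Skn p); rewrite mulnC hg => /eqP.
by rewrite mulf_eq0 (negPf (char0 g)) => /eqP.
Qed.
End WeightedSums.

(** The opposite points: y becomes - y - a x - 1, and the slope of the
    tangent - l - a. *)
Lemma cyc_neg (L : fieldType) (a : L) k x y l : doubling_cycle a 1 k x y l ->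
  doubling_cycle a 1 k x (fun i => - y i - a * x i - 1) (fun i => - l i - a).
Proof.
move=> C; split; first exact: cy_k C.
- by move=> i; rewrite -(cy_curve C i); ring.
- move=> i; rewrite (_ : _ + 1 = - (2%:R * y i + a * x i + 1)); last by ring.
  by rewrite oppr_eq0 (cy_ne C).
- move=> i; transitivity (l i * (2%:R * y i + a * x i + 1) + a * (2%:R * y i + a * x i + 1)).
    by ring.
  by rewrite (cy_l C); ring.
- by move=> i; rewrite (cy_x C); ring.
- by move=> i; rewrite (cy_y C); ring.
- by move=> i; have [-> ->] := cy_per C i.
rewrite -[RHS]oppr0 -[in RHS](cy_sum C) -sumrN; apply: eq_bigr => i _.
by rewrite -mulrN; congr (_ * _); ring.
Qed.

(** Doubling is a function of the point. *)
Lemma cyc_det (L : fieldType) (a : L) k x y l k' x' y' l' i j :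
  doubling_cycle a 1 k x y l -> doubling_cycle a 1 k' x' y' l' -> x i = x' j -> y i = y' j ->
  x i.+1 = x' j.+1 /\ y i.+1 = y' j.+1.
Proof.
move=> C C' ex ey; have el : l i = l' j.
  by apply: (mulIf (cy_ne C i)); rewrite (cy_l C) ex ey (cy_l C').
by rewrite (cy_y C) (cy_y C') (cy_x C) (cy_x C') el ex ey.
Qed.

Section Rigidity.
Variables (L : fieldType) (A m : L -> Prop).
Hypothesis V : valuation_ring A m.
Hypothesis m2 : m 2%:R.

Lemma vm_prime u v : ~ m u -> m (u * v) -> m v.
Proof.
move=> nu h; rewrite -[v](mulKf (unit_neq0 V m2 nu)); apply: (vm_mul V) => //; exact: (vr_inv V).
Qed.

(** Divisibility is a total preorder on a valuation ring. *)
Lemma valuation_max (s : seq L) : s != [::] -> exists2 g, g \in s &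
  forall u, u \in s -> exists2 c, A c & u = c * g.
Proof.
elim: s => // z s IH _; have [->|/IH [g gs hg]] := eqVneq s [::].
  exists z; first by rewrite inE.
  by move=> u; rewrite inE => /eqP ->; exists 1; rewrite ?mul1r //; exact: (vr1 V).
have [[c Ac ez]|[c Ac eg]] : (exists2 c, A c & z = c * g) \/ (exists2 c, A c & g = c * z).
  have [->|g0] := eqVneq g 0; first by right; exists 0; rewrite ?mul0r //; exact: (vr0 V).
  case: (vr_total V (z / g)) => [h|/(vr_max V) h].
    by left; exists (z / g); rewrite ?divfK.
  have [->|z0] := eqVneq z 0; first by left; exists 0; rewrite ?mul0r //; exact: (vr0 V).
  by right; exists (g / z); [rewrite -invf_div|rewrite divfK].
- exists g; first by rewrite inE gs orbT.
  by move=> u; rewrite inE => /orP[/eqP ->|/hg//]; exists c.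
exists z; first by rewrite mem_head.
move=> u; rewrite inE => /orP[/eqP ->|/hg[d Ad ->]]; first by exists 1; rewrite ?mul1r //; exact: (vr1 V).
by exists (d * c); [exact: (vr_mul V)|rewrite eg mulrA].
Qed.

(** Nakayama's lemma for the ideal generated by s, which is principal. *)
Lemma nakayama (s : seq L) :
  (forall g, (forall u, u \in s -> exists2 c, A c & u = c * g) ->
     forall u, u \in s -> exists2 c, m c & u = c * g) -> forall u, u \in s -> u = 0.
Proof.
move=> h; have [->//|s0] := eqVneq s [::].
have [g gs hg] := valuation_max s0; have [c mc e] := h g hg g gs.
suff g0 : g = 0 by move=> u /hg[d _ ->]; rewrite g0 mulr0.
have : (1 + - c) * g = 0 by rewrite mulrDl mul1r mulNr -e subrr.
move/eqP; rewrite mulf_eq0 (negPf (unit_neq0 V m2 _)) //=; first by move/eqP.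
exact: (vm_1add V (vm_opp V m2 mc)).
Qed.

Definition mults (I : L -> Prop) (g u : L) := exists2 c, I c & u = c * g.

Lemma multsA_add g u v : mults A g u -> mults A g v -> mults A g (u + v).
Proof. by move=> [c hc ->] [d hd ->]; exists (c + d); [exact: (vr_add V)|rewrite mulrDl]. Qed.
Lemma multsA_mul g u v : A u -> mults A g v -> mults A g (u * v).
Proof. by move=> hu [d hd ->]; exists (u * d); [exact: (vr_mul V)|rewrite mulrA]. Qed.
Lemma multsm_add g u v : mults m g u -> mults m g v -> mults m g (u + v).
Proof. by move=> [c hc ->] [d hd ->]; exists (c + d); [exact: (vm_add V m2)|rewrite mulrDl]. Qed.
Lemma multsm_mul g u v : A u -> mults m g v -> mults m g (u * v).
Proof. by move=> hu [d hd ->]; exists (u * d); [exact: (vm_mul V)|rewrite mulrA]. Qed.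
Lemma multsm_mulm g u v : m u -> mults A g v -> mults m g (u * v).
Proof. by move=> hu [d hd ->]; exists (u * d); [exact: (vm_mulr V)|rewrite mulrA]. Qed.
Lemma multsA_unit g u v : ~ m u -> mults A g (u * v) -> mults A g v.
Proof.
move=> nu h; rewrite -[v](mulKf (unit_neq0 V m2 nu)); apply: multsA_mul => //; exact: (vr_inv V).
Qed.
Lemma multsm_unit g u v : ~ m u -> mults m g (u * v) -> mults m g v.
Proof.
move=> nu h; rewrite -[v](mulKf (unit_neq0 V m2 nu)); apply: multsm_mul => //; exact: (vr_inv V).
Qed.

Section Two.
Variables (a a' : L) (k k' : nat) (x y l x' y' l' : nat -> L).
Hypotheses (C : doubling_cycle a 1 k x y l) (C' : doubling_cycle a' 1 k' x' y' l').

Let ma := cyc_a_max V m2 C. Let ma' := cyc_a_max V m2 C'.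
Let Aa := vr_max V ma. Let Aa' := vr_max V ma'.
Let Ax i : A (x i). Proof. exact: (cyc_x_int V m2 C Aa (vr1 V)). Qed.
Let Ax' i : A (x' i). Proof. exact: (cyc_x_int V m2 C' Aa' (vr1 V)). Qed.
Let Ay i : A (y i). Proof. exact: (cyc_y_int V m2 C Aa (vr1 V)). Qed.
Let Ay' i : A (y' i). Proof. exact: (cyc_y_int V m2 C' Aa' (vr1 V)). Qed.
Let Al i : A (l i). Proof. exact: (cyc_l_int V m2 C Aa (vr1 V)). Qed.
Let Al' i : A (l' i). Proof. exact: (cyc_l_int V m2 C' Aa' (vr1 V)). Qed.
Let Aadd' := vr_add V. Let Aopp' := vr_opp V. Let Amul' := vr_mul V. Let Asub' := vr_sub V. Let Anat' := vr_nat V.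
Let Aexp' := vr_exp V. Let A1' := vr1 V.
Let madd' := vm_add V m2. Let mmul' := vm_mul V. Let mopp' := vm_opp V m2. Let mmulr' := vm_mulr V.
Ltac inA := repeat first [done | apply: Asub' | apply: Aopp' | apply: Aadd' | apply: Amul' | apply: Aexp' | apply: Anat'].

(** The difference of the two duplication formulas.  Modulo 2 and a the map is
    x -> x^4, whose derivative vanishes: hence a coefficient c in m. *)
Lemma cyc_contract i j : exists c e, [/\ A e, A c,
   m (x i - x' j) -> m c &
   (1 + (4%:R * x i ^+ 3 + a ^+ 2 * x i ^+ 2 + 2%:R * a * x i)) * (x i.+1 - x' j.+1)
    = c * (x i - x' j) + e * (a - a')].
Proof.
pose X := x i; pose X' := x' j; pose Z' := x' j.+1.
pose c := (X + X') * (X ^+ 2 + X' ^+ 2) - a * (X + X') - 2%:R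
  - Z' * (4%:R * (X ^+ 2 + X * X' + X' ^+ 2) + a ^+ 2 * (X + X') + 2%:R * a).
pose e := - X' ^+ 2 - Z' * ((a + a') * X' ^+ 2 + 2%:R * X').
have [hX hX' hZ'] : [/\ A X, A X' & A Z'] by split; [exact: Ax|exact: Ax'|exact: Ax'].
exists c, e; split.
- by rewrite /e; inA.
- by rewrite /c; inA.
- move=> h; have hs : m (X + X').
    rewrite (_ : X + X' = (X - X') + X' * 2%:R); last by ring.
    by apply: madd' => //; apply: mmul'.
  rewrite /c; apply: madd'; first apply: madd'; first apply: madd'.
  + by apply: mmulr' => //; inA.
  + by apply: mopp'; apply: mmulr' => //; inA.
  + exact: mopp'.
  apply: mopp'; apply: mmul' => //; apply: madd'; first apply: madd'.
  + rewrite (_ : 4%:R = 2%:R * 2%:R); last by ring.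
    by apply: mmulr'; [apply: mmulr'|inA].
  + by apply: mmul' => //; inA.
  + by apply: mmulr'.
have d := cyc_dup C i; have d' := cyc_dup C' j; rewrite -/X -/X' -/Z' in d d' *.
have -> : (1 + (4%:R * X ^+ 3 + a ^+ 2 * X ^+ 2 + 2%:R * a * X)) * (x i.+1 - Z')
  = (X ^+ 4 - a * 1 * X ^+ 2 - 2%:R * 1 ^+ 2 * X)
  - Z' * (1 + (4%:R * X ^+ 3 + a ^+ 2 * X ^+ 2 + 2%:R * a * X)).
  by rewrite -d; ring.
apply/eqP; rewrite -subr_eq0; apply/eqP.
have {}d' : Z' * (4%:R * X' ^+ 3 + a' ^+ 2 * X' ^+ 2 + 2%:R * a' * 1 * X' + 1 ^+ 2)
   - (X' ^+ 4 - a' * 1 * X' ^+ 2 - 2%:R * 1 ^+ 2 * X') = 0 by rewrite d' subrr.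
by rewrite -[RHS]oppr0 -[in RHS]d' /c /e; ring.
Qed.

Let unit_i i : ~ m (1 + (4%:R * x i ^+ 3 + a ^+ 2 * x i ^+ 2 + 2%:R * a * x i)).
Proof.
apply: (vm_1add V); apply: madd'; first apply: madd'.
- rewrite (_ : 4%:R = 2%:R * 2%:R); last by ring.
  by apply: mmulr'; [apply: mmulr'|inA].
- by apply: mmulr'; [apply: (vm_exp V)|inA].
- by apply: mmulr' => //; apply: mmulr'.
Qed.

Lemma cyc_x_congr i j : m (x i - x' j) -> m (x i.+1 - x' j.+1).
Proof.
move=> h; have [c [e [Ae Ac _ eq]]] := cyc_contract i j.
apply: (vm_prime (@unit_i i)); rewrite eq.
apply: madd'; apply: mmul' => //; apply: madd' => //; exact: mopp'.
Qed.

Lemma cyc_x_contract g i j : m (x i - x' j) -> mults A g (x i - x' j) -> mults m g (a - a') ->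
  mults m g (x i.+1 - x' j.+1).
Proof.
move=> h hx ha; have [c [e [Ae Ac /(_ h) mc eq]]] := cyc_contract i j.
apply: (multsm_unit (@unit_i i)); rewrite eq.
by apply: multsm_add; [apply: multsm_mulm|apply: multsm_mul].
Qed.

Let unitY i : ~ m (2%:R * y i + a * x i + 1). Proof. exact: (cyc_unit V m2 C). Qed.

Lemma cyc_l_diff i j : (2%:R * y i + a * x i + 1) * (l i - l' j) =
   (3%:R * (x i + x' j) - l' j * a) * (x i - x' j) - (a + 2%:R * l' j) * (y i - y' j)
   - (y' j + l' j * x' j) * (a - a').
Proof.
have e := cy_l C i; have e' := cy_l C' j.
rewrite mulrBr (mulrC _ (l i)) e; apply/eqP; rewrite -subr_eq0; apply/eqP.
have {}e' : l' j * (2%:R * y' j + a' * x' j + 1) - (3%:R * x' j ^+ 2 - a' * y' j) = 0.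
  by rewrite e' subrr.
by rewrite -[RHS]oppr0 -[in RHS]e'; ring.
Qed.

Lemma cyc_y_congr i j : m (x i - x' j) -> m (y i - y' j) -> m (y i.+1 - y' j.+1).
Proof.
move=> hx xY; have hx1 := cyc_x_congr hx.
have ha : m (a - a') by apply: madd' => //; exact: mopp'.
have hl : m (l i - l' j).
  apply: (vm_prime (@unitY i)); rewrite cyc_l_diff.
  apply: madd'; [apply: madd'; [|apply: mopp']|apply: mopp']; apply: mmul' => //; inA.
rewrite (cy_y C) (cy_y C').
rewrite (_ : _ - _ = - (x i.+1 - x i) * (l i - l' j) - x i.+1 * (a - a')
   - (l' j + a') * (x i.+1 - x' j.+1) - (y i - y' j) + l' j * (x i - x' j)); last by ring.
apply: madd'; [apply: madd'; [apply: madd'; [apply: madd'|]|]|].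
- by apply: mmul' => //; rewrite opprB; inA.
- by apply: mopp'; apply: mmul'.
- by apply: mopp'; apply: mmul' => //; inA.
- exact: mopp'.
by apply: mmul'.
Qed.

(** The equation of the curve is of degree 2 in y. *)
Lemma cyc_y_dichotomy i : m (x i - x' i) ->
  m (y i - y' i) \/ m (y i - (- y' i - a' * x' i - 1)).
Proof.
move=> hx; have [h|h] := pselect (m (y i - y' i)); first by left.
right; apply: (vm_prime h).
have e := cy_curve C i; have e' := cy_curve C' i.
rewrite (_ : _ * _ = (x i ^+ 2 + x i * x' i + x' i ^+ 2) * (x i - x' i)
  - x i * y i * a + x' i * y i * a'); last first.
  have -> : (x i ^+ 2 + x i * x' i + x' i ^+ 2) * (x i - x' i) = x i ^+ 3 - x' i ^+ 3 by ring.
  by rewrite -e -e'; ring.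
by apply: madd'; [apply: madd'; [|apply: mopp']|]; apply: mmul' => //; inA.
Qed.

(** The differences of a, of the x_i and of the y_i generate an ideal I, say
    gA.  The slopes differ by elements of I, so by the sum relation a - a' is
    in 2I; doubling contracts the x_i, so their differences are in mI by
    periodicity; and y_i is then determined modulo mI by the equation of the
    curve, whose derivative in y is a unit.  So I is contained in mI. *)
Lemma cyc_rigid : k = k' -> m (x 0%N - x' 0%N) -> m (y 0%N - y' 0%N) ->
  a = a' /\ forall i, x i = x' i /\ y i = y' i.
Proof.
move=> ek mx0 my0.
have mxy t : m (x t - x' t) /\ m (y t - y' t).
  by elim: t => [|t [hx xY]] //; split; [apply: cyc_x_congr|apply: cyc_y_congr].
pose dx t := x t - x' t; pose dy t := y t - y' t.
pose s := (a - a') :: mkseq dx k ++ mkseq dy k.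
have as_ : a - a' \in s by rewrite mem_head.
have modk t : (t %% k < k)%N by rewrite ltn_pmod ?(cy_k C).
have xs t : dx t \in s.
  rewrite in_cons mem_cat; apply/orP; right; apply/orP; left.
  apply/mapP; exists (t %% k)%N; first by rewrite mem_iota add0n modk.
  by rewrite /dx (cyc_mod C t).1 ek (cyc_mod C' t).1.
have ys t : dy t \in s.
  rewrite in_cons mem_cat; apply/orP; right; apply/orP; right.
  apply/mapP; exists (t %% k)%N; first by rewrite mem_iota add0n modk.
  by rewrite /dy (cyc_mod C t).2 ek (cyc_mod C' t).2.
suff h : forall u, u \in s -> u = 0.
  by split=> [|t]; [|split]; apply/eqP; rewrite -subr_eq0; apply/eqP;
    [exact: h as_|exact: h (xs t)|exact: h (ys t)].
apply: nakayama => g hg.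
have [ga gx gy] : [/\ mults A g (a - a'), forall t, mults A g (x t - x' t)
    & forall t, mults A g (y t - y' t)].
  by split=> [|t|t]; [exact: hg as_|exact: hg (xs t)|exact: hg (ys t)].
have gl t : mults A g (l t - l' t).
  apply: (multsA_unit (@unitY t)); rewrite cyc_l_diff.
  by apply: multsA_add; [apply: multsA_add|]; rewrite -?mulNr; apply: multsA_mul => //; inA.
have Ga : mults m g (a - a').
  have [j ej] : exists j, k = j.+1 by exists k.-1; rewrite prednK ?(cy_k C).
  pose c i := 2%:R * (l i - l' i) + (a - a').
  have gc i : mults A g (c i) by apply: multsA_add => //; apply: multsA_mul.
  have : \sum_(i < k) 2%:R ^+ (k.-1 - i) * c i = 0.
    rewrite -[RHS]subr0 -[X in X - _](cy_sum C) -[X in _ - X](cy_sum C') -ek -sumrB.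
    by apply: eq_bigr => i _; rewrite -mulrBr /c; congr (_ * _); ring.
  rewrite ej wsumS; set S := \sum_(i < j) _ => e.
  rewrite (_ : a - a' = (- 2%:R) * (S + (l j - l' j))); last first.
    by apply/eqP; rewrite -subr_eq0; apply/eqP; rewrite -[RHS]e /c; ring.
  apply: multsm_mulm; first exact: mopp'.
  apply: multsA_add => //; rewrite /S; elim/big_ind: _ => [|u v|i _].
  - by exists 0; rewrite ?mul0r //; exact: (vr0 V).
  - exact: multsA_add.
  by apply: multsA_mul => //; inA.
have Gx t : mults m g (dx t).
  rewrite /dx -(cy_per C t).1 -(cy_per C' t).1 -ek.
  have [j ->] : exists j, k = j.+1 by exists k.-1; rewrite prednK ?(cy_k C).
  by rewrite addnS; apply: cyc_x_contract => //; case: (mxy (t + j)%N).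
have Gy t : mults m g (dy t).
  have [mx my] := mxy t.
  have nu : ~ m (1 + ((y t - y' t) + y' t * 2%:R + x t * a)).
    by apply: (vm_1add V); apply: madd'; [apply: madd' => //|]; apply: mmul'.
  apply: (multsm_unit nu).
  rewrite (_ : _ * _ = (x t ^+ 2 + x t * x' t + x' t ^+ 2 - y' t * a) * dx t
     + (- (y' t * x' t)) * (a - a')).
    by apply: multsm_add; apply: multsm_mul => //; inA.
  rewrite /dx /dy; apply/eqP; rewrite -subr_eq0; apply/eqP.
  have e : (y t ^+ 2 + a * x t * y t + 1 * y t - x t ^+ 3)
    - (y' t ^+ 2 + a' * x' t * y' t + 1 * y' t - x' t ^+ 3) = 0.
    by rewrite (cy_curve C) (cy_curve C') !subrr.
  by rewrite -[RHS]e; ring.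
move=> u; rewrite in_cons mem_cat => /orP[/eqP -> //|/orP[]/mapP[t _ ->]]; [exact: Gx|exact: Gy].
Qed.

End Two.

(** The difference of the two points of the cycle is multiplied by elements of
    m by each doubling, and comes back after a period. *)
Lemma cyc_x_inj a k (x y l : nat -> L) (C : doubling_cycle a 1 k x y l) i j :
  m (x i - x j) -> x i = x j.
Proof.
move=> mij.
have mt t : m (x (t + i)%N - x (t + j)%N).
  by elim: t => [|t IH] //; rewrite !addSn; apply: (cyc_x_congr C C).
pose d t := x (t + i)%N - x (t + j)%N; pose s := mkseq d k.
have ds t : d t \in s.
  apply/mapP; exists (t %% k)%N; first by rewrite mem_iota add0n ltn_pmod ?(cy_k C).
  have e i' : x (t %% k + i')%N = x (t + i')%N.
    by rewrite -(cyc_mod C (t %% k + _)).1 modnDml (cyc_mod C _).1.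
  by rewrite /d !e.
suff h : forall u, u \in s -> u = 0.
  by apply/eqP; rewrite -subr_eq0; apply/eqP; exact: (h _ (ds 0%N)).
apply: nakayama => g hg u /mapP[t _ ->]; have gd t' : mults A g (d t') by apply: hg.
rewrite /d -(cy_per C (t + i)).1 -(cy_per C (t + j)).1 ![(t + _ + k)%N]addnAC.
have [q ->] : exists q, k = q.+1 by exists k.-1; rewrite prednK ?(cy_k C).
rewrite addnS !addSn; apply: (cyc_x_contract C C); [exact: mt|exact: gd|].
by exists 0; rewrite ?mul0r ?subrr //; exact: (vm0 V m2).
Qed.

Lemma cyc_frob_x a k (x y l : nat -> L) (C : doubling_cycle a 1 k x y l) :
  m (x 0%N ^+ (2 ^ (2 * k)) - x 0%N).
Proof.
have [s Ss] := frob_x V m2 C k 0; have [-> _] := cy_per C 0 => ->.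
by rewrite mulrC; apply: (vm_mul V) => //; exact: (gen_integral V m2 C).
Qed.

(** A monic polynomial over the residue field has at most as many roots as its
    degree: divide by X - r_0 and use that m is prime. *)
Lemma roots_mod n (p : {poly L}) (r : 'I_n -> L) : p \is monic -> (forall i, A p`_i) ->
  (forall i, A (r i)) -> (forall i, m p.[r i]) -> (forall i j, m (r i - r j) -> i = j) ->
  (n < size p)%N.
Proof.
elim: n p r => [|n IH] p r mp Ap Ar pr inc.
  by rewrite size_poly_gt0 monic_neq0.
set c := r ord0; pose q := p %/ ('X - c%:P).
have ep : p = q * ('X - c%:P) + (p.[c])%:P by rewrite {1}(divp_eq p ('X - c%:P)) modp_XsubC.
have sp : (1 < size p)%N.
  rewrite ltnNge; apply/negP => /size1_polyC; move: p`_0 => u e; apply: (vm1 V).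
  have := pr ord0; rewrite e hornerC; move: mp; rewrite e monicE lead_coefC => /eqP ->.
  by [].
have sq : size p = (size q).+1.
  have q0 : q != 0.
    by apply: contraTneq sp => q0; rewrite ep q0 mul0r add0r -leqNgt size_polyC_leq1.
  by rewrite size_divp ?polyXsubC_eq0 // size_XsubC subn1 prednK // ltnW.
have coefp i : p`_i.+1 = q`_i - c * q`_i.+1.
  by rewrite {1}ep mulrBr coefD coefB coefMX coefMC coefC /= addr0 mulrC.
have Aq j : forall i, (size q <= i + j)%N -> A q`_i.
  elim: j => [|j IHj] i; first by rewrite addn0 => le; rewrite nth_default //; exact: (vr0 V).
  rewrite addnS -addSn => /IHj Ai; rewrite (_ : q`_i = p`_i.+1 + c * q`_i.+1); last first.
    by rewrite coefp; ring.
  by apply: (vr_add V) => //; apply: (vr_mul V) => //; exact: Ar.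
have mq : q \is monic.
  rewrite monicE lead_coefE; have := mp; rewrite monicE lead_coefE sq /= => /eqP <-.
  have [j ej] : exists j, size q = j.+1.
    by exists (size q).-1; rewrite prednK //; move: sp; rewrite sq.
  by rewrite ej coefp (nth_default _ (_ : size q <= j.+1)%N) ?ej // mulr0 subr0.
rewrite sq ltnS; apply: (IH q (r \o lift ord0)) => //.
- by move=> i; apply: (Aq (size q)); rewrite leq_addl.
- by move=> i; apply: Ar.
- move=> i /=; set z := r _; have nz : ~ m (z - c) by move/inc/eqP; rewrite eq_sym (negPf (neq_lift _ _)).
  apply: (vm_prime nz).
  have -> : (z - c) * q.[z] = p.[z] - p.[c].
    by rewrite {1}ep hornerD hornerM hornerXsubC hornerC; ring.
  by apply: (vm_sub V); apply: pr.
by move=> i j /inc /lift_inj.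
Qed.

End Rigidity.

(** * Finiteness *)

Section MapAddp.
Variables (F G : fieldType) (f : {rmorphism F -> G}) (E : weierstrass F).

Lemma map_addp R S : map_point f (addp E R S) =
  addp (map_weierstrass f E) (map_point f R) (map_point f S).
Proof.
case: R S => [|x1 y1] [|x2 y2] //=.
have -> : (f x1 == f x2) = (x1 == x2) by rewrite (inj_eq (fmorph_inj f)).
have -> : (f y1 + f y2 + f (wa1 E) * f x2 + f (wa3 E) == 0)
    = (y1 + y2 + wa1 E * x2 + wa3 E == 0).
  by rewrite -(fmorph_eq0 f) !rmorphD rmorphM.
case: ifP => // _; case: ifP => _ /=.
  set N := 3%:R * _ + _ + _ - _; set D := 2%:R * _ + _ + _.
  have eN : f N = 3%:R * f x1 ^+ 2 + 2%:R * f (wa2 E) * f x1 + f (wa4 E) - f (wa1 E) * f y1.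
    by rewrite rmorphB !rmorphD !rmorphM !rmorph_nat.
  have eD : f D = 2%:R * f y1 + f (wa1 E) * f x1 + f (wa3 E).
    by rewrite !rmorphD !rmorphM !rmorph_nat.
  rewrite -eN -eD -fmorph_div; move: (N / D) => l; congr Aff.
    by rewrite !rmorphB rmorphD !rmorphM.
  by rewrite !(rmorphB, rmorphM, rmorphN, rmorphD).
rewrite -!rmorphB -fmorph_div; move: (_ / _) => l; congr Aff.
  by rewrite !rmorphB rmorphD !rmorphM.
by rewrite !(rmorphB, rmorphM, rmorphN, rmorphD).
Qed.

Lemma map_dbl R i : map_point f (iter i (dbl E) R) =
  iter i (dbl (map_weierstrass f E)) (map_point f R).
Proof. by elim: i => //= i IH; rewrite /dbl map_addp IH. Qed.
End MapAddp.

Section Period.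
Variables (L : fieldType) (a : L) (k : nat) (x y l : nat -> L).
Hypothesis C : doubling_cycle a 1 k x y l.

Lemma cyc_l_eq i j : x i = x j -> y i = y j -> l i = l j.
Proof.
by move=> ex ey; apply: (mulIf (cy_ne C i)); rewrite (cy_l C) ex ey (cy_l C).
Qed.

(** p doublings change Q into Q or - Q, so 2p doublings fix Q. *)
Lemma cyc_period p : x p = x 0%N -> forall t, x (t + 2 * p)%N = x t /\ y (t + 2 * p)%N = y t.
Proof.
move=> ex; have [ey|ey] : y p = y 0%N \/ y p = - y 0%N - a * x 0%N - 1.
  have e := cy_curve C p; have e0 := cy_curve C 0; rewrite ex -e0 in e.
  have : (y p - y 0%N) * (y p - (- y 0%N - a * x 0%N - 1)) = 0.
    by move/eqP: e; rewrite -subr_eq0 => /eqP e; rewrite -[RHS]e; ring.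
  by move/eqP; rewrite mulf_eq0 !subr_eq0 => /orP[]/eqP; [left|right].
- have h t : x (t + p)%N = x t /\ y (t + p)%N = y t.
    by elim: t => [|t [hx xY]] //; rewrite addSn; apply: (cyc_det C C).
  move=> t; rewrite mul2n -addnn addnA.
  by have [-> ->] := h (t + p)%N.
have h t : x (t + p)%N = x t /\ y (t + p)%N = - y t - a * x t - 1.
  by elim: t => [|t [hx xY]] //; rewrite addSn; apply: (cyc_det C (cyc_neg C)).
move=> t; rewrite mul2n -addnn addnA.
have [-> ->] := h (t + p)%N; have [-> ->] := h t; split=> //; ring.
Qed.

Lemma cyc_reperiod p : (forall n, n.+1%:R != 0 :> L) -> (0 < p)%N ->
  (forall t, x (t + p)%N = x t /\ y (t + p)%N = y t) -> doubling_cycle a 1 p x y l.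
Proof.
move=> char0 p0 per; case: (C) => k0 h1 h2 h3 h4 h5 h6 h7; split=> //.
apply: (wsum_period (c := fun i => 2%:R * l i + a) (k := k) char0) => // i; rewrite (_ : l _ = l i) //; apply: cyc_l_eq.
- by case: (per i).
- by case: (per i).
- by case: (h6 i).
by case: (h6 i).
Qed.

Lemma periods_mul p q : (forall t, x (t + p)%N = x t /\ y (t + p)%N = y t) ->
  forall t, x (t + q * p)%N = x t /\ y (t + q * p)%N = y t.
Proof.
move=> per; elim: q => [|q IH] t; first by rewrite mul0n addn0.
by rewrite mulSn addnA; have [-> ->] := IH (t + p)%N.
Qed.

Variables (A m : L -> Prop).
Hypothesis V : valuation_ring A m.
Hypothesis m2 : m 2%:R.

(** By [cyc_x_inj] the two values are equal, and equality propagates along the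
    whole cycle. *)
Lemma cyc_congr_period i p : m (x (i + p)%N - x i) -> x p = x 0%N.
Proof.
move=> mi; have e := cyc_x_inj V m2 C mi.
have h t : x (t + (i + p))%N = x (t + i)%N.
  elim: t => [|t IH] //; apply: (cyc_x_inj V m2 C).
  by rewrite !addSn; apply: (cyc_x_congr V m2 C C); rewrite IH subrr; exact: (vm0 V m2).
have [j ej] : exists j, (j + i = i * k)%N.
  by exists (i * k - i)%N; rewrite subnK // leq_pmulr // (cy_k C).
have := h j; rewrite addnA ej addnC (cyc_per_mul C i p).1.
by have := (cyc_per_mul C i 0).1; rewrite add0n => -> ->.
Qed.

End Period.

(** The doublings of the model P0 of P are K-rational, and isomorphisms act on
    abscissas by affine maps. *)
Lemma cyc_orbit (K : fieldType) (iota : {rmorphism K -> algC}) (E : weierstrass algC) P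
    (a : algC) (x y : nat -> algC) :
  pair_iso E P (deuring a) (Aff (x 1%N) (y 1%N)) ->
  (forall i, Aff (x i.+1) (y i.+1) = addp (deuring a) (Aff (x i) (y i)) (Aff (x i) (y i))) ->
  defined_over iota E P ->
  exists u r (X : nat -> K), forall i, x i.+1 = u * iota (X i) + r.
Proof.
move=> iso dup [E0 [P0 [_ _ iso0]]].
have [u [r [s [t [u0 ch eP]]]]] := pair_iso_trans (pair_iso_sym iso) iso0.
have it i : Aff (x i.+1) (y i.+1) = iter i (dbl (deuring a)) (Aff (x 1%N) (y 1%N)).
  by elim: i => [|i IH] //=; rewrite -IH.
exists (u ^+ 2), r, (fun i => xcoord (iter i (dbl E0) P0)) => i.
have := it i; rewrite eP (change_iter_dbl u0 ch) -map_dbl.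
by case: (iter i _ P0) => [|v w] //= [-> _].
Qed.

Section Bound.
Variable pp : algC -> Prop.
Hypothesis hpp : prime_over 2 pp.
Let V := valuation_at hpp alg_algC.
Let m2 := max_at2 hpp.
Local Notation A := (integral_at pp).
Local Notation m := (max_at pp).

Variables (K : fieldExtType rat) (iota : {rmorphism K -> algC}) (d : nat).
Hypothesis hd : max_residue_degree K 2 d.

(** The affine map is eliminated by the ratios (X_i - X_0) / (X_1 - X_0), whose
    denominators are units because X_0 and X_1 give incongruent elements. *)
Lemma affine_residue_count N (X : nat -> K) (u r : algC) :
  (forall i, (i < N)%N -> A (u * iota (X i) + r)) ->
  (forall i j, (i < N)%N -> (j < N)%N -> m (u * iota (X i) - u * iota (X j)) -> i = j) ->
  (1 < N)%N -> (N <= 2 ^ d)%N.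
Proof.
move=> Ax inc N1; pose ppK z := pp (iota z).
have hppK : prime_over 2 ppK := prime_restrict iota hpp.
have VK := valuation_at hppK (int_relation iota).
have [d' hd'] := residue_degree_ex hppK.
apply: leq_trans (_ : 2 ^ d' <= _)%N; last by rewrite leq_exp2l //; case: hd => _; apply; eassumption.
have n10 : ~ m (u * iota (X 1%N) - u * iota (X 0%N)) by move=> h; have := inc 1%N 0%N N1 (ltnW N1) h.
have nz := unit_neq0 V m2 n10.
have X10 : X 1%N - X 0%N != 0.
  by apply: contraNneq nz => e; rewrite -mulrBr -rmorphB e rmorph0 mulr0.
have u0 : u != 0 by apply: contraNneq nz => ->; rewrite !mul0r subrr.
pose z (i : 'I_N) := (X i - X 0%N) / (X 1%N - X 0%N).
have zE i : iota (z i) = (u * iota (X i) - u * iota (X 0%N)) / (u * iota (X 1%N) - u * iota (X 0%N)).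
  rewrite -!mulrBr invfM mulrACA mulfV // mul1r fmorph_div !rmorphB //.
apply: (residue_count hppK (int_relation iota) (z := z)) => // [i|i j hij].
  have [->|zi0] := eqVneq (z i) 0; first exact: (vr0 VK).
  case: (vr_total VK (z i)) => // hz; exfalso; apply: (vm1 V).
  have h := max_at_map hz; rewrite fmorphV in h.
  have z0 : iota (z i) != 0 by rewrite fmorph_eq0.
  rewrite -(mulfV z0); apply: (vm_mul V) => //; rewrite zE; apply: (vr_mul V); last exact: (vr_inv V).
  rewrite (_ : _ - _ = (u * iota (X i) + r) - (u * iota (X 0%N) + r)); last by ring.
  by apply: (vr_sub V); apply: Ax => //; apply: ltnW.
suff h : m (u * iota (X i) - u * iota (X j)).
  by apply: val_inj; apply: inc h.
have -> : u * iota (X i) - u * iota (X j) =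
   (u * iota (X 1%N) - u * iota (X 0%N)) * iota (z i - z j).
  by rewrite rmorphB !zE; move: nz; set w := _ - _ => nz; field.
apply: (vm_mul V); last exact: max_at_map.
rewrite (_ : _ - _ = (u * iota (X 1%N) + r) - (u * iota (X 0%N) + r)); last by ring.
by apply: (vr_sub V); apply: Ax => //; apply: ltnW.
Qed.

Definition bound_period := (2 * (2 ^ d)`!)%N.

(** Among 2^d + 1 consecutive x_i starting at x_1, the abscissa of P, two are
    congruent, hence the x_i have a period at most 2^d. *)
Lemma bounded_period (a : algC) k x y l (u r : algC) (X : nat -> K) : doubling_cycle a 1 k x y l ->
  (forall i, x i.+1 = u * iota (X i) + r) -> doubling_cycle a 1 bound_period x y l.
Proof.
move=> C eX.
have Aa := vr_max V (cyc_a_max V m2 C).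
have Ax i : A (x i) by exact: (cyc_x_int V m2 C Aa (vr1 V)).
have [p [p0 lep ep]] : exists p, [/\ (0 < p)%N, (p <= 2 ^ d)%N & x p = x 0%N].
  apply: contrapT => none.
  suff: ((2 ^ d).+1 <= 2 ^ d)%N by rewrite ltnn.
  apply: (@affine_residue_count _ X u r); last by rewrite ltnS expn_gt0.
    by move=> i _; rewrite -eX.
  have aux i j : (i < j)%N -> (j <= 2 ^ d)%N -> ~ m (u * iota (X j) - u * iota (X i)).
    move=> lt le h; apply: none; exists (j - i)%N; split; first by rewrite subn_gt0.
      by rewrite (leq_trans (leq_subr _ _)).
    apply: (cyc_congr_period C V m2 (i := i.+1)).
    rewrite addSn subnKC; last exact: ltnW.
    by rewrite !eX (_ : _ - _ = u * iota (X j) - u * iota (X i)) //; ring.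
  move=> i j li lj h; have [lt|lt|//] := ltngtP i j; exfalso.
    by apply: (aux i j) => //; rewrite -opprB; apply: (vm_opp V m2).
  exact: (aux j i).
apply: (cyc_reperiod C algC_char0); first by rewrite /bound_period muln_gt0 fact_gt0.
have /dvdnP[q ->] : (2 * p %| bound_period)%N.
  by rewrite dvdn_pmul2l // dvdn_fact // p0.
exact: periods_mul (cyc_period C ep).
Qed.

(** Cycles of non-isomorphic curves have incongruent x_0: if the x_0 are
    congruent, then so are the y_0, perhaps after replacing a cycle by its
    opposite, and [cyc_rigid] applies.  So [roots_mod] bounds their number. *)
Lemma lame_bound n (E : 'I_n -> weierstrass algC) (P : 'I_n -> point algC) :
  (forall i, exists N, odd N /\ signature (E i) (P i) N 1) ->
  (forall i, defined_over iota (E i) (P i)) ->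
  (forall i j, pair_iso (E i) (P i) (E j) (P j) -> i = j) ->
  (n <= 2 ^ (2 * bound_period))%N.
Proof.
move=> sg def inj.
have data i : exists w : algC * (nat -> algC) * (nat -> algC) * (nat -> algC),
    let: (a, x, y, l) := w in doubling_cycle a 1 bound_period x y l /\
    pair_iso (E i) (P i) (deuring a) (Aff (x 1%N) (y 1%N)).
  have [N [oddN sgN]] := sg i.
  have [a [k [x [y [l [C _ iso dup]]]]]] := lame_data oddN sgN.
  have [u [r [X eX]]] := cyc_orbit iso dup (def i).
  by exists (a, x, y, l); split=> //; apply: (bounded_period C eX).
have [w hw] := choice data.
pose x0 i := let: (_, x, _, _) := w i in x 0%N : algC.
have N1 : (1 < 2 ^ (2 * bound_period))%N.
  by rewrite -{1}(expn0 2) ltn_exp2l // !muln_gt0 fact_gt0.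
pose p : {poly algC} := 'X^(2 ^ (2 * bound_period)) - 'X.
have sp : size p = (2 ^ (2 * bound_period)).+1.
  by rewrite size_polyDl size_polyXn // size_polyN size_polyX.
rewrite -ltnS -sp; apply: (roots_mod V m2 (p := p) (r := x0)).
- by rewrite monicE lead_coefDl ?lead_coefXn // size_polyXn size_polyN size_polyX.
- by move=> i; rewrite coefB coefXn coefX; apply: (vr_sub V); apply: (vr_nat V).
- move=> i; rewrite /x0; have := hw i; case: (w i) => [[[a x] y] l] [C _].
  exact: (cyc_x_int V m2 C (vr_max V (cyc_a_max V m2 C)) (vr1 V)).
- move=> i; rewrite /x0; have := hw i; case: (w i) => [[[a x] y] l] [C _].
  by rewrite /p hornerD hornerN hornerXn hornerX; apply: (cyc_frob_x V m2 C).
move=> i j; rewrite /x0; have := hw i; have := hw j.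
case: (w i) => [[[a x] y] l]; case: (w j) => [[[a' x'] y'] l'] [C' iso'] [C iso] mx.
have [my|my] := cyc_y_dichotomy V m2 C C' mx; apply: inj.
  have [ea exy] := cyc_rigid V m2 C C' (erefl _) mx my.
  have [ex ey] := exy 1%N; apply: (pair_iso_trans iso).
  by rewrite ea ex ey; apply: pair_iso_sym.
have [ea exy] := cyc_rigid V m2 C (cyc_neg C') (erefl _) mx my.
have [ex ey] := exy 1%N; apply: (pair_iso_trans iso); apply: pair_iso_sym.
apply: (pair_iso_trans iso'); rewrite ea ex ey.
have := pair_iso_neg (deuring a') (Aff (x' 1%N) (y' 1%N)).
by rewrite /opp_point /=.
Qed.

End Bound.

Theorem corollary2p9 :
  (forall (E : weierstrass algC) (P : point algC) (n : nat),
     odd n -> lame_curve E P n -> signature E P n 1 ->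
     (exists (K : fieldExtType rat) (iota : {rmorphism K -> algC}),
        unramified_above K 2 /\ defined_over iota E P) /\
     (forall pp : algC -> Prop,
        prime_over 2 pp -> potentially_good_reduction pp E)) /\
  (exists B : nat -> nat,
     forall (K : fieldExtType rat) (iota : {rmorphism K -> algC}) (d : nat),
       max_residue_degree K 2 d ->
       forall (m : nat) (E : 'I_m -> weierstrass algC)
              (P : 'I_m -> point algC),
         (forall i, exists n : nat,
             [/\ odd n, lame_curve (E i) (P i) n &
                 signature (E i) (P i) n 1]) ->
         (forall i, defined_over iota (E i) (P i)) ->
         (forall i j, pair_iso (E i) (P i) (E j) (P j) -> i = j) ->
         (m <= B d)%N).
Proof.
split=> [E P n oddn _ sg|].
  by split; [exact: lame_unramified oddn sg|exact: lame_good_reduction oddn sg].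
exists (fun d => 2 ^ (2 * bound_period d))%N => K iota d hd m E P sg.
have [pp hpp] := exists_prime_over2.
apply: (lame_bound hpp hd) => i; have [n [oddn _ sgn]] := sg i; by exists n.
Qed.
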